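(* Let $c,d,g,\omega$ be real constants with $c\neq0$, and consider on $S^2$ the equation $$\Delta_{S^2}\psi-2\omega\cos\theta=c\,e^{d\psi}+g\qquad(\ast)$$ for an unknown smooth function $\psi:S^2\to\mathbb{R}$. Let $C=gd$ and $\varpi=\omega d$, and suppose $\varpi\neq0$. Then: (i) if $C<0$, there exists a solution of $(\ast)$ if and only if $cd>0$; (ii) if $C=0$, then $(\ast)$ does not have a solution; (iii) if $0<C<2$, there exists a solution of $(\ast)$ if and only if $cd<0$; (iv) if $C=2$, then $(\ast)$ does not have a solution; (v) if $2<C<13/6$, there exists a solution of $(\ast)$ if $cd<0$ and $$|\varpi|<\frac{2\,(C-2)^{3/2}\sqrt{11-5C}}{9-4C};$$ (vi) if $13/6\le C<4$, there exists a solution of $(\ast)$ if $cd<0$ and $|\varpi|<C-2$.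
   Context: $S^2$ is the unit two-dimensional sphere with its standard round metric and spherical coordinates $(\theta,\varphi)$, where $0\le\theta\le\pi$ is the polar angle and $0\le\varphi<2\pi$ is the longitude. $\Delta_{S^2}=\frac{\partial^2}{\partial\theta^2}+\cot\theta\frac{\partial}{\partial\theta}+\frac{1}{\sin^2\theta}\frac{\partial^2}{\partial\varphi^2}$ is the Laplacian on $S^2$. ''Solution'' means a smooth solution on the whole sphere (no point singularities are allowed). *)

(* Defs.v *)
From Stdlib Require Import Reals Lra List.
From Coquelicot Require Import Coquelicot.
Open Scope R_scope.

Definition R3 : UniformSpace :=
  prod_UniformSpace (prod_UniformSpace R_UniformSpace R_UniformSpace) R_UniformSpace.

Inductive axis : Set := axis_x | axis_y | axis_z.

Definition coord (i : axis) (p : R3) : R :=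
  let '(x, y, z) := p in
  match i with axis_x => x | axis_y => y | axis_z => z end.

Definition set_coord (i : axis) (p : R3) (t : R) : R3 :=
  let '(x, y, z) := p in
  match i with axis_x => (t, y, z) | axis_y => (x, t, z) | axis_z => (x, y, t) end.

Definition partial (i : axis) (F : R3 -> R) (p : R3) : R :=
  Derive (fun t => F (set_coord i p t)) (coord i p).

Definition iter_partial (s : list axis) (F : R3 -> R) : R3 -> R :=
  fold_right partial F s.

(* C^infinity on U.  [Derive] is a total operator, so existence of the partial
   derivatives is required explicitly.  Only used for open U, where the values
   of F off U are irrelevant. *)
Definition smooth_on (U : R3 -> Prop) (F : R3 -> R) : Prop :=
  forall (s : list axis) (p : R3), U p ->
    continuous (iter_partial s F) p /\
    forall i : axis,
      ex_derive (fun t => iter_partial s F (set_coord i p t)) (coord i p).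

Definition on_sphere (p : R3) : Prop :=
  let '(x, y, z) := p in x ^ 2 + y ^ 2 + z ^ 2 = 1.

Definition S2 : Type := {p : R3 | on_sphere p}.

(* Smoothness on the embedded submanifold S2 of R^3: local extendability to a
   smooth function on an open subset of R^3. *)
Definition smooth_S2 (psi : S2 -> R) : Prop :=
  forall p : S2, exists (U : R3 -> Prop) (F : R3 -> R),
    open U /\ U (proj1_sig p) /\ smooth_on U F /\
    forall q : S2, U (proj1_sig q) -> psi q = F (proj1_sig q).

Lemma spherical_on_sphere (theta phi : R) :
  on_sphere (sin theta * cos phi, sin theta * sin phi, cos theta).
Proof.
  unfold on_sphere.
  pose proof (sin2_cos2 theta) as H1; pose proof (sin2_cos2 phi) as H2.
  unfold Rsqr in H1, H2.
  replace ((sin theta * cos phi) ^ 2 + (sin theta * sin phi) ^ 2 + cos theta ^ 2)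
    with (sin theta * sin theta * (sin phi * sin phi + cos phi * cos phi)
          + cos theta * cos theta) by ring.
  rewrite H2; lra.
Qed.

Definition spherical (theta phi : R) : S2 :=
  exist on_sphere (sin theta * cos phi, sin theta * sin phi, cos theta)
    (spherical_on_sphere theta phi).

(* Meaningful for 0 < theta < PI only. *)
Definition laplacian_S2 (psi : S2 -> R) (theta phi : R) : R :=
  Derive_n (fun t => psi (spherical t phi)) 2 theta
  + cos theta / sin theta * Derive (fun t => psi (spherical t phi)) theta
  + / (sin theta) ^ 2 * Derive_n (fun t => psi (spherical theta t)) 2 phi.

(* psi is smooth on the whole sphere, poles included.  The equation is written
   where the coordinate expression of the Laplacian is nonsingular; both sides
   being continuous on S2 for smooth psi, it then holds at the poles as well. *)
Definition is_solution (c d g omega : R) (psi : S2 -> R) : Prop :=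
  smooth_S2 psi /\
  forall theta phi : R, 0 < theta < PI -> 0 <= phi < 2 * PI ->
    laplacian_S2 psi theta phi - 2 * omega * cos theta
    = c * exp (d * psi (spherical theta phi)) + g.

Definition has_solution (c d g omega : R) : Prop :=
  exists psi : S2 -> R, is_solution c d g omega psi.

(* Main.v *)
(** Put u = d psi, C = g d and w = omega d.

    Nonexistence.  In the angles (theta, phi) a smooth function on the sphere is
    a C^2 function on the whole plane, so averages over parallels are C^1 in
    theta and take explicit values at the poles.  Averaging the equation gives
    int (c d e^u + C) = 0, and averaging it against a conformal vector field
    gives, for C = 2, int e^u sin^2 theta = 0 (Kazdan-Warner).  Both are
    Rolle-type contradictions for one function of theta.

    Existence.  An additive constant turns c d into kap = 1 or -1.  For u
    depending on z = 1 + cos theta only, p = z (2 - z) u' satisfies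
    p' = kap e^u + C + 2 w (z - 1).  There is exactly one solution u_a with
    u_a(0) = a that is regular at z = 0, and it is regular at z = 2 as well when
    p vanishes there, that is, when its mass M(a) = int e^{u_a} equals
    -2 kap C.  As M is continuous it suffices to see the mass on both sides of
    this value.  For kap = 1 and C < 0 (where the exponential is cut off and the
    maximum principle removes the cut-off) M is small for low a and large for
    high a.  For kap = -1 one may take w >= 0 by reflection, and uses the
    Pohozaev identity: z (2 - z) e^u + m^2 / 2 - C m has derivative
    e^u ((C - 2) (z - 1) - w z (2 - z)), where m is the mass on [0, z].  If a is
    low, the mass is small or sits near z = 2, so that M - 2 C gets the sign of
    C - 2; if a is high, a bubble of mass almost 4 sits at z = 0 and M - 2 C gets the opposite
    sign as long as C < 4. *)

Require Import Defs.
From Stdlib Require Import Reals Lra Lia List Classical.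
From Coquelicot Require Import Coquelicot.
Open Scope R_scope.

(** * Calculus in one variable *)

(** Two difficulties sit at the poles. The equation for u is singular at z = 0, yet smoothness on
    the sphere asks for smoothness in z up to the pole. Dividing p by z turns it into an average of
    the right-hand side, so a regular solution solves a nonsingular fixed-point equation on both
    sides of z = 0, and each derivative of u yields one more of the average. A function smooth in z
    slightly beyond [0, 2] is then smooth on a slab of R^3 around the sphere. The other difficulty
    is the continuity of M, an improper integral at z = 2: mass might escape into that pole as a
    varies. For kap = 1 the cut-off bounds the integrand. For kap = -1 the density z (2 - z) e^u
    must tend to 0 there, which forces M(a) > 2 C - 2 for every a; once the mass has passed this
    threshold by a margin close to z = 2, the remaining mass is at most a multiple of the density,
    uniformly for nearby a. For kap = -1, C > 0 and w >= 0 the bound u_a <= a - C ln ((2 - z) / 2)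
    is available beforehand, so a cut-off placed above it never acts. *)

Lemma le_of_derive_nonneg (f df : R -> R) (a b : R) :
  a <= b ->
  (forall x, a < x < b -> is_derive f x (df x)) ->
  (forall x, a <= x <= b -> continuous f x) ->
  (forall x, a < x < b -> 0 <= df x) -> f a <= f b.
Proof.
  intros Hab Hd Hc Hp.
  destruct (Req_dec a b) as [<-|Hne]; [lra|].
  (* [MVT_gen] places the mean point only in the closed interval, and nothing is known of [df] at
     the ends; the extension by 0 keeps the sign there. *)
  set (df' := fun x => match Rlt_dec a x, Rlt_dec x b with left _, left _ => df x | _, _ => 0 end).
  destruct (MVT_gen f a b df') as (c & _ & E).
  - rewrite Rmin_left, Rmax_right by lra. intros x Hx. unfold df'.
    destruct (Rlt_dec a x); [|lra]. destruct (Rlt_dec x b); [|lra]. now apply Hd.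
  - rewrite Rmin_left, Rmax_right by lra. intros x Hx.
    apply continuity_pt_filterlim. now apply Hc.
  - assert (0 <= df' c).
    { unfold df'. destruct (Rlt_dec a c); [|lra]. destruct (Rlt_dec c b); [|lra].
      apply Hp; lra. }
    nra.
Qed.

Lemma ge_of_derive_nonpos (f df : R -> R) (a b : R) :
  a <= b ->
  (forall x, a < x < b -> is_derive f x (df x)) ->
  (forall x, a <= x <= b -> continuous f x) ->
  (forall x, a < x < b -> df x <= 0) -> f b <= f a.
Proof.
  intros Hab Hd Hc Hp.
  assert (- f a <= - f b); [|lra].
  apply (le_of_derive_nonneg (fun x => - f x) (fun x => - df x) a b Hab).
  - intros x Hx. apply (is_derive_opp f x (df x)). now apply Hd.
  - intros x Hx. apply (continuous_opp f x). now apply Hc.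
  - intros x Hx. specialize (Hp x Hx). lra.
Qed.

Lemma lt_of_derive_pos (f df : R -> R) (a b : R) :
  a < b ->
  (forall x, a < x < b -> is_derive f x (df x)) ->
  (forall x, a <= x <= b -> continuous f x) ->
  (forall x, a < x < b -> 0 < df x) -> f a < f b.
Proof.
  intros Hab Hd Hc Hp.
  assert (H1 : f a <= f ((a + b) / 2)).
  { apply (le_of_derive_nonneg f df); try lra; intros x Hx;
      [apply Hd|apply Hc|left; apply Hp]; lra. }
  assert (H2 : f ((a + b) / 2) < f b).
  (* Strictness comes from [(a+b)/2, c], which lies strictly inside (a, b), so that the mean point
     cannot be an end. *)
  { set (c := (3 * b + a) / 4).
    assert (H3 : f ((a+b)/2) < f c).
    { destruct (MVT_gen f ((a+b)/2) c df) as (e & He & E); unfold c in *.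
      - intros x; rewrite Rmin_left, Rmax_right by lra. intros; apply Hd; lra.
      - intros x; rewrite Rmin_left, Rmax_right by lra. intros.
        apply continuity_pt_filterlim. apply Hc; lra.
      - rewrite Rmin_left, Rmax_right in He by lra.
        assert (0 < df e) by (apply Hp; lra). nra. }
    assert (f c <= f b).
    { unfold c; apply (le_of_derive_nonneg f df); try lra; intros x Hx;
      [apply Hd|apply Hc|left; apply Hp]; lra. }
    lra. }
  lra.
Qed.

Lemma continuous_of_derive (f : R -> R) (x l : R) : is_derive f x l -> continuous f x.
Proof. intros H. apply (ex_derive_continuous f x). now exists l. Qed.

Lemma continuous_Rdiv (f g : R -> R) (x : R) :
  continuous f x -> continuous g x -> g x <> 0 -> continuous (fun t => f t / g t) x.
Proof.
  intros Hf Hg H0. apply (continuous_mult f (fun t => / g t) x); [exact Hf|].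
  apply (continuous_comp g Rinv); [exact Hg|]. now apply continuous_Rinv.
Qed.

Lemma continuous_RInt_param (f : R -> R -> R) (a b x0 : R) :
  a <= b ->
  (forall t, a <= t <= b -> continuity_2d_pt f x0 t) ->
  locally x0 (fun x => ex_RInt (f x) a b) ->
  continuous (fun x => RInt (f x) a b) x0.
Proof.
  intros Hab Hc Hi.
  apply filterlim_locally. intros eps.
  (* The [+ 1] keeps the denominator positive when a = b. *)
  assert (He : 0 < eps / (2 * (b - a + 1))).
  { apply Rdiv_lt_0_compat; [apply eps|lra]. }
  destruct (uniform_continuity_2d_1d' f a b x0 Hc (mkposreal _ He)) as (d & Hd).
  assert (Hloc : locally x0 (fun x => Rabs (x - x0) < d)) by (exists d; intros y Hy; exact Hy).
  assert (Hi0 := locally_singleton _ _ Hi).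
  generalize (filter_and _ _ Hi Hloc). apply filter_imp. intros x (Hx1 & Hx2).
  change (Rabs (RInt (f x) a b - RInt (f x0) a b) < eps).
  rewrite <- (RInt_minus (V := R_CompleteNormedModule)) by assumption.
  apply Rle_lt_trans with ((b - a) * (eps / (2 * (b - a + 1)))).
  - apply abs_RInt_le_const; [assumption| |].
    + now apply (ex_RInt_minus (V := R_NormedModule)).
    + intros t Ht. left.
      assert (Hd' := cond_pos d). apply Rabs_def2 in Hx2.
      apply (Hd t x0 t x); try lra.
      unfold Rminus. rewrite Rplus_opp_r, Rabs_R0. lra.
  - assert (0 < eps) by apply eps.
    apply Rlt_le_trans with ((b - a + 1) * (eps / (2 * (b - a + 1)))).
    + apply Rmult_lt_compat_r; [exact He|lra].
    + assert (E : (b - a + 1) * (eps / (2 * (b - a + 1))) = eps / 2) by (field; lra).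
      rewrite E. lra.
Qed.

Lemma abs_le_of_derive (f df g dg : R -> R) (a b : R) :
  a <= b ->
  (forall x, a <= x <= b -> is_derive f x (df x)) ->
  (forall x, a <= x <= b -> is_derive g x (dg x)) ->
  (forall x, a <= x <= b -> Rabs (df x) <= dg x) ->
  Rabs (f b - f a) <= g b - g a.
Proof.
  intros Hab Hf Hg Hb.
  assert (H1 : g a - f a <= g b - f b).
  { apply (le_of_derive_nonneg (fun x => g x - f x) (fun x => dg x - df x)); [lra| | |].
    - intros x Hx. apply (is_derive_minus g f); [apply Hg|apply Hf]; lra.
    - intros x Hx. apply (continuous_of_derive _ x (dg x - df x)).
      apply (is_derive_minus g f); [apply Hg|apply Hf]; lra.
    - intros x Hx. assert (H := Hb x ltac:(lra)). apply Rabs_le_between in H. lra. }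
  assert (H2 : g a + f a <= g b + f b).
  { apply (le_of_derive_nonneg (fun x => g x + f x) (fun x => dg x + df x)); [lra| | |].
    - intros x Hx. apply (is_derive_plus g f); [apply Hg|apply Hf]; lra.
    - intros x Hx. apply (continuous_of_derive _ x (dg x + df x)).
      apply (is_derive_plus g f); [apply Hg|apply Hf]; lra.
    - intros x Hx. assert (H := Hb x ltac:(lra)). apply Rabs_le_between in H. lra. }
  apply Rabs_le_between. lra.
Qed.

(** Comparison with a geometric series. The explicit rate serves twice: for the Picard iterates,
    where it makes the convergence uniform in z, and for the limit of a Lipschitz function at a
    pole. *)
Lemma geometric_limit (s : nat -> R) (K : R) :
  (forall n, Rabs (s (S n) - s n) <= K / 2 ^ n) ->
  forall n, Rabs (real (Lim_seq s) - s n) <= 2 * K / 2 ^ n.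
Proof.
  intros H.
  assert (P2 : forall n, 0 < 2 ^ n) by (intros; apply pow_lt; lra).
  assert (K0 : 0 <= K).
  { generalize (H 0%nat) (Rabs_pos (s 1%nat - s 0%nat)). simpl. lra. }
  assert (T : forall n k, Rabs (s (n + k)%nat - s n) <= 2 * K / 2 ^ n - 2 * K / 2 ^ (n + k)).
  { intros n k; induction k as [|k IH].
    - rewrite Nat.add_0_r. unfold Rminus. rewrite !Rplus_opp_r, Rabs_R0. lra.
    - replace (n + S k)%nat with (S (n + k)) by lia.
      replace (s (S (n + k)) - s n) with ((s (S (n + k)) - s (n + k)%nat) + (s (n + k)%nat - s n))
        by ring.
      assert (E : 2 * K / 2 ^ (n + k) = K / 2 ^ (n + k) + 2 * K / 2 ^ S (n + k)).
      { simpl. field. apply Rgt_not_eq, P2. }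
      generalize (Rabs_triang (s (S (n + k)) - s (n + k)%nat) (s (n + k)%nat - s n))
        (H (n + k)%nat). lra. }
  assert (T' : forall n k, Rabs (s (n + k)%nat - s n) <= 2 * K / 2 ^ n).
  { intros n k. assert (0 <= 2 * K / 2 ^ (n + k)).
    { apply Rdiv_le_0_compat; [lra|apply P2]. }
    generalize (T n k). lra. }
  assert (L0 : is_lim_seq (fun n => 2 * K / 2 ^ n) 0).
  { apply (is_lim_seq_ext (fun n => 2 * K * (/ 2) ^ n)).
    - intros n. rewrite pow_inv. reflexivity.
    - replace (Finite 0) with (Rbar_mult (2 * K) 0) by (simpl; f_equal; ring).
      apply is_lim_seq_scal_l. apply is_lim_seq_geom.
      rewrite Rabs_pos_eq; lra. }
  assert (C : ex_finite_lim_seq s).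
  { apply ex_lim_seq_cauchy_corr. intros eps.
    assert (He : 0 < eps / 2) by (generalize (cond_pos eps); lra).
    apply is_lim_seq_spec in L0. destruct (L0 (mkposreal _ He)) as (N & HN).
    specialize (HN N (Nat.le_refl N)). simpl in HN.
    rewrite Rminus_0_r in HN. apply Rabs_def2 in HN.
    exists N. intros n m Hn Hm.
    replace n with (N + (n - N))%nat by lia. replace m with (N + (m - N))%nat by lia.
    replace (s (N + (n - N))%nat - s (N + (m - N))%nat) with
      ((s (N + (n - N))%nat - s N) + - (s (N + (m - N))%nat - s N)) by ring.
    eapply Rle_lt_trans; [apply Rabs_triang|]. rewrite Rabs_Ropp.
    generalize (T' N (n - N)%nat) (T' N (m - N)%nat). lra. }
  destruct C as (l & Hl). rewrite (is_lim_seq_unique _ _ Hl). simpl. intros n.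
  assert (Hl' : is_lim_seq (fun k => Rabs (s (n + k)%nat - s n)) (Rabs (l - s n))).
  { apply (is_lim_seq_abs _ (Finite (l - s n))).
    apply (is_lim_seq_minus' _ _ l (s n)); [|apply is_lim_seq_const].
    apply (is_lim_seq_ext (fun k => s (k + n)%nat)).
    - intros k. f_equal. lia.
    - now apply is_lim_seq_incr_n. }
  apply (is_lim_seq_le _ (fun _ => 2 * K / 2 ^ n) _ (2 * K / 2 ^ n)) in Hl';
    [exact Hl'|intros k; apply T'|apply is_lim_seq_const].
Qed.

Lemma half_pow_lt (K eps : R) : 0 < eps -> exists n, K / 2 ^ n < eps.
Proof.
  intros He.
  assert (L0 : is_lim_seq (fun n => K * (/ 2) ^ n) 0).
  { replace (Finite 0) with (Rbar_mult K 0) by (simpl; f_equal; ring).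
    apply is_lim_seq_scal_l. apply is_lim_seq_geom. rewrite Rabs_pos_eq; lra. }
  apply is_lim_seq_spec in L0. destruct (L0 (mkposreal _ He)) as (N & HN).
  exists N. specialize (HN N (Nat.le_refl N)). simpl in HN.
  rewrite Rminus_0_r, pow_inv in HN. apply Rabs_def2 in HN. apply HN.
Qed.

Lemma eq_of_derive (f g df : R -> R) (a b : R) :
  a <= b ->
  (forall x, a < x < b -> is_derive f x (df x)) ->
  (forall x, a < x < b -> is_derive g x (df x)) ->
  (forall x, a <= x <= b -> continuous f x) ->
  (forall x, a <= x <= b -> continuous g x) ->
  f a = g a -> f b = g b.
Proof.
  intros Hab Hf Hg Cf Cg E.
  assert (D : forall x, a < x < b -> is_derive (fun x => f x - g x) x 0).
  { intros x Hx. replace 0 with (df x - df x) by ring.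
    apply (is_derive_minus f g); auto. }
  assert (Cfg : forall x, a <= x <= b -> continuous (fun x => f x - g x) x).
  { intros x Hx. apply (continuous_minus f g); auto. }
  assert (f a - g a <= f b - g b).
  { apply (le_of_derive_nonneg (fun x => f x - g x) (fun _ => 0)); auto. intros; lra. }
  assert (f b - g b <= f a - g a).
  { apply (ge_of_derive_nonpos (fun x => f x - g x) (fun _ => 0)); auto. intros; lra. }
  lra.
Qed.

Lemma continuous_eps (f : R -> R) (x eps : R) :
  continuous f x -> 0 < eps ->
  exists d, 0 < d /\ forall y, x - d < y < x + d -> Rabs (f y - f x) < eps.
Proof.
  intros Hf He.
  destruct (proj1 (filterlim_locally f (f x)) Hf (mkposreal eps He)) as (d & Hd).
  exists d. split; [apply d|]. intros y Hy. apply Hd.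
  change (Rabs (y - x) < d). apply Rabs_def1; lra.
Qed.

Lemma continuous_Rplus (f g : R -> R) x :
  continuous f x -> continuous g x -> continuous (fun t => f t + g t) x.
Proof. exact (continuous_plus f g x). Qed.
Lemma continuous_Rminus (f g : R -> R) x :
  continuous f x -> continuous g x -> continuous (fun t => f t - g t) x.
Proof. exact (continuous_minus f g x). Qed.
Lemma continuous_Ropp (f : R -> R) x :
  continuous f x -> continuous (fun t => - f t) x.
Proof. exact (continuous_opp f x). Qed.
Lemma continuous_Rmult (f g : R -> R) x :
  continuous f x -> continuous g x -> continuous (fun t => f t * g t) x.
Proof. exact (continuous_mult f g x). Qed.
Lemma continuous_exp_comp (f : R -> R) x :
  continuous f x -> continuous (fun t => exp (f t)) x.
Proof. intros H. apply (continuous_comp f exp); [exact H|apply continuous_exp]. Qed.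
Lemma continuous_Rpow (f : R -> R) n x :
  continuous f x -> continuous (fun t => f t ^ n) x.
Proof.
  intros H; induction n as [|n IH]; simpl; [apply continuous_const|].
  now apply continuous_Rmult.
Qed.
Lemma continuous_Rabs_comp (f : R -> R) x :
  continuous f x -> continuous (fun t => Rabs (f t)) x.
Proof. intros H. apply (continuous_comp f Rabs); [exact H|apply continuous_Rabs]. Qed.

Lemma Rmin_Rabs (a b : R) : Rmin a b = (a + b - Rabs (a - b)) / 2.
Proof. unfold Rmin, Rabs. destruct (Rle_dec a b), (Rcase_abs (a - b)); lra. Qed.

Ltac cont :=
  repeat first
    [ assumption | apply continuous_const | apply continuous_id
    | apply continuous_Rplus | apply continuous_Rminus | apply continuous_Ropp
    | apply continuous_Rmult | apply continuous_exp_comp | apply continuous_Rpow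
    | apply continuous_Rabs_comp ].

Lemma continuous_Rmin_comp (f g : R -> R) x :
  continuous f x -> continuous g x -> continuous (fun t => Rmin (f t) (g t)) x.
Proof.
  intros Hf Hg.
  apply (continuous_ext (fun t => (f t + g t - Rabs (f t - g t)) * / 2)).
  - intros t. now rewrite Rmin_Rabs.
  - cont.
Qed.

Lemma locally_open_interval (l r x : R) : l < x < r -> locally x (fun y => l < y < r).
Proof.
  intros H. apply filter_and; [apply (open_gt l)|apply (open_lt r)]; lra.
Qed.

(** For k = 0 this is the mean of g between 0 and y, in a form that stays meaningful at y = 0 and
    for y < 0. The weight [s ^ k] collects the factors s produced by differentiating [g (y * s)] in
    y, so that the family is closed under derivatives. *)
Definition avgk (k : nat) (g : R -> R) (y : R) : R :=
  RInt (fun s => s ^ k * g (y * s)) 0 1.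

Lemma scaled_in_ball (r y s : R) : -r < y < r -> 0 <= s <= 1 -> -r < y * s < r.
Proof. intros; split; nra. Qed.

Lemma ex_RInt_avgk (r : R) (k : nat) (g : R -> R) (y : R) :
  (forall t, -r < t < r -> continuous g t) -> -r < y < r ->
  ex_RInt (fun s => s ^ k * g (y * s)) 0 1.
Proof.
  intros Hg Hy. apply (ex_RInt_continuous (V := R_CompleteNormedModule)).
  rewrite Rmin_left, Rmax_right by lra. intros s Hs.
  apply continuous_Rmult; [cont|].
  apply (continuous_comp (fun s => y * s) g); [cont|].
  apply Hg. now apply scaled_in_ball.
Qed.

Lemma continuity_2d_avgk (r : R) (k : nat) (g : R -> R) (y s : R) :
  (forall t, -r < t < r -> continuous g t) -> -r < y < r -> 0 <= s <= 1 ->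
  continuity_2d_pt (fun y s => s ^ k * g (y * s)) y s.
Proof.
  intros Hg Hy Hs. apply continuity_2d_pt_mult.
  - apply (continuity_1d_2d_pt_comp (fun s => s ^ k) (fun y s => s)).
    + apply continuity_pt_filterlim, (continuous_Rpow (fun x => x)), continuous_id.
    + apply continuity_2d_pt_id2.
  - apply (continuity_1d_2d_pt_comp g (fun y s => y * s)).
    + apply continuity_pt_filterlim, Hg. now apply scaled_in_ball.
    + apply continuity_2d_pt_mult; [apply continuity_2d_pt_id1|apply continuity_2d_pt_id2].
Qed.

Lemma continuous_avgk (r : R) (k : nat) (g : R -> R) (y : R) :
  (forall t, -r < t < r -> continuous g t) -> -r < y < r ->
  continuous (avgk k g) y.
Proof.
  intros Hg Hy.
  apply (continuous_RInt_param (fun y s => s ^ k * g (y * s)) 0 1 y); [lra| |].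
  - intros t Ht. now apply (continuity_2d_avgk r).
  - generalize (locally_open_interval (-r) r y Hy). apply filter_imp. intros z Hz.
    now apply (ex_RInt_avgk r).
Qed.

Lemma is_derive_avgk (r : R) (k : nat) (g g' : R -> R) (y : R) :
  (forall t, -r < t < r -> is_derive g t (g' t)) ->
  (forall t, -r < t < r -> continuous g' t) -> -r < y < r ->
  is_derive (avgk k g) y (avgk (S k) g' y).
Proof.
  intros Hd Hc Hy.
  assert (Hg : forall t, -r < t < r -> continuous g t).
  { intros t Ht. now apply (continuous_of_derive g t (g' t)), Hd. }
  assert (D : forall z s, -r < z * s < r ->
            is_derive (fun u => s ^ k * g (u * s)) z (s ^ S k * g' (z * s))).
  { intros z s Hzs.
    assert (H1 : is_derive g (z * s) (g' (z * s))) by now apply Hd.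
    assert (H2 : is_derive (fun u => g (u * s)) z (s * g' (z * s))).
    { apply (is_derive_comp g (fun u => u * s)); [exact H1|].
      auto_derive; [trivial|ring]. }
    replace (s ^ S k * g' (z * s)) with (s ^ k * (s * g' (z * s))) by (simpl; ring).
    now apply (is_derive_scal (fun u => g (u * s))). }
  unfold avgk at 2.
  rewrite (RInt_ext (fun s => s ^ S k * g' (y * s))
             (fun s => Derive (fun u => s ^ k * g (u * s)) y)).
  2: { rewrite Rmin_left, Rmax_right by lra. intros s Hs. symmetry.
       apply is_derive_unique, D, scaled_in_ball; lra. }
  apply (is_derive_RInt_param (fun u s => s ^ k * g (u * s)) 0 1 y).
  - generalize (locally_open_interval (-r) r y Hy). apply filter_imp. intros z Hz t.
    rewrite Rmin_left, Rmax_right by lra. intros Ht.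
    eexists. now apply D, scaled_in_ball.
  - rewrite Rmin_left, Rmax_right by lra. intros s Hs.
    apply continuity_2d_pt_ext_loc with (fun u v => v ^ S k * g' (u * v));
      [|now apply (continuity_2d_avgk r)].
    assert (Hm : continuity_2d_pt (fun u v => u * v) y s).
    { apply continuity_2d_pt_mult; [apply continuity_2d_pt_id1|apply continuity_2d_pt_id2]. }
    assert (Hys := scaled_in_ball r y s Hy Hs).
    assert (He : 0 < Rmin (y * s + r) (r - y * s)) by (apply Rmin_pos; lra).
    destruct (Hm (mkposreal _ He)) as (d & Hdl). exists d. intros u v Hu Hv.
    specialize (Hdl u v Hu Hv). simpl in Hdl. apply Rabs_def2 in Hdl.
    assert (H1 := Rmin_l (y * s + r) (r - y * s)).
    assert (H2 := Rmin_r (y * s + r) (r - y * s)).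
    symmetry. apply is_derive_unique, D. lra.
  - generalize (locally_open_interval (-r) r y Hy). apply filter_imp. intros z Hz.
    now apply (ex_RInt_avgk r).
Qed.

Lemma avgk0_mult (r : R) (g : R -> R) (y : R) :
  (forall t, -r < t < r -> continuous g t) -> -r < y < r ->
  y * avgk 0 g y = RInt g 0 y.
Proof.
  intros Hg Hy. unfold avgk.
  assert (HI : ex_RInt g (y * 0 + 0) (y * 1 + 0)).
  { apply (ex_RInt_continuous (V := R_CompleteNormedModule)). intros z Hz. apply Hg.
    replace (y * 0 + 0) with 0 in Hz by ring. replace (y * 1 + 0) with y in Hz by ring.
    unfold Rmin, Rmax in Hz. destruct (Rle_dec 0 y); lra. }
  generalize (RInt_comp_lin g y 0 0 1 HI).
  replace (y * 0 + 0) with 0 by ring. replace (y * 1 + 0) with y by ring.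
  intros <-. rewrite <- (RInt_scal (V := R_CompleteNormedModule)).
  - apply RInt_ext. intros s _. unfold scal; simpl. unfold mult; simpl.
    rewrite Rplus_0_r. ring.
  - apply (ex_RInt_avgk r 0 g y Hg Hy).
Qed.

(** Derivatives are existential witnesses, constrained only on the open interval; closure under
    products, exponentials and averages then goes by induction without computing any [Derive]. *)
Fixpoint Cn_on (n : nat) (l r : R) (f : R -> R) : Prop :=
  match n with
  | O => forall x, l < x < r -> continuous f x
  | S n => exists f', (forall x, l < x < r -> is_derive f x (f' x)) /\ Cn_on n l r f'
  end.

Lemma Cn_on_ext n l r f g :
  (forall x, l < x < r -> f x = g x) -> Cn_on n l r f -> Cn_on n l r g.
Proof.
  intros E.
  assert (EL : forall x, l < x < r -> locally x (fun y => f y = g y)).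
  { intros x Hx. generalize (locally_open_interval l r x Hx). apply filter_imp. exact E. }
  destruct n as [|n]; simpl.
  - intros H x Hx. apply (continuous_ext_loc _ f); [now apply EL|now apply H].
  - intros (f' & Hf & Hn). exists f'. split; [|exact Hn]. intros x Hx.
    apply (is_derive_ext_loc f); [now apply EL|now apply Hf].
Qed.

Lemma Cn_on_continuous n l r f : Cn_on n l r f -> forall x, l < x < r -> continuous f x.
Proof.
  destruct n as [|n]; [easy|]. intros (f' & Hf & _) x Hx.
  now apply (continuous_of_derive f x (f' x)), Hf.
Qed.

Lemma Cn_on_pred n l r f : Cn_on (S n) l r f -> Cn_on n l r f.
Proof.
  revert f; induction n as [|n IH]; intros f H.
  - intros x Hx. now apply (Cn_on_continuous _ _ _ _ H).
  - destruct H as (f' & Hf & Hn). exists f'. split; [exact Hf|]. now apply IH.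
Qed.

Lemma Cn_on_const n l r c : Cn_on n l r (fun _ => c).
Proof.
  revert c; induction n as [|n IH]; intros c; simpl.
  - intros; apply continuous_const.
  - exists (fun _ => 0). split; [intros; apply (is_derive_const c)|apply IH].
Qed.

Lemma Cn_on_id n l r : Cn_on n l r (fun x => x).
Proof.
  destruct n as [|n]; simpl.
  - intros; apply continuous_id.
  - exists (fun _ => 1). split; [intros; apply (is_derive_id x)|apply Cn_on_const].
Qed.

Lemma Cn_on_plus n l r f g :
  Cn_on n l r f -> Cn_on n l r g -> Cn_on n l r (fun x => f x + g x).
Proof.
  revert f g; induction n as [|n IH]; intros f g Hf Hg.
  - intros x Hx. apply continuous_Rplus; [now apply Hf|now apply Hg].
  - destruct Hf as (f' & Hf & Hf'), Hg as (g' & Hg & Hg').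
    exists (fun x => f' x + g' x). split; [|now apply IH].
    intros x Hx. apply (is_derive_plus f g); [now apply Hf|now apply Hg].
Qed.

Lemma Cn_on_mult n l r f g :
  Cn_on n l r f -> Cn_on n l r g -> Cn_on n l r (fun x => f x * g x).
Proof.
  revert f g; induction n as [|n IH]; intros f g Hf Hg.
  - intros x Hx. apply continuous_Rmult; [now apply Hf|now apply Hg].
  - assert (Hf0 := Cn_on_pred _ _ _ _ Hf). assert (Hg0 := Cn_on_pred _ _ _ _ Hg).
    destruct Hf as (f' & Hf & Hf'), Hg as (g' & Hg & Hg').
    exists (fun x => f' x * g x + f x * g' x). split.
    + intros x Hx. apply (is_derive_mult f g); [now apply Hf|now apply Hg|].
      intros; apply Rmult_comm.
    + apply Cn_on_plus; now apply IH.
Qed.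

Lemma Cn_on_exp n l r f : Cn_on n l r f -> Cn_on n l r (fun x => exp (f x)).
Proof.
  revert f; induction n as [|n IH]; intros f Hf.
  - intros x Hx. apply continuous_exp_comp. now apply Hf.
  - assert (Hf0 := Cn_on_pred _ _ _ _ Hf). destruct Hf as (f' & Hf & Hf').
    exists (fun x => f' x * exp (f x)). split.
    + intros x Hx. apply (is_derive_comp exp f); [apply is_derive_exp|now apply Hf].
    + apply Cn_on_mult; [exact Hf'|now apply IH].
Qed.

Lemma Cn_on_inv n l r f :
  (forall x, l < x < r -> f x <> 0) -> Cn_on n l r f -> Cn_on n l r (fun x => / f x).
Proof.
  intros H0. induction n as [|n IH]; intros Hf.
  - intros x Hx. apply (continuous_comp f Rinv); [now apply Hf|].
    now apply continuous_Rinv, H0.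
  - assert (Hf0 := IH (Cn_on_pred _ _ _ _ Hf)). destruct Hf as (f' & Hf & Hf').
    exists (fun x => -1 * (f' x * (/ f x * / f x))). split.
    + intros x Hx. replace (-1 * (f' x * (/ f x * / f x))) with (- f' x / f x ^ 2)
        by (field; now apply H0).
      apply is_derive_inv; [now apply Hf|now apply H0].
    + apply Cn_on_mult; [apply Cn_on_const|].
      repeat apply Cn_on_mult; assumption.
Qed.

Lemma Cn_on_avgk n k r g : Cn_on n (-r) r g -> Cn_on n (-r) r (avgk k g).
Proof.
  revert k g; induction n as [|n IH]; intros k g Hg.
  - intros x Hx. now apply (continuous_avgk r).
  - destruct Hg as (g' & Hg & Hg'). exists (avgk (S k) g'). split; [|now apply IH].
    intros x Hx. apply (is_derive_avgk r); [exact Hg| |exact Hx].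
    now apply (Cn_on_continuous n).
Qed.

Lemma Cn_on_affine n l r l' r' a b f :
  (forall x, l' < x < r' -> l < a * x + b < r) ->
  Cn_on n l r f -> Cn_on n l' r' (fun x => f (a * x + b)).
Proof.
  intros Hi; revert f; induction n as [|n IH]; intros f Hf.
  - intros x Hx. apply (continuous_comp (fun x => a * x + b) f); [cont|now apply Hf, Hi].
  - destruct Hf as (f' & Hf & Hf'). exists (fun x => a * f' (a * x + b)). split.
    + intros x Hx. apply (is_derive_comp f (fun x => a * x + b)).
      * now apply Hf, Hi.
      * auto_derive; [trivial|ring].
    + apply Cn_on_mult; [apply Cn_on_const|now apply IH].
Qed.

Lemma Cn_on_ex_derive_n n l r f x :
  Cn_on n l r f -> l < x < r -> ex_derive_n f n x.
Proof.
  revert f x; induction n as [|n IH]; intros f x Hf Hx; [exact I|].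
  destruct Hf as (f' & Hf & Hf').
  destruct n as [|n]; [simpl; eexists; now apply Hf|].
  assert (H := IH f' x Hf' Hx). simpl in H. simpl.
  apply ex_derive_ext_loc with (Derive_n f' n); [|exact H].
  generalize (locally_open_interval l r x Hx). apply filter_imp. intros y Hy.
  change (Derive (Derive_n f n) y) with (Derive_n f (S n) y).
  (* [Derive_n] adds the new derivative on the outside, [Cn_on] on the inside; [Derive_n_comp]
     exchanges the two. *)
  replace (S n) with (n + 1)%nat by lia. rewrite <- Derive_n_comp.
  apply Derive_n_ext_loc.
  generalize (locally_open_interval l r y Hy). apply filter_imp. intros z Hz. symmetry. now apply is_derive_unique, Hf.
Qed.

(** * The initial value problem at a pole *)

(** The interval extends to the left of the pole z = 0 so that solutions can be followed across it.
    The Lipschitz constant may depend on r because the cut-off height used for kap = -1 tends to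
    infinity at t = 2. *)
Definition admissible (F : R -> R -> R) : Prop :=
  (forall u, (forall t, -2 < t < 2 -> continuous u t) ->
     forall t, -2 < t < 2 -> continuous (fun t => F t (u t)) t) /\
  (forall r, 0 < r < 2 -> exists Lam, 0 < Lam /\ forall t v w, -r <= t <= r ->
     Rabs (F t v - F t w) <= Lam * Rabs (v - w)).

(* A fixed point of [picard F a] is a solution of
   (z (2 - z) u')' = F z u with u 0 = a that is regular at z = 0:
   there z (2 - z) u' z = RInt (F u) 0 z, and dividing by z turns the integral
   into an average, which makes sense for z <= 0 as well. *)
Definition picard (F : R -> R -> R) (a : R) (u : R -> R) (z : R) : R :=
  a + RInt (fun y => avgk 0 (fun t => F t (u t)) y / (2 - y)) 0 z.

Lemma is_derive_picard F a u z :
  admissible F -> (forall t, -2 < t < 2 -> continuous u t) -> -2 < z < 2 ->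
  is_derive (picard F a u) z (avgk 0 (fun t => F t (u t)) z / (2 - z)).
Proof.
  intros (HF & _) Hu Hz. specialize (HF u Hu).
  assert (Hc : forall y, -2 < y < 2 ->
            continuous (fun y => avgk 0 (fun t => F t (u t)) y / (2 - y)) y).
  { intros y Hy. apply continuous_Rdiv; [now apply (continuous_avgk 2)|cont|lra]. }
  replace (avgk 0 (fun t => F t (u t)) z / (2 - z)) with
    (0 + avgk 0 (fun t => F t (u t)) z / (2 - z)) by ring.
  apply (is_derive_plus (fun _ => a)); [apply (is_derive_const a)|].
  apply (is_derive_RInt (fun y => avgk 0 (fun t => F t (u t)) y / (2 - y)) _ 0).
  - generalize (locally_open_interval (-2) 2 z Hz). apply filter_imp. intros x Hx.
    apply (RInt_correct (V := R_CompleteNormedModule)).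
    apply (ex_RInt_continuous (V := R_CompleteNormedModule)). intros y Hy. apply Hc.
    unfold Rmin, Rmax in Hy. destruct (Rle_dec 0 x); lra.
  - now apply Hc.
Qed.

Lemma picard_0 F a u : picard F a u 0 = a.
Proof. unfold picard. rewrite RInt_point. unfold zero; simpl. ring. Qed.

Lemma continuous_picard F a u z :
  admissible F -> (forall t, -2 < t < 2 -> continuous u t) -> -2 < z < 2 ->
  continuous (picard F a u) z.
Proof.
  intros HF Hu Hz. eapply continuous_of_derive. now apply is_derive_picard.
Qed.

Lemma exp_le_compat x y : x <= y -> exp x <= exp y.
Proof. intros [H| ->]; [left; now apply exp_increasing|right; reflexivity]. Qed.

(* The weight exp (lam |z|) makes [picard] a contraction on all of [l, r]. *)
Lemma picard_contraction F rho :
  admissible F -> 0 < rho < 2 ->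
  exists lam, 0 < lam /\ forall a b u v l r D,
    (forall t, -2 < t < 2 -> continuous u t) ->
    (forall t, -2 < t < 2 -> continuous v t) ->
    -rho <= l <= 0 -> 0 <= r <= rho -> 0 <= D ->
    (forall z, l <= z <= r -> Rabs (u z - v z) <= D * exp (lam * Rabs z)) ->
    forall z, l <= z <= r ->
      Rabs (picard F a u z - picard F b v z) <= Rabs (a - b) + D / 2 * exp (lam * Rabs z).
Proof.
  intros HF Hrho. destruct (proj2 HF rho Hrho) as (Lam & HLam & HL).
  (* The derivative of the difference is at most Lam D e^(lam |z|) / (2 - rho), which for this
     weight is half the derivative of D e^(lam |z|) in |z|. *)
  exists (2 * Lam / (2 - rho)). split; [apply Rdiv_lt_0_compat; lra|].
  set (lam := 2 * Lam / (2 - rho)).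
  assert (Hlam : 0 < lam) by (apply Rdiv_lt_0_compat; lra).
  intros a b u v l r D Hu Hv Hl Hr HD Huv.
  set (fu := fun t => F t (u t)). set (fv := fun t => F t (v t)).
  assert (Hfu := proj1 HF u Hu). assert (Hfv := proj1 HF v Hv).
  fold fu in Hfu; fold fv in Hfv.
  assert (HA : forall z, l <= z <= r ->
     Rabs (avgk 0 fu z / (2 - z) - avgk 0 fv z / (2 - z)) <= D / 2 * (lam * exp (lam * Rabs z))).
  { intros z Hz.
    assert (Hz2 : -2 < z < 2) by lra.
    assert (HA : Rabs (avgk 0 fu z - avgk 0 fv z) <= Lam * (D * exp (lam * Rabs z))).
    { unfold avgk. rewrite <- (RInt_minus (V := R_CompleteNormedModule));
        [|now apply (ex_RInt_avgk 2 0)|now apply (ex_RInt_avgk 2 0)].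
      replace (Lam * (D * exp (lam * Rabs z))) with ((1 - 0) * (Lam * (D * exp (lam * Rabs z))))
        by ring.
      apply abs_RInt_le_const; [lra| |].
      - apply (ex_RInt_minus (V := R_NormedModule)); now apply (ex_RInt_avgk 2 0).
      - intros s Hs. unfold minus, plus, opp; simpl. unfold fu, fv.
        replace (1 * F (z * s) (u (z * s)) + - (1 * F (z * s) (v (z * s)))) with
          (F (z * s) (u (z * s)) - F (z * s) (v (z * s))) by ring.
        assert (Hzs : l <= z * s <= r) by (split; nra).
        eapply Rle_trans; [apply HL; lra|].
        apply Rmult_le_compat_l; [lra|]. eapply Rle_trans; [apply Huv; exact Hzs|].
        apply Rmult_le_compat_l; [lra|]. apply exp_le_compat.
        apply Rmult_le_compat_l; [lra|]. rewrite Rabs_mult, (Rabs_pos_eq s) by lra.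
        generalize (Rabs_pos z). nra. }
    replace (avgk 0 fu z / (2 - z) - avgk 0 fv z / (2 - z)) with
      ((avgk 0 fu z - avgk 0 fv z) * / (2 - z)) by (field; lra).
    rewrite Rabs_mult, (Rabs_pos_eq (/ (2 - z))) by (left; apply Rinv_0_lt_compat; lra).
    replace (D / 2 * (lam * exp (lam * Rabs z))) with
      ((Lam * (D * exp (lam * Rabs z))) * / (2 - rho)) by (unfold lam; field; lra).
    apply Rmult_le_compat; [apply Rabs_pos|left; apply Rinv_0_lt_compat; lra|exact HA|].
    apply Rinv_le_contravar; lra. }
  assert (HE : forall z, l <= z <= r ->
     is_derive (fun z => picard F a u z - picard F b v z) z
       (avgk 0 fu z / (2 - z) - avgk 0 fv z / (2 - z))).
  { intros z Hz. apply (is_derive_minus (picard F a u) (picard F b v)).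
    - apply (is_derive_picard F a u); [exact HF|exact Hu|lra].
    - apply (is_derive_picard F b v); [exact HF|exact Hv|lra]. }
  intros z Hz.
  enough (H : Rabs ((picard F a u z - picard F b v z) - (a - b)) <=
              D / 2 * exp (lam * Rabs z) - D / 2).
  { replace (picard F a u z - picard F b v z) with
      ((a - b) + ((picard F a u z - picard F b v z) - (a - b))) by ring.
    generalize (Rabs_triang (a - b) ((picard F a u z - picard F b v z) - (a - b))). lra. }
  destruct (Rle_lt_dec 0 z) as [Hz0|Hz0].
  - generalize (abs_le_of_derive (fun z => picard F a u z - picard F b v z)
      (fun z => avgk 0 fu z / (2 - z) - avgk 0 fv z / (2 - z))
      (fun z => D / 2 * exp (lam * z)) (fun z => D / 2 * (lam * exp (lam * z))) 0 z Hz0).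
    rewrite !picard_0, Rmult_0_r, exp_0, Rmult_1_r, (Rabs_pos_eq z) by lra.
    intros H; apply H; clear H.
    + intros x Hx. apply HE. lra.
    + intros x Hx. auto_derive; [trivial|ring].
    + intros x Hx. rewrite <- (Rabs_pos_eq x) at 5 by lra. apply HA. lra.
  - generalize (abs_le_of_derive (fun z => picard F a u z - picard F b v z)
      (fun z => avgk 0 fu z / (2 - z) - avgk 0 fv z / (2 - z))
      (fun z => - (D / 2 * exp (lam * - z))) (fun z => D / 2 * (lam * exp (lam * - z))) z 0).
    rewrite !picard_0, Ropp_0, Rmult_0_r, exp_0, Rmult_1_r, (Rabs_left z) by lra.
    rewrite <- (Rabs_Ropp (a - b - _)).
    intros H.
    replace (picard F a u z - picard F b v z - (a - b)) with
      (- (a - b - (picard F a u z - picard F b v z))) by ring.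
    eapply Rle_trans; [apply H|]; [lra| | | |lra].
    + intros x Hx. apply HE. lra.
    + intros x Hx. auto_derive; [trivial|ring].
    + intros x Hx. replace (- x) with (Rabs x); [apply HA; lra|].
      destruct Hx as (_ & [Hx| ->]); [now apply Rabs_left|rewrite Rabs_R0; ring].
Qed.

Fixpoint picard_iter (F : R -> R -> R) (a : R) (n : nat) : R -> R :=
  match n with O => fun _ => a | S n => picard F a (picard_iter F a n) end.

Lemma continuous_picard_iter F a n t :
  admissible F -> -2 < t < 2 -> continuous (picard_iter F a n) t.
Proof.
  intros HF. revert t. induction n as [|n IH]; intros t Ht.
  - apply continuous_const.
  - now apply continuous_picard.
Qed.

Lemma one_le_exp_abs lam z : 0 < lam -> 1 <= exp (lam * Rabs z).
Proof.
  intros H. rewrite <- exp_0. apply exp_le_compat.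
  apply Rmult_le_pos; [lra|apply Rabs_pos].
Qed.

Lemma continuous_bounded (f : R -> R) (a b : R) :
  a <= b -> (forall x, a <= x <= b -> continuous f x) ->
  exists M, 0 <= M /\ forall x, a <= x <= b -> Rabs (f x) <= M.
Proof.
  intros Hab Hf.
  destruct (continuity_ab_maj (fun x => Rabs (f x)) a b Hab) as (x0 & H1 & H2).
  { intros c Hc. apply continuity_pt_filterlim. apply continuous_Rabs_comp, Hf, Hc. }
  exists (Rabs (f x0)). split; [apply Rabs_pos|exact H1].
Qed.

Lemma picard_iter_bound F a rho :
  admissible F -> 0 < rho < 2 ->
  exists K, 0 <= K /\ forall n z, -rho <= z <= rho ->
    Rabs (picard_iter F a (S n) z - picard_iter F a n z) <= K / 2 ^ n.
Proof.
  intros HF Hrho.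
  destruct (picard_contraction F rho HF Hrho) as (lam & Hlam & HC).
  destruct (continuous_bounded (fun z => picard_iter F a 1 z - picard_iter F a 0 z) (-rho) rho)
    as (M & HM0 & HM); [lra| |].
  { intros x Hx. apply continuous_Rminus; apply continuous_picard_iter; auto; lra. }
  assert (P2 : forall n, 0 < 2 ^ n) by (intros; apply pow_lt; lra).
  assert (H : forall n z, -rho <= z <= rho ->
    Rabs (picard_iter F a (S n) z - picard_iter F a n z) <= M / 2 ^ n * exp (lam * Rabs z)).
  { induction n as [|n IH]; intros z Hz.
    - rewrite pow_O, Rdiv_1_r. generalize (HM z Hz) (one_le_exp_abs lam z Hlam).
      intros. eapply Rle_trans; [eassumption|]. nra.
    - eapply Rle_trans.
      + apply (HC a a (picard_iter F a (S n)) (picard_iter F a n) (-rho) rho (M / 2 ^ n)); try lra.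
        * intros t Ht. now apply continuous_picard_iter.
        * intros t Ht. now apply continuous_picard_iter.
        * apply Rdiv_le_0_compat; auto.
        * exact IH.
      + unfold Rminus. rewrite Rplus_opp_r, Rabs_R0. right. simpl. field.
        apply Rgt_not_eq, P2. }
  exists (M * exp (lam * rho)). split.
  { apply Rmult_le_pos; [exact HM0|left; apply exp_pos]. }
  intros n z Hz. eapply Rle_trans; [apply H, Hz|].
  replace (M * exp (lam * rho) / 2 ^ n) with (M / 2 ^ n * exp (lam * rho))
    by (field; apply Rgt_not_eq, P2).
  apply Rmult_le_compat_l; [now apply Rdiv_le_0_compat|].
  apply exp_le_compat, Rmult_le_compat_l; [lra|]. now apply Rabs_le_between.
Qed.

Definition picard_sol (F : R -> R -> R) (a z : R) : R :=
  real (Lim_seq (fun n => picard_iter F a n z)).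

Lemma picard_sol_spec F a :
  admissible F ->
  (forall z, -2 < z < 2 -> continuous (picard_sol F a) z) /\
  (forall z, -2 < z < 2 -> picard_sol F a z = picard F a (picard_sol F a) z).
Proof.
  intros HF. set (u := picard_sol F a).
  assert (P2 : forall n, 0 < 2 ^ n) by (intros; apply pow_lt; lra).
  assert (HU : forall rho, 0 < rho < 2 -> exists K, 0 <= K /\ forall n z, -rho <= z <= rho ->
             Rabs (u z - picard_iter F a n z) <= K / 2 ^ n).
  { intros rho Hrho. destruct (picard_iter_bound F a rho HF Hrho) as (K & HK & H).
    exists (2 * K). split; [lra|]. intros n z Hz.
    apply (geometric_limit (fun n => picard_iter F a n z) K). intros m. now apply H. }
  assert (Hin : forall z, -2 < z < 2 -> exists rho, 0 < rho < 2 /\ -rho < z < rho).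
  { intros z Hz. exists ((Rabs z + 2) / 2).
    assert (Rabs z < 2) by (apply Rabs_def1; lra).
    generalize (Rabs_pos z) (Rle_abs z) (Rle_abs (- z)). rewrite Rabs_Ropp. lra. }
  assert (Cu : forall z, -2 < z < 2 -> continuous u z).
  { intros z Hz. destruct (Hin z Hz) as (rho & Hrho & Hzr).
    destruct (HU rho Hrho) as (K & HK & H).
    apply filterlim_locally. intros eps.
    assert (He : 0 < eps / 3) by (generalize (cond_pos eps); lra).
    destruct (half_pow_lt K _ He) as (n & Hn).
    assert (Cn := continuous_picard_iter F a n z HF Hz).
    assert (Cn' := proj1 (filterlim_locally _ _) Cn (mkposreal _ He)).
    generalize (filter_and _ _ Cn' (locally_open_interval _ _ _ Hzr)). apply filter_imp.
    intros y (Hy1 & Hy2). change (Rabs (picard_iter F a n y - picard_iter F a n z) < eps / 3) in Hy1.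
    change (Rabs (u y - u z) < eps).
    generalize (H n y ltac:(lra)) (H n z ltac:(lra)). intros H1 H2.
    apply Rabs_le_between in H1, H2. apply Rabs_def2 in Hy1. apply Rabs_def1; lra. }
  split; [exact Cu|].
  intros z Hz. destruct (Hin z Hz) as (rho & Hrho & Hzr).
  destruct (HU rho Hrho) as (K & HK & H).
  destruct (picard_contraction F rho HF Hrho) as (lam & Hlam & HC).
  apply cond_eq. intros eps Heps.
  destruct (half_pow_lt (K * (1 + exp (lam * Rabs z))) eps Heps) as (n & Hn).
  eapply Rle_lt_trans; [|exact Hn].
  replace (u z - picard F a u z) with
    ((u z - picard_iter F a (S n) z) + (picard F a (picard_iter F a n) z - picard F a u z))
    by (simpl; ring).
  eapply Rle_trans; [apply Rabs_triang|].
  assert (H1 := H (S n) z ltac:(lra)).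
  (* The contraction carries the distance from u to the n-th iterate over to their images, so u
     misses the fixed-point equation by O(2^-n) for every n. *)
  assert (H2 : Rabs (picard F a (picard_iter F a n) z - picard F a u z) <=
               Rabs (a - a) + K / 2 ^ n / 2 * exp (lam * Rabs z)).
  { apply (HC a a (picard_iter F a n) u (-rho) rho); try lra.
    - intros t Ht. now apply continuous_picard_iter.
    - exact Cu.
    - now apply Rdiv_le_0_compat.
    - intros y Hy. rewrite Rabs_minus_sym. eapply Rle_trans; [now apply H|].
      rewrite <- (Rmult_1_r (K / 2 ^ n)) at 1.
      apply Rmult_le_compat_l; [now apply Rdiv_le_0_compat|now apply one_le_exp_abs]. }
  unfold Rminus at 2 in H2. rewrite Rplus_opp_r, Rabs_R0 in H2.
  assert (HKn : 0 <= K / 2 ^ n) by now apply Rdiv_le_0_compat.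
  replace (K * (1 + exp (lam * Rabs z)) / 2 ^ n) with (K / 2 ^ n * (1 + exp (lam * Rabs z)))
    by (field; apply Rgt_not_eq, P2).
  replace (K / 2 ^ S n) with (K / 2 ^ n / 2) in H1 by (simpl; field; apply Rgt_not_eq, P2).
  generalize (exp_pos (lam * Rabs z)). nra.
Qed.

(** The case a = b is uniqueness. Leaving l and r free allows a comparison on one side of the pole
    only, which is needed for a function known to be a solution just for z >= 0. *)
Lemma picard_dependence F rho :
  admissible F -> 0 < rho < 2 ->
  exists L, 0 < L /\ forall a b u v l r,
    (forall t, -2 < t < 2 -> continuous u t) ->
    (forall t, -2 < t < 2 -> continuous v t) ->
    -rho <= l <= 0 -> 0 <= r <= rho ->
    (forall z, l <= z <= r -> u z = picard F a u z) ->
    (forall z, l <= z <= r -> v z = picard F b v z) ->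
    forall z, l <= z <= r -> Rabs (u z - v z) <= L * Rabs (a - b).
Proof.
  intros HF Hrho. destruct (picard_contraction F rho HF Hrho) as (lam & Hlam & HC).
  exists (2 * exp (lam * rho)). split; [generalize (exp_pos (lam * rho)); lra|].
  intros a b u v l r Hu Hv Hl Hr Eu Ev.
  destruct (continuity_ab_maj (fun z => Rabs (u z - v z) * exp (- (lam * Rabs z))) l r)
    as (z0 & Hmax & Hz0); [lra| |].
  { intros c Hc. apply continuity_pt_filterlim.
    assert (continuous u c) by (apply Hu; lra). assert (continuous v c) by (apply Hv; lra).
    apply (continuous_Rmult (fun z => Rabs (u z - v z)) (fun z => exp (- (lam * Rabs z)))); cont. }
  cbv beta in Hmax. set (N := Rabs (u z0 - v z0) * exp (- (lam * Rabs z0))) in *.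
  assert (HN0 : 0 <= N) by (apply Rmult_le_pos; [apply Rabs_pos|left; apply exp_pos]).
  assert (X : forall z, exp (- (lam * Rabs z)) * exp (lam * Rabs z) = 1).
  { intros z. rewrite <- exp_plus, Rplus_opp_l. apply exp_0. }
  assert (HN : forall z, l <= z <= r -> Rabs (u z - v z) <= N * exp (lam * Rabs z)).
  { intros z Hz. specialize (Hmax z Hz).
    replace (Rabs (u z - v z)) with
      (Rabs (u z - v z) * exp (- (lam * Rabs z)) * exp (lam * Rabs z))
      by (rewrite Rmult_assoc, X; ring).
    apply Rmult_le_compat_r; [left; apply exp_pos|exact Hmax]. }
  assert (H0 := HC a b u v l r N Hu Hv Hl Hr HN0 HN z0 Hz0).
  rewrite <- Eu, <- Ev in H0 by exact Hz0.
  (* At the point where the weighted difference is maximal, the contraction bounds N by |a - b| + N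
     / 2, up to the weight, which is at least 1. *)
  assert (HN2 : N <= 2 * Rabs (a - b)).
  { assert (E : Rabs (u z0 - v z0) = N * exp (lam * Rabs z0)).
    { unfold N. rewrite Rmult_assoc, X. ring. }
    rewrite E in H0. generalize (one_le_exp_abs lam z0 Hlam) (Rabs_pos (a - b)). nra. }
  intros z Hz. eapply Rle_trans; [now apply HN|].
  replace (2 * exp (lam * rho) * Rabs (a - b)) with (2 * Rabs (a - b) * exp (lam * rho)) by ring.
  apply Rmult_le_compat; [exact HN0|left; apply exp_pos|exact HN2|].
  apply exp_le_compat, Rmult_le_compat_l; [lra|]. apply Rabs_le_between. lra.
Qed.

(* The right-hand side of the equation in z = 1 + cos theta, with the
   exponential cut off at height B so that it becomes Lipschitz. *)
Definition nonlinearity (kap C w : R) (B : R -> R) (t v : R) : R :=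
  C + 2 * w * (t - 1) + kap * exp (Rmin v (B t)).

Lemma exp_diff_le x y b : x <= y -> y <= b -> exp y - exp x <= exp b * (y - x).
Proof.
  intros Hxy Hb.
  assert (H := exp_ineq1_le (x - y)).
  assert (E : exp x = exp y * exp (x - y)) by (rewrite <- exp_plus; f_equal; ring).
  assert (Hyb := exp_le_compat y b Hb). generalize (exp_pos y). rewrite E. nra.
Qed.

Lemma exp_Rmin_lipschitz v w b :
  Rabs (exp (Rmin v b) - exp (Rmin w b)) <= exp b * Rabs (v - w).
Proof.
  assert (H : forall v w, w <= v -> Rabs (exp (Rmin v b) - exp (Rmin w b)) <= exp b * Rabs (v - w)).
  { clear. intros v w Hwv.
    assert (Hm : Rmin w b <= Rmin v b) by (apply Rle_min_compat_r; exact Hwv).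
    assert (H := exp_diff_le _ _ b Hm (Rmin_r v b)).
    rewrite !Rabs_pos_eq; [|lra|generalize (exp_le_compat _ _ Hm); lra].
    eapply Rle_trans; [exact H|]. apply Rmult_le_compat_l; [left; apply exp_pos|].
    unfold Rmin. destruct (Rle_dec v b), (Rle_dec w b); lra. }
  destruct (Rle_dec w v) as [Hwv|Hwv]; [now apply H|].
  rewrite Rabs_minus_sym, (Rabs_minus_sym v). apply H. lra.
Qed.

Lemma admissible_nonlinearity kap C w B :
  (forall t, -2 < t < 2 -> continuous B t) -> admissible (nonlinearity kap C w B).
Proof.
  intros HB. split.
  - intros u Hu t Ht. unfold nonlinearity.
    assert (continuous (fun t => Rmin (u t) (B t)) t).
    { apply continuous_Rmin_comp; auto. }
    cont.
  - intros r Hr. destruct (continuous_bounded B (-r) r) as (M & HM0 & HM); [lra| |].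
    { intros x Hx. apply HB; lra. }
    exists (Rabs kap * exp M + 1). split.
    { generalize (Rmult_le_pos _ _ (Rabs_pos kap) (Rlt_le _ _ (exp_pos M))). lra. }
    intros t v v' Ht. unfold nonlinearity.
    replace (C + 2 * w * (t - 1) + kap * exp (Rmin v (B t)) -
      (C + 2 * w * (t - 1) + kap * exp (Rmin v' (B t)))) with
      (kap * (exp (Rmin v (B t)) - exp (Rmin v' (B t)))) by ring.
    rewrite Rabs_mult.
    assert (H1 := exp_Rmin_lipschitz v v' (B t)).
    assert (H2 : exp (B t) <= exp M).
    { apply exp_le_compat. generalize (HM t Ht) (Rle_abs (B t)). lra. }
    generalize (Rabs_pos kap) (Rabs_pos (v - v')). intros.
    assert (Rabs (exp (Rmin v (B t)) - exp (Rmin v' (B t))) <= exp M * Rabs (v - v')) by nra.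
    nra.
Qed.

(** * Smooth continuation of a solution across a pole *)

Lemma one_sided_limit (U U' : R -> R) (c : R) :
  (forall z, 0 < z <= 1 -> is_derive U z (U' z)) ->
  (forall z, 0 < z <= 1 -> Rabs (U' z) <= c) ->
  exists b, forall z, 0 < z <= 1 -> Rabs (U z - b) <= c * z.
Proof.
  intros HU Hc.
  assert (c0 : 0 <= c) by (generalize (Hc 1 ltac:(lra)) (Rabs_pos (U' 1)); lra).
  assert (Lip : forall x y, 0 < x -> x <= y -> y <= 1 -> Rabs (U y - U x) <= c * y - c * x).
  { intros x y Hx Hxy Hy.
    apply (abs_le_of_derive U U' (fun y => c * y) (fun _ => c) x y Hxy).
    - intros t Ht. apply HU. lra.
    - intros t Ht. auto_derive; [trivial|ring].
    - intros t Ht. apply Hc. lra. }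
  assert (P2 : forall n, 0 < / 2 ^ n <= 1).
  { intros n. split; [apply Rinv_0_lt_compat, pow_lt; lra|].
    rewrite <- Rinv_1. apply Rinv_le_contravar; [lra|]. apply pow_R1_Rle. lra. }
  set (s := fun n => U (/ 2 ^ n)). exists (real (Lim_seq s)).
  assert (HL : forall n, Rabs (real (Lim_seq s) - s n) <= 2 * (c / 2) / 2 ^ n).
  { apply geometric_limit. intros n. unfold s. rewrite Rabs_minus_sym.
    assert (E : / 2 ^ S n = / 2 ^ n / 2) by (simpl; field; apply pow_nonzero; lra).
    eapply Rle_trans; [apply Lip; generalize (P2 n) (P2 (S n)); lra|].
    rewrite E. right. field. apply pow_nonzero; lra. }
  intros z Hz. destruct (half_pow_lt 1 z (proj1 Hz)) as (n & Hn).
  unfold Rdiv in Hn. rewrite Rmult_1_l in Hn.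
  specialize (HL n). unfold s in HL.
  generalize (Lip (/ 2 ^ n) z ltac:(apply P2) ltac:(lra) ltac:(lra)). intros H.
  replace (2 * (c / 2) / 2 ^ n) with (c * / 2 ^ n) in HL by (field; apply pow_nonzero; lra).
  apply Rabs_le_between in H, HL. apply Rabs_le_between. fold s in HL. lra.
Qed.

Lemma continuous_of_linear_bound (f : R -> R) (x c d : R) :
  0 < d -> (forall y, x - d < y < x + d -> Rabs (f y - f x) <= c * Rabs (y - x)) ->
  continuous f x.
Proof.
  intros Hd H. apply filterlim_locally. intros eps.
  set (c' := Rabs c + 1). assert (Hc' : 0 < c') by (unfold c'; generalize (Rabs_pos c); lra).
  assert (He : 0 < Rmin d (eps / c')).
  { apply Rmin_pos; [exact Hd|]. apply Rdiv_lt_0_compat; [apply eps|exact Hc']. }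
  exists (mkposreal _ He). intros y Hy. change (Rabs (y - x) < Rmin d (eps / c')) in Hy.
  change (Rabs (f y - f x) < eps).
  assert (H1 := Rlt_le_trans _ _ _ Hy (Rmin_l _ _)).
  assert (H2 := Rlt_le_trans _ _ _ Hy (Rmin_r _ _)).
  apply Rle_lt_trans with (c' * Rabs (y - x)).
  - eapply Rle_trans; [apply H; apply Rabs_def2 in H1; lra|].
    apply Rmult_le_compat_r; [apply Rabs_pos|]. unfold c'. generalize (Rle_abs c); lra.
  - replace (pos eps) with (c' * (eps / c')) by (field; lra).
    now apply Rmult_lt_compat_l.
Qed.

(* Across the pole z = 0 a solution is continued by the Picard solution with the
   same value there; uniqueness glues the two. *)
Lemma end_regularity (kap C w c : R) (U P : R -> R) :
  (forall z, 0 < z < 2 ->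
     is_derive U z (P z / (z * (2 - z))) /\
     is_derive P z (kap * exp (U z) + C + 2 * w * (z - 1)) /\
     Rabs (P z) <= c * (z * (2 - z))) ->
  exists V e, 0 < e <= 1 /\ (forall z, 0 < z < e -> V z = U z) /\
    forall n, Cn_on n (-e) e V.
Proof.
  intros H.
  assert (c0 : 0 <= c).
  { destruct (H 1 ltac:(lra)) as (_ & _ & H1). generalize (Rabs_pos (P 1)). lra. }
  destruct (one_sided_limit U (fun z => P z / (z * (2 - z))) c) as (b & Hb).
  { intros z Hz. apply H. lra. }
  { intros z Hz. destruct (H z ltac:(lra)) as (_ & _ & H1).
    assert (Hzz : 0 < z * (2 - z)) by nra.
    unfold Rdiv. rewrite Rabs_mult, (Rabs_pos_eq (/ _)).
    - apply (Rmult_le_reg_r (z * (2 - z))); [exact Hzz|].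
      rewrite Rmult_assoc, Rinv_l, Rmult_1_r by lra. exact H1.
    - left. now apply Rinv_0_lt_compat. }
  (* The constant continuation to z <= 0 is merely continuous and is no solution there; it only
     makes [U0] an admissible argument of [picard]. *)
  set (U0 := fun z => match Rle_dec z 0 with left _ => b | right _ => U z end).
  set (P0 := fun z => match Rle_dec z 0 with left _ => 0 | right _ => P z end).
  assert (U0p : forall z, 0 < z -> U0 z = U z).
  { intros z Hz. unfold U0. destruct (Rle_dec z 0); [lra|reflexivity]. }
  assert (P0p : forall z, 0 < z -> P0 z = P z).
  { intros z Hz. unfold P0. destruct (Rle_dec z 0); [lra|reflexivity]. }
  assert (U0n : forall z, z <= 0 -> U0 z = b).
  { intros z Hz. unfold U0. destruct (Rle_dec z 0); [reflexivity|lra]. }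
  assert (P0n : forall z, z <= 0 -> P0 z = 0).
  { intros z Hz. unfold P0. destruct (Rle_dec z 0); [reflexivity|lra]. }
  assert (Lp : forall z, 0 < z -> locally z (fun y => 0 < y)) by (intros; now apply (open_gt 0)).
  assert (DU : forall z, 0 < z < 2 -> is_derive U0 z (P0 z / (z * (2 - z)))).
  { intros z Hz. rewrite P0p by lra. apply (is_derive_ext_loc U); [|now apply H].
    generalize (Lp z ltac:(lra)). apply filter_imp. intros y Hy. symmetry. now apply U0p. }
  assert (DP : forall z, 0 < z < 2 ->
     is_derive P0 z (kap * exp (U0 z) + C + 2 * w * (z - 1))).
  { intros z Hz. rewrite U0p by lra. apply (is_derive_ext_loc P); [|now apply H].
    generalize (Lp z ltac:(lra)). apply filter_imp. intros y Hy. symmetry. now apply P0p. }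
  assert (CU : forall z, -2 < z < 2 -> continuous U0 z).
  { intros z Hz. destruct (Rle_lt_dec z 0) as [Hz0|Hz0].
    - apply (continuous_of_linear_bound U0 z c 1); [lra|]. intros y Hy. rewrite (U0n z) by lra.
      destruct (Rle_lt_dec y 0) as [Hy0|Hy0].
      + rewrite U0n by lra. unfold Rminus at 1. rewrite Rplus_opp_r, Rabs_R0.
        apply Rmult_le_pos; [lra|apply Rabs_pos].
      + rewrite U0p by lra. eapply Rle_trans; [apply Hb; lra|].
        apply Rmult_le_compat_l; [lra|]. generalize (Rle_abs (y - z)). lra.
    - eapply continuous_of_derive. apply DU. lra. }
  assert (CP : forall z, 0 <= z < 2 -> continuous P0 z).
  { intros z Hz. destruct (Rle_lt_dec z 0) as [Hz0|Hz0].
    - replace z with 0 by lra. apply (continuous_of_linear_bound P0 0 (2 * c) 2); [lra|].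
      intros y Hy. rewrite (P0n 0) by lra. rewrite !Rminus_0_r.
      destruct (Rle_lt_dec y 0) as [Hy0|Hy0].
      + rewrite P0n by lra. rewrite Rabs_R0.
        apply Rmult_le_pos; [lra|apply Rabs_pos].
      + rewrite P0p by lra. destruct (H y ltac:(lra)) as (_ & _ & H1).
        eapply Rle_trans; [exact H1|]. rewrite (Rabs_pos_eq y) by lra.
        assert (c * (y * (2 - y)) <= c * (2 * y)); [|lra].
        apply Rmult_le_compat_l; [lra|nra].
    - eapply continuous_of_derive. apply DP. lra. }
  (* On [0, 1] the solution stays below b + c, so this cut-off does not act; the extra 1 leaves room
     for the Picard solution slightly to the left of 0. *)
  set (B := b + c + 1). set (F := nonlinearity kap C w (fun _ => B)).
  assert (HF : admissible F).
  { apply admissible_nonlinearity. intros; apply continuous_const. }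
  assert (FU : forall z, 0 <= z <= 1 -> F z (U0 z) = kap * exp (U0 z) + C + 2 * w * (z - 1)).
  { intros z Hz. unfold F, nonlinearity. rewrite Rmin_left; [ring|].
    destruct (Rle_lt_dec z 0) as [Hz0|Hz0].
    - rewrite U0n by lra. unfold B; lra.
    - rewrite U0p by lra. specialize (Hb z ltac:(lra)). apply Rabs_le_between in Hb.
      unfold B. assert (c * z <= c * 1) by (apply Rmult_le_compat_l; lra). lra. }
  assert (CF : forall t, -2 < t < 2 -> continuous (fun t => F t (U0 t)) t).
  { apply (proj1 HF), CU. }
  assert (IP : forall z, 0 <= z <= 1 -> RInt (fun t => F t (U0 t)) 0 z = P0 z).
  { intros z Hz.
    assert (DI : forall x, -2 < x < 2 ->
      is_derive (fun z => RInt (fun t => F t (U0 t)) 0 z) x (F x (U0 x))).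
    { intros x Hx. apply (is_derive_RInt (fun t => F t (U0 t)) _ 0); [|now apply CF].
      generalize (locally_open_interval (-2) 2 x Hx). apply filter_imp. intros y Hy.
      apply (RInt_correct (V := R_CompleteNormedModule)).
      apply (ex_RInt_continuous (V := R_CompleteNormedModule)). intros s Hs. apply CF.
      unfold Rmin, Rmax in Hs. destruct (Rle_dec 0 y); lra. }
    apply (eq_of_derive _ P0 (fun t => F t (U0 t)) 0 z); try lra.
    - intros x Hx. apply DI. lra.
    - intros x Hx. rewrite FU by lra. apply DP. lra.
    - intros x Hx. eapply continuous_of_derive. apply DI. lra.
    - intros x Hx. apply CP. lra.
    - rewrite RInt_point, P0n by lra. reflexivity. }
  assert (EU : forall z, 0 <= z <= 1 -> U0 z = picard F b U0 z).
  { intros z Hz.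
    apply (eq_of_derive U0 (picard F b U0)
             (fun y => avgk 0 (fun t => F t (U0 t)) y / (2 - y)) 0 z); try lra.
    - intros x Hx. replace (avgk 0 (fun t => F t (U0 t)) x / (2 - x)) with (P0 x / (x * (2 - x))).
      + apply DU. lra.
      + rewrite <- IP by lra. rewrite <- (avgk0_mult 2) by (auto; lra). field. lra.
    - intros x Hx. apply is_derive_picard; auto. lra.
    - intros x Hx. apply CU. lra.
    - intros x Hx. apply continuous_picard; auto. lra.
    - rewrite picard_0. apply U0n. lra. }
  destruct (picard_sol_spec F b HF) as (CV & EV). set (V := picard_sol F b) in *.
  assert (UV : forall z, 0 <= z <= 1 -> U0 z = V z).
  { intros z Hz. destruct (picard_dependence F 1 HF ltac:(lra)) as (L & _ & HL).
    specialize (HL b b U0 V 0 1 CU CV ltac:(lra) ltac:(lra) EU ltac:(intros; apply EV; lra) z Hz).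
    unfold Rminus at 2 in HL. rewrite Rplus_opp_r, Rabs_R0, Rmult_0_r in HL.
    generalize (Rabs_pos (U0 z - V z)). intros.
    apply Rminus_diag_uniq. apply Rabs_eq_0. lra. }
  assert (V0 : V 0 = b) by (rewrite EV by lra; apply picard_0).
  assert (HVB : exists e, 0 < e <= 1 /\ forall z, -e < z < e -> V z < B).
  { destruct (continuous_eps V 0 1 (CV 0 ltac:(lra)) Rlt_0_1) as (e & He0 & He).
    assert (H1 := Rmin_l e 1). exists (Rmin e 1).
    split; [split; [apply Rmin_pos; lra|apply Rmin_r]|].
    intros z Hz. specialize (He z ltac:(lra)).
    apply Rabs_def2 in He. rewrite V0 in He. unfold B. lra. }
  destruct HVB as (e & He & HVB). exists V, e. split; [exact He|]. split.
  { intros z Hz. rewrite <- UV, U0p by lra. reflexivity. }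
  set (G := fun t => C + 2 * w * (t + -1) + kap * exp (V t)).
  assert (DV : forall z, -e < z < e -> is_derive V z (avgk 0 G z * / (2 + -1 * z))).
  { intros z Hz. apply (is_derive_ext_loc (picard F b V)).
    - generalize (locally_open_interval (-2) 2 z ltac:(lra)). apply filter_imp.
      intros y Hy. symmetry. now apply EV.
    - replace (avgk 0 G z * / (2 + -1 * z)) with (avgk 0 (fun t => F t (V t)) z / (2 - z)).
      + apply is_derive_picard; auto. lra.
      + unfold Rdiv. f_equal; [|f_equal; ring]. unfold avgk. apply RInt_ext.
        rewrite Rmin_left, Rmax_right by lra. intros s Hs. f_equal.
        unfold F, nonlinearity, G. rewrite Rmin_left; [ring|].
        left. apply HVB. apply scaled_in_ball; lra. }
  (* Bootstrap: V' is an average of a smooth expression in V, divided by 2 - z, so V has one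
     derivative more than is already known. *)
  induction n as [|n IH].
  - intros x Hx. apply CV. lra.
  - exists (fun z => avgk 0 G z * / (2 + -1 * z)). split; [exact DV|].
    apply Cn_on_mult.
    + apply Cn_on_avgk. unfold G. apply Cn_on_plus.
      * apply Cn_on_plus; [apply Cn_on_const|].
        apply Cn_on_mult; [apply Cn_on_const|].
        apply Cn_on_plus; [apply Cn_on_id|apply Cn_on_const].
      * apply Cn_on_mult; [apply Cn_on_const|]. now apply Cn_on_exp.
    + apply Cn_on_inv; [intros; lra|]. apply Cn_on_plus; [apply Cn_on_const|].
      apply Cn_on_mult; [apply Cn_on_const|apply Cn_on_id].
Qed.

(** * From axially symmetric solutions to functions on the sphere *)

(* Axially symmetric solutions in x = cos theta; the bound on p = (1 - x^2) u'
   expresses regularity at both poles. *)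
Definition axial_bvp (kap C w : R) : Prop :=
  exists (u p : R -> R) (c : R), forall x, -1 < x < 1 ->
    is_derive u x (p x / (1 - x ^ 2)) /\
    is_derive p x (kap * exp (u x) + C + 2 * w * x) /\
    Rabs (p x) <= c * (1 - x ^ 2).

Lemma is_derive_affine (f : R -> R) (a b x l : R) :
  is_derive f (a * x + b) l -> is_derive (fun y => f (a * y + b)) x (a * l).
Proof.
  intros H. apply (is_derive_comp f (fun y => a * y + b)); [exact H|].
  auto_derive; [trivial|ring].
Qed.

Lemma axial_bvp_reflect kap C w : axial_bvp kap C w -> axial_bvp kap C (- w).
Proof.
  intros (u & p & c & H). exists (fun x => u (-1 * x + 0)), (fun x => -1 * p (-1 * x + 0)), c.
  intros x Hx. destruct (H (-1 * x + 0) ltac:(lra)) as (H1 & H2 & H3).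
  replace (1 - (-1 * x + 0) ^ 2) with (1 - x ^ 2) in * by ring.
  split; [|split].
  - replace (-1 * p (-1 * x + 0) / (1 - x ^ 2)) with (-1 * (p (-1 * x + 0) / (1 - x ^ 2)))
      by (unfold Rdiv; ring).
    exact (is_derive_affine u (-1) 0 x _ H1).
  - replace (kap * exp (u (-1 * x + 0)) + C + 2 * - w * x) with
      (-1 * (-1 * (kap * exp (u (-1 * x + 0)) + C + 2 * w * (-1 * x + 0)))) by ring.
    apply (is_derive_scal (fun x => p (-1 * x + 0))). exact (is_derive_affine p (-1) 0 x _ H2).
  - rewrite Rabs_mult. replace (Rabs (-1)) with 1 by (rewrite Rabs_left; lra). lra.
Qed.

Lemma axial_smooth_inside kap C w (u p : R -> R) c :
  (forall x, -1 < x < 1 ->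
    is_derive u x (p x / (1 - x ^ 2)) /\
    is_derive p x (kap * exp (u x) + C + 2 * w * x) /\
    Rabs (p x) <= c * (1 - x ^ 2)) ->
  forall n, Cn_on n (-1) 1 u /\ Cn_on n (-1) 1 p.
Proof.
  intros H. induction n as [|n (IHu & IHp)].
  - split; intros x Hx; eapply continuous_of_derive; now apply H.
  - split.
    + exists (fun x => p x * / (1 + -1 * (x * x))). split.
      * intros x Hx. replace (1 + -1 * (x * x)) with (1 - x ^ 2) by ring. now apply H.
      * apply Cn_on_mult; [exact IHp|]. apply Cn_on_inv; [intros; nra|].
        repeat first [apply Cn_on_plus|apply Cn_on_mult|apply Cn_on_const|apply Cn_on_id].
    + exists (fun x => kap * exp (u x) + C + 2 * w * x). split; [intros; now apply H|].
      repeat first [apply Cn_on_plus|apply Cn_on_mult|apply Cn_on_const|apply Cn_on_id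
                   |apply Cn_on_exp; exact IHu].
Qed.

Lemma axial_smooth_extension kap C w (u p : R -> R) c :
  (forall x, -1 < x < 1 ->
    is_derive u x (p x / (1 - x ^ 2)) /\
    is_derive p x (kap * exp (u x) + C + 2 * w * x) /\
    Rabs (p x) <= c * (1 - x ^ 2)) ->
  exists h e, 0 < e /\ (forall x, -1 < x < 1 -> h x = u x) /\
    forall n x, -1 - e < x < 1 + e -> ex_derive_n h n x.
Proof.
  intros H.
  destruct (end_regularity kap C w c (fun z => u (1 * z + -1)) (fun z => p (1 * z + -1)))
    as (Vl & el & Hel & EVl & SVl).
  { intros z Hz. destruct (H (1 * z + -1) ltac:(lra)) as (H1 & H2 & H3).
    replace (1 - (1 * z + -1) ^ 2) with (z * (2 - z)) in * by ring.
    split; [|split; [|exact H3]].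
    - replace (p (1 * z + -1) / (z * (2 - z))) with (1 * (p (1 * z + -1) / (z * (2 - z)))) by ring.
      exact (is_derive_affine u 1 (-1) z _ H1).
    - replace (kap * exp (u (1 * z + -1)) + C + 2 * w * (z - 1)) with
        (1 * (kap * exp (u (1 * z + -1)) + C + 2 * w * (1 * z + -1))) by ring.
      exact (is_derive_affine p 1 (-1) z _ H2). }
  (* The other pole is reached by z = 1 - x, a reflection that changes the sign of w and of the
     momentum. *)
  destruct (end_regularity kap C (- w) c (fun z => u (-1 * z + 1)) (fun z => -1 * p (-1 * z + 1)))
    as (Vr & er & Her & EVr & SVr).
  { intros z Hz. destruct (H (-1 * z + 1) ltac:(lra)) as (H1 & H2 & H3).
    replace (1 - (-1 * z + 1) ^ 2) with (z * (2 - z)) in * by ring.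
    split; [|split].
    - replace (-1 * p (-1 * z + 1) / (z * (2 - z))) with (-1 * (p (-1 * z + 1) / (z * (2 - z))))
        by (unfold Rdiv; ring).
      exact (is_derive_affine u (-1) 1 z _ H1).
    - replace (kap * exp (u (-1 * z + 1)) + C + 2 * - w * (z - 1)) with
        (-1 * (-1 * (kap * exp (u (-1 * z + 1)) + C + 2 * w * (-1 * z + 1)))) by ring.
      apply (is_derive_scal (fun z => p (-1 * z + 1))). exact (is_derive_affine p (-1) 1 z _ H2).
    - rewrite Rabs_mult. replace (Rabs (-1)) with 1 by (rewrite Rabs_left; lra). lra. }
  set (h := fun x => match Rle_dec x (-1) with left _ => Vl (1 * x + 1)
    | right _ => match Rle_dec 1 x with left _ => Vr (-1 * x + 1) | right _ => u x end end).
  assert (hu : forall x, -1 < x < 1 -> h x = u x).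
  { intros x Hx. unfold h. destruct (Rle_dec x (-1)); [lra|].
    destruct (Rle_dec 1 x); [lra|reflexivity]. }
  assert (Hl : forall x, -1 - el < x < -1 + el -> h x = Vl (1 * x + 1)).
  { intros x Hx. destruct (Rle_lt_dec x (-1)) as [Hx1|Hx1].
    - unfold h. destruct (Rle_dec x (-1)); [reflexivity|lra].
    - rewrite hu, EVl by lra. f_equal. ring. }
  assert (Hr : forall x, 1 - er < x < 1 + er -> h x = Vr (-1 * x + 1)).
  { intros x Hx. destruct (Rle_lt_dec 1 x) as [Hx1|Hx1].
    - unfold h. destruct (Rle_dec x (-1)); [lra|]. destruct (Rle_dec 1 x); [reflexivity|lra].
    - rewrite hu, EVr by lra. f_equal. ring. }
  assert (Hmin1 := Rmin_l el er). assert (Hmin2 := Rmin_r el er).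
  exists h, (Rmin el er). split; [apply Rmin_pos; lra|]. split; [exact hu|].
  intros n x Hx.
  destruct (Rle_lt_dec x (-1)) as [Hx1|Hx1]; [|destruct (Rle_lt_dec 1 x) as [Hx2|Hx2]].
  - apply (Cn_on_ex_derive_n n (-1 - el) (-1 + el)); [|lra].
    apply (Cn_on_ext _ _ _ (fun x => Vl (1 * x + 1))); [intros; symmetry; now apply Hl|].
    apply (Cn_on_affine n (- el) el); [intros; lra|apply SVl].
  - apply (Cn_on_ex_derive_n n (1 - er) (1 + er)); [|lra].
    apply (Cn_on_ext _ _ _ (fun x => Vr (-1 * x + 1))); [intros; symmetry; now apply Hr|].
    apply (Cn_on_affine n (- er) er); [intros; lra|apply SVr].
  - apply (Cn_on_ex_derive_n n (-1) 1); [|lra].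
    apply (Cn_on_ext _ _ _ u); [intros; symmetry; now apply hu|].
    now apply (axial_smooth_inside kap C w u p c).
Qed.

(** * Zonal functions as smooth functions on the sphere *)

Lemma iter_partial_zonal (k : R -> R) (s : list axis) :
  (exists n, forall p, iter_partial s (fun p => k (coord axis_z p)) p = Derive_n k n (coord axis_z p))
  \/ (forall p, iter_partial s (fun p => k (coord axis_z p)) p = 0).
Proof.
  induction s as [|i s IH].
  - left. exists 0%nat. intros; reflexivity.
  - set (G := iter_partial s (fun p => k (coord axis_z p))) in *.
    change (iter_partial (i :: s) (fun p => k (coord axis_z p))) with (partial i G).
    destruct IH as [(n & IH)|IH].
    + assert (Hz : forall j p, j <> axis_z -> partial j G p = 0).
      { intros j ((x, y), z) Hj. unfold partial.
        rewrite (Derive_ext _ (fun _ => Derive_n k n z)); [apply Derive_const|].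
        intros t. rewrite IH. now destruct j. }
      destruct i; [right; intros; now apply Hz|right; intros; now apply Hz|].
      left. exists (S n). intros ((x, y), z). unfold partial. simpl.
      apply Derive_ext. intros t. now rewrite IH.
    + right. intros ((x, y), z). unfold partial.
      rewrite (Derive_ext _ (fun _ => 0)); [apply Derive_const|]. intros; apply IH.
Qed.

(** With l < -1 and 1 < r the slab is an open set containing the whole sphere, so one extension
    serves at every point, poles included. This is why the profile must be smooth beyond [-1, 1]. *)
Lemma smooth_on_zonal (k : R -> R) (l r : R) :
  (forall n x, l < x < r -> ex_derive_n k n x) ->
  smooth_on (fun p => l < coord axis_z p < r) (fun p => k (coord axis_z p)).
Proof.
  intros Hk s p Hp.
  assert (Cz : continuous (fun p : R3 => coord axis_z p) p).
  { apply (continuous_ext (fun q : R3 => snd q)); [now intros ((x, y), z)|].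
    destruct p as ((x, y), z). apply continuous_snd. }
  destruct (iter_partial_zonal k s) as [(n & E)|E].
  - split.
    + apply (continuous_ext (fun q => Derive_n k n (coord axis_z q))); [now intros|].
      apply (continuous_comp (fun q : R3 => coord axis_z q) (Derive_n k n)); [exact Cz|].
      apply (ex_derive_continuous (Derive_n k n)). now apply (Hk (S n)).
    + intros i. destruct p as ((x, y), z). destruct i;
        [apply (ex_derive_ext (fun _ => Derive_n k n z));
           [intros; now rewrite E|apply ex_derive_const]
        |apply (ex_derive_ext (fun _ => Derive_n k n z));
           [intros; now rewrite E|apply ex_derive_const]
        |apply (ex_derive_ext (Derive_n k n));
           [intros; now rewrite E|now apply (Hk (S n))]].
  - split.
    + apply (continuous_ext (fun q => 0)); [now intros|]. apply continuous_const.
    + intros i. apply (ex_derive_ext (fun _ => 0)); [now intros|]. apply ex_derive_const.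
Qed.

Lemma cos_inside theta : 0 < theta < PI -> -1 < cos theta < 1.
Proof.
  intros H. assert (Hs := sin_gt_0 theta (proj1 H) (proj2 H)).
  assert (E := sin2_cos2 theta). unfold Rsqr in E. split; nra.
Qed.

Lemma has_solution_of_axial_bvp (kap c d g omega : R) :
  d <> 0 -> c <> 0 -> 0 < kap / (c * d) -> axial_bvp kap (g * d) (omega * d) ->
  has_solution c d g omega.
Proof.
  intros Hd Hc Hk (u & p & b & H).
  destruct (axial_smooth_extension kap (g * d) (omega * d) u p b H) as (h & e & He & hu & hs).
  (* The shift s turns c d e^(u + s) into kap e^u, so that psi = (u + s) / d solves the original
     equation. *)
  set (s := ln (kap / (c * d))).
  set (k := fun x => / d * (h x + s)).
  assert (ks : forall n x, -1 - e < x < 1 + e -> ex_derive_n k n x).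
  { intros n x Hx. apply ex_derive_n_scal_l. apply ex_derive_n_plus.
    - generalize (locally_open_interval (-1 - e) (1 + e) x Hx). apply filter_imp.
      intros y Hy m _. now apply hs.
    - apply filter_forall. intros y m _. apply ex_derive_n_const. }
  exists (fun q => k (coord axis_z (proj1_sig q))). split.
  - intros q. exists (fun p => -1 - e < coord axis_z p < 1 + e), (fun p => k (coord axis_z p)).
    assert (Hz : -1 - e < coord axis_z (proj1_sig q) < 1 + e).
    { destruct q as (((x, y), z) & Hq). simpl in *. nra. }
    split; [|split; [exact Hz|split; [now apply smooth_on_zonal|reflexivity]]].
    apply (open_comp (fun p : R3 => coord axis_z p) (fun z => -1 - e < z < 1 + e)).
    + intros ((x, y), z) _. apply (filterlim_ext (fun q : R3 => snd q)); [now intros ((x', y'), z')|].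
      apply (continuous_snd (U := prod_UniformSpace R_UniformSpace R_UniformSpace)).
    + apply open_and; [apply (open_gt (-1 - e))|apply (open_lt (1 + e))].
  - intros theta phi Ht _. 
    change (Derive (Derive (fun t => k (cos t))) theta
      + cos theta / sin theta * Derive (fun t => k (cos t)) theta
      + / sin theta ^ 2 * Derive (Derive (fun t => k (cos theta))) phi
      - 2 * omega * cos theta = c * exp (d * k (cos theta)) + g).
    rewrite (Derive_ext (Derive (fun _ => k (cos theta))) (fun _ => 0)) by (intros; apply Derive_const).
    rewrite Derive_const.
    assert (Hs : forall t, 0 < t < PI -> 0 < sin t) by (intros; now apply sin_gt_0).
    assert (Hsc : forall t, 1 - cos t ^ 2 = sin t ^ 2).
    { intros t. generalize (sin2_cos2 t). unfold Rsqr. intros E. simpl. lra. }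
    assert (ke : forall x, -1 < x < 1 -> k x = / d * (u x + s)).
    { intros x Hx. unfold k. now rewrite hu. }
    assert (D1 : forall t, 0 < t < PI ->
      is_derive (fun t => k (cos t)) t (- (/ d * (p (cos t) / sin t)))).
    { intros t Ht'. specialize (Hs t Ht').
      apply (is_derive_ext_loc (fun t => / d * (u (cos t) + s))).
      - generalize (locally_open_interval 0 PI t Ht'). apply filter_imp. intros y Hy.
        symmetry. apply ke. now apply cos_inside.
      - destruct (H (cos t) (cos_inside t Ht')) as (H1 & _ & _). rewrite Hsc in H1.
        replace (- (/ d * (p (cos t) / sin t))) with
          (/ d * ((- sin t * (p (cos t) / sin t ^ 2)) + 0)) by (field; lra).
        apply (is_derive_scal (fun t => u (cos t) + s)).
        apply (is_derive_plus (fun t => u (cos t)) (fun _ => s)); [|apply (is_derive_const s)].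
        apply (is_derive_comp u cos); [exact H1|]. apply is_derive_cos. }
    assert (E1 : Derive (fun t : R => k (cos t)) theta = - (/ d * (p (cos theta) / sin theta)))
      by exact (is_derive_unique _ _ _ (D1 theta Ht)).
    rewrite E1.
    destruct (H (cos theta) (cos_inside theta Ht)) as (_ & H2 & _).
    assert (D2 : is_derive (Derive (fun t => k (cos t))) theta
      (/ d * (kap * exp (u (cos theta)) + g * d + 2 * (omega * d) * cos theta) +
       / d * (p (cos theta) * cos theta / sin theta ^ 2))).
    { apply (is_derive_ext_loc (fun t => - (/ d * (p (cos t) / sin t)))).
      - generalize (locally_open_interval 0 PI theta Ht). apply filter_imp. intros y Hy.
        symmetry. now apply is_derive_unique, D1.
      - specialize (Hs theta Ht).
        set (q := kap * exp (u (cos theta)) + g * d + 2 * (omega * d) * cos theta) in *.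
        assert (D3 : is_derive (fun t => p (cos t)) theta (- sin theta * q)).
        { apply (is_derive_comp p cos); [exact H2|]. apply is_derive_cos. }
        replace (/ d * q + / d * (p (cos theta) * cos theta / sin theta ^ 2)) with
          (- (/ d * ((- sin theta * q * sin theta - p (cos theta) * cos theta) / sin theta ^ 2)))
          by (field; lra).
        apply (is_derive_opp (fun t => / d * (p (cos t) / sin t))).
        apply (is_derive_scal (fun t => p (cos t) / sin t)).
        apply (is_derive_div (fun t => p (cos t)) sin); [exact D3|apply is_derive_sin|lra]. }
    assert (E2 := is_derive_unique _ _ _ D2). simpl in E2. rewrite E2.
    specialize (Hs theta Ht). rewrite ke by now apply cos_inside.
    replace (exp (d * (/ d * (u (cos theta) + s)))) with (exp (u (cos theta)) * (kap / (c * d))).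
    2: { rewrite <- (exp_ln (kap / (c * d))) by exact Hk. rewrite <- exp_plus. f_equal.
         fold s. field. exact Hd. }
    field. repeat split; lra.
Qed.

(** * The shooting family *)

Lemma is_derive_RInt_0 (f : R -> R) z :
  (forall t, -2 < t < 2 -> continuous f t) -> -2 < z < 2 ->
  is_derive (fun z => RInt f 0 z) z (f z).
Proof.
  intros Hf Hz. apply (is_derive_RInt f _ 0); [|now apply Hf].
  generalize (locally_open_interval (-2) 2 z Hz). apply filter_imp. intros y Hy.
  apply (RInt_correct (V := R_CompleteNormedModule)).
  apply (ex_RInt_continuous (V := R_CompleteNormedModule)). intros s Hs. apply Hf.
  unfold Rmin, Rmax in Hs. destruct (Rle_dec 0 y); lra.
Qed.

Lemma picard_sol_0 F a : admissible F -> picard_sol F a 0 = a.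
Proof.
  intros HF. rewrite (proj2 (picard_sol_spec F a HF)) by lra. apply picard_0.
Qed.

Lemma is_derive_picard_sol F a z :
  admissible F -> 0 < z < 2 ->
  is_derive (picard_sol F a) z
    (RInt (fun t => F t (picard_sol F a t)) 0 z / (z * (2 - z))).
Proof.
  intros HF Hz. destruct (picard_sol_spec F a HF) as (Cu & Eu).
  set (u := picard_sol F a) in *.
  apply (is_derive_ext_loc (picard F a u)).
  - generalize (locally_open_interval (-2) 2 z ltac:(lra)). apply filter_imp.
    intros y Hy. symmetry. now apply Eu.
  - rewrite <- (avgk0_mult 2) by (try apply (proj1 HF u Cu); lra).
    replace (z * avgk 0 (fun t => F t (u t)) z / (z * (2 - z))) with
      (avgk 0 (fun t => F t (u t)) z / (2 - z)) by (field; lra).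
    apply (is_derive_picard F a u); [exact HF|exact Cu|lra].
Qed.

Definition sol (kap C w : R) (B : R -> R) (a : R) : R -> R :=
  picard_sol (nonlinearity kap C w B) a.

Definition mass (kap C w : R) (B : R -> R) (a z : R) : R :=
  RInt (fun t => exp (Rmin (sol kap C w B a t) (B t))) 0 z.

Lemma continuous_sol kap C w B a z :
  (forall t, -2 < t < 2 -> continuous B t) -> -2 < z < 2 ->
  continuous (sol kap C w B a) z.
Proof.
  intros HB Hz. apply (picard_sol_spec (nonlinearity kap C w B)); [|exact Hz].
  now apply admissible_nonlinearity.
Qed.

Lemma sol_0 kap C w B a :
  (forall t, -2 < t < 2 -> continuous B t) -> sol kap C w B a 0 = a.
Proof. intros HB. apply picard_sol_0. now apply admissible_nonlinearity. Qed.

Lemma continuous_cut_exp kap C w B a z :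
  (forall t, -2 < t < 2 -> continuous B t) -> -2 < z < 2 ->
  continuous (fun t => exp (Rmin (sol kap C w B a t) (B t))) z.
Proof.
  intros HB Hz. apply continuous_exp_comp, continuous_Rmin_comp.
  - now apply continuous_sol.
  - now apply HB.
Qed.

Lemma is_derive_mass kap C w B a z :
  (forall t, -2 < t < 2 -> continuous B t) -> -2 < z < 2 ->
  is_derive (mass kap C w B a) z (exp (Rmin (sol kap C w B a z) (B z))).
Proof.
  intros HB Hz.
  apply (is_derive_RInt_0 (fun t => exp (Rmin (sol kap C w B a t) (B t))));
    [|exact Hz].
  intros t Ht. now apply continuous_cut_exp.
Qed.

Lemma mass_0 kap C w B a : mass kap C w B a 0 = 0.
Proof. unfold mass. rewrite RInt_point. reflexivity. Qed.

(** The numerator is the momentum p: integrating the right-hand side from the pole, 2 w (t - 1)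
    contributes -w z (2 - z) and the cut-off exponential contributes the mass. *)
Lemma is_derive_sol kap C w B a z :
  (forall t, -2 < t < 2 -> continuous B t) -> 0 < z < 2 ->
  is_derive (sol kap C w B a) z
    ((C * z - w * (z * (2 - z)) + kap * mass kap C w B a z) / (z * (2 - z))).
Proof.
  intros HB Hz. assert (HF := admissible_nonlinearity kap C w B HB).
  replace (C * z - w * (z * (2 - z)) + kap * mass kap C w B a z) with
    (RInt (fun t => nonlinearity kap C w B t (sol kap C w B a t)) 0 z).
  { now apply is_derive_picard_sol. }
  assert (CF : forall t, -2 < t < 2 ->
    continuous (fun t => nonlinearity kap C w B t (sol kap C w B a t)) t).
  { apply (proj1 HF). intros; now apply continuous_sol. }
  apply (eq_of_derive _ (fun z => C * z - w * (z * (2 - z)) + kap * mass kap C w B a z)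
    (fun t => nonlinearity kap C w B t (sol kap C w B a t)) 0 z); try lra.
  - intros x Hx.
    apply (is_derive_RInt_0 (fun t => nonlinearity kap C w B t (sol kap C w B a t)));
      [exact CF|lra].
  - intros x Hx. unfold nonlinearity.
    apply (is_derive_plus (fun z => C * z - w * (z * (2 - z)))).
    + auto_derive; [trivial|ring].
    + apply (is_derive_scal (mass kap C w B a)). apply is_derive_mass; [exact HB|lra].
  - intros x Hx. eapply continuous_of_derive.
    apply (is_derive_RInt_0 (fun t => nonlinearity kap C w B t (sol kap C w B a t)));
      [exact CF|lra].
  - intros x Hx. assert (continuous (mass kap C w B a) x).
    { eapply continuous_of_derive. apply is_derive_mass; [exact HB|lra]. }
    cont.
  - rewrite RInt_point, mass_0. unfold zero; simpl. ring.
Qed.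

Lemma sol_dependence kap C w B rho :
  (forall t, -2 < t < 2 -> continuous B t) -> 0 < rho < 2 ->
  exists L, 0 < L /\ forall a b z, 0 <= z <= rho ->
    Rabs (sol kap C w B a z - sol kap C w B b z) <= L * Rabs (a - b).
Proof.
  intros HB Hrho. assert (HF := admissible_nonlinearity kap C w B HB).
  destruct (picard_dependence _ rho HF Hrho) as (L & HL0 & HL).
  exists L. split; [exact HL0|]. intros a b z Hz.
  destruct (picard_sol_spec _ a HF) as (Ca & Ea), (picard_sol_spec _ b HF) as (Cb & Eb).
  apply (HL a b _ _ 0 rho); try lra; auto; intros; [apply Ea|apply Eb]; lra.
Qed.

Lemma mass_dependence kap C w B rho :
  (forall t, -2 < t < 2 -> continuous B t) -> 0 < rho < 2 ->
  exists L, 0 < L /\ forall a b,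
    Rabs (mass kap C w B a rho - mass kap C w B b rho) <= L * Rabs (a - b).
Proof.
  intros HB Hrho.
  destruct (sol_dependence kap C w B rho HB Hrho) as (L & HL0 & HL).
  destruct (continuous_bounded B 0 rho) as (M & HM0 & HM); [lra|intros; apply HB; lra|].
  exists (rho * (exp M * L)). split.
  { apply Rmult_lt_0_compat; [lra|]. apply Rmult_lt_0_compat; [apply exp_pos|exact HL0]. }
  intros a b.
  assert (Hex : forall c, ex_RInt (fun t => exp (Rmin (sol kap C w B c t) (B t))) 0 rho).
  { intros c. apply (ex_RInt_continuous (V := R_CompleteNormedModule)).
    rewrite Rmin_left, Rmax_right by lra. intros t Ht. apply continuous_cut_exp; [exact HB|lra]. }
  unfold mass. rewrite <- (RInt_minus (V := R_CompleteNormedModule)) by apply Hex.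
  replace (rho * (exp M * L) * Rabs (a - b)) with ((rho - 0) * (exp M * (L * Rabs (a - b)))) by ring.
  apply abs_RInt_le_const; [lra| |].
  - apply (ex_RInt_minus (V := R_NormedModule)); apply Hex.
  - intros t Ht. eapply Rle_trans; [apply (exp_Rmin_lipschitz _ _ (B t))|].
    apply Rmult_le_compat; [left; apply exp_pos|apply Rabs_pos| |now apply HL].
    apply exp_le_compat. generalize (HM t Ht) (Rle_abs (B t)). lra.
Qed.

Lemma mass_incr kap C w B a x y :
  (forall t, -2 < t < 2 -> continuous B t) -> 0 <= x -> x <= y -> y < 2 ->
  mass kap C w B a x <= mass kap C w B a y.
Proof.
  intros HB Hx Hxy Hy.
  apply (le_of_derive_nonneg (mass kap C w B a)
    (fun z => exp (Rmin (sol kap C w B a z) (B z)))); [exact Hxy| | |].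
  - intros t Ht. apply is_derive_mass; [exact HB|lra].
  - intros t Ht. eapply continuous_of_derive. apply is_derive_mass; [exact HB|lra].
  - intros t _. left. apply exp_pos.
Qed.

(** The limit at z = 2 along one sequence. Since [Lim_seq] is total, the total mass is a plain
    function of the start; it is the true left limit for monotone bounded f, by [end_value_spec]. *)
Definition end_value (f : R -> R) : R := real (Lim_seq (fun n => f (2 - / 2 ^ n))).

Lemma end_value_spec (f : R -> R) (K : R) :
  (forall x y, 0 <= x -> x <= y -> y < 2 -> f x <= f y) ->
  (forall x, 0 <= x < 2 -> f x <= K) ->
  (forall x, 0 <= x < 2 -> f x <= end_value f) /\
  (forall eps, 0 < eps -> exists x, 0 <= x < 2 /\
     forall y, x <= y < 2 -> end_value f - eps < f y) /\
  end_value f <= K.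
Proof.
  intros Hi HK.
  assert (P2 : forall n, 0 < / 2 ^ n <= 1).
  { intros n. split; [apply Rinv_0_lt_compat, pow_lt; lra|].
    rewrite <- Rinv_1. apply Rinv_le_contravar; [lra|]. apply pow_R1_Rle. lra. }
  set (s := fun n => f (2 - / 2 ^ n)).
  assert (Hs : forall n, s n <= s (S n)).
  { intros n. apply Hi; [generalize (P2 n); lra| |generalize (P2 (S n)); lra].
    assert (/ 2 ^ S n = / 2 ^ n / 2) by (simpl; field; apply pow_nonzero; lra).
    generalize (P2 n). lra. }
  assert (HsK : forall n, s n <= K) by (intros n; apply HK; generalize (P2 n); lra).
  destruct (ex_finite_lim_seq_incr s K Hs HsK) as (l & Hl).
  assert (El : end_value f = l).
  { unfold end_value. fold s. now rewrite (is_lim_seq_unique _ _ Hl). }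
  rewrite El. repeat split.
  - intros x Hx. destruct (half_pow_lt 1 (2 - x)) as (n & Hn); [lra|].
    unfold Rdiv in Hn. rewrite Rmult_1_l in Hn.
    apply Rle_trans with (s n); [apply Hi; generalize (P2 n); lra|].
    now apply is_lim_seq_incr_compare.
  - intros eps He. apply is_lim_seq_spec in Hl. destruct (Hl (mkposreal _ He)) as (N & HN).
    specialize (HN N (Nat.le_refl N)). simpl in HN. apply Rabs_def2 in HN.
    exists (2 - / 2 ^ N). split; [generalize (P2 N); lra|]. intros y Hy.
    apply Rlt_le_trans with (s N); [lra|]. apply Hi; generalize (P2 N); lra.
  - apply (is_lim_seq_le s (fun _ => K) l K HsK Hl). apply is_lim_seq_const.
Qed.

Lemma intermediate_value (f : R -> R) (a b y : R) :
  a <= b -> (forall x, a <= x <= b -> continuous f x) ->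
  f a <= y <= f b \/ f b <= y <= f a -> exists x, a <= x <= b /\ f x = y.
Proof.
  (* Clamping to [a, b] makes the function continuous on all of R, as [IVT_gen] demands. *)
  intros Hab Hf Hy. set (cl := fun x => Rmax a (Rmin b x)).
  assert (Hcl : forall x, a <= cl x <= b).
  { intros x. unfold cl, Rmax, Rmin. destruct (Rle_dec b x), (Rle_dec a _); lra. }
  assert (Cl : forall x, continuous cl x).
  { intros x. apply (continuous_ext (fun x => - Rmin (- a) (- Rmin b x))).
    - intros t. unfold cl, Rmax, Rmin. destruct (Rle_dec b t), (Rle_dec _ _), (Rle_dec _ _); lra.
    - apply continuous_Ropp, continuous_Rmin_comp; [cont|]. apply continuous_Ropp.
      apply (continuous_Rmin_comp (fun _ => b) (fun x => x)); cont. }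
  destruct (IVT_gen (fun x => f (cl x)) a b y) as (x & _ & E).
  - intros x. apply continuity_pt_filterlim.
    apply (continuous_comp cl f); [apply Cl|apply Hf, Hcl].
  - assert (Ea : cl a = a).
    { unfold cl. rewrite (Rmin_right b a), Rmax_left; lra. }
    assert (Eb : cl b = b).
    { unfold cl. rewrite (Rmin_left b b), Rmax_right; lra. }
    rewrite Ea, Eb. unfold Rmin, Rmax. destruct (Rle_dec (f a) (f b)); lra.
  - exists (cl x). split; [apply Hcl|exact E].
Qed.

Lemma axial_bvp_of_z (kap C w c : R) (u p : R -> R) :
  (forall z, 0 < z < 2 ->
     is_derive u z (p z / (z * (2 - z))) /\
     is_derive p z (kap * exp (u z) + C + 2 * w * (z - 1)) /\
     Rabs (p z) <= c * (z * (2 - z))) ->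
  axial_bvp kap C w.
Proof.
  intros H. exists (fun x => u (1 * x + 1)), (fun x => p (1 * x + 1)), c.
  intros x Hx. destruct (H (1 * x + 1) ltac:(lra)) as (H1 & H2 & H3).
  replace ((1 * x + 1) * (2 - (1 * x + 1))) with (1 - x ^ 2) in * by ring.
  split; [|split; [|exact H3]].
  - replace (p (1 * x + 1) / (1 - x ^ 2)) with (1 * (p (1 * x + 1) / (1 - x ^ 2))) by ring.
    exact (is_derive_affine u 1 1 x _ H1).
  - replace (kap * exp (u (1 * x + 1)) + C + 2 * w * x) with
      (1 * (kap * exp (u (1 * x + 1)) + C + 2 * w * (1 * x + 1 - 1))) by ring.
    exact (is_derive_affine p 1 1 x _ H2).
Qed.

(** * Existence for negative C *)

(* Applied to v = u + w z, for which (z (2 - z) v')' = g + C. *)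
Lemma maximum_principle (v P g : R -> R) (C b : R) :
  (forall z, 0 <= z < 2 -> continuous v z) ->
  (forall z, 0 <= z < 2 -> continuous P z) ->
  (forall z, 0 < z < 2 -> is_derive v z (P z / (z * (2 - z)))) ->
  (forall z, 0 < z < 2 -> is_derive P z (g z + C)) ->
  (forall z, 0 < z < 2 -> b < v z -> 0 < g z + C) ->
  P 0 = 0 ->
  (forall eps, 0 < eps -> exists x, 0 <= x < 2 /\ forall y, x <= y < 2 -> P y < eps) ->
  forall z, 0 < z < 2 -> v z <= b.
Proof.
  intros Cv CP Dv DP Hg P00 Pend z0 Hz0. apply Rnot_lt_le. intros Hb.
  assert (Pos : forall z, 0 < z < 2 -> 0 < z * (2 - z)) by (intros; nra).
  assert (Up : forall x y, 0 <= x -> x < y -> y < 2 ->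
    (forall t, x < t < y -> 0 < P t) -> v x < v y).
  { intros x y Hx Hxy Hy HP.
    apply (lt_of_derive_pos v (fun z => P z / (z * (2 - z)))); [exact Hxy| | |].
    - intros t Ht. apply Dv. lra.
    - intros t Ht. apply Cv. lra.
    - intros t Ht. apply Rdiv_lt_0_compat; [now apply HP|apply Pos; lra]. }
  assert (PUp : forall x y, 0 <= x -> x < y -> y < 2 ->
    (forall t, x < t < y -> b < v t) -> P x < P y).
  { intros x y Hx Hxy Hy HP. apply (lt_of_derive_pos P (fun z => g z + C)); [exact Hxy| | |].
    - intros t Ht. apply DP. lra.
    - intros t Ht. apply CP. lra.
    - intros t Ht. apply Hg; [lra|now apply HP]. }
  (* If P were negative at a maximum z > 0, v would be decreasing just to the left of z and hence
     larger there. *)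
  assert (MaxP : forall z y, 0 <= z -> z <= y -> y < 2 ->
    (forall t, 0 <= t <= y -> v t <= v z) -> 0 <= P z).
  { intros z y Hz Hzy Hy Hmax. destruct (Req_dec z 0) as [->|Hn]; [lra|].
    apply Rnot_lt_le. intros HP.
    destruct (continuous_eps P z (- P z) (CP z ltac:(lra)) ltac:(lra)) as (d & Hd & H).
    assert (Hm1 := Rmin_l d z). assert (Hm2 := Rmin_r d z).
    assert (Hm : 0 < Rmin d z) by (apply Rmin_pos; lra).
    assert (v z < v (z - Rmin d z / 2)); [|specialize (Hmax (z - Rmin d z / 2)); lra].
    apply Ropp_lt_cancel.
    apply (lt_of_derive_pos (fun t => - v t) (fun t => - (P t / (t * (2 - t))))); [lra| | |].
    - intros t Ht. apply (is_derive_opp v t). apply Dv. lra.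
    - intros t Ht. apply continuous_Ropp, Cv. lra.
    - intros t Ht. assert (HPt := H t ltac:(lra)). apply Rabs_def2 in HPt.
      assert (0 < - P t / (t * (2 - t))).
      { apply Rdiv_lt_0_compat; [lra|apply Pos; lra]. }
      unfold Rdiv in *. lra. }
  (* Above level b the maximum of v over [0, y] can only sit at y: at an earlier maximum P is
     nonnegative, and since P increases where v > b, v would keep growing to the right. *)
  assert (Last : forall y, z0 <= y < 2 -> v z0 <= v y /\ 0 <= P y).
  { intros y Hy.
    destruct (continuity_ab_maj v 0 y) as (zs & Hmax & Hzs); [lra| |].
    { intros c Hc. apply continuity_pt_filterlim, Cv. lra. }
    assert (Hz0s := Hmax z0 ltac:(lra)).
    assert (HP := MaxP zs y ltac:(lra) ltac:(lra) ltac:(lra) Hmax).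
    destruct (Req_dec zs y) as [->|Hne]; [split; lra|exfalso].
    destruct (continuous_eps v zs (v zs - b) (Cv zs ltac:(lra)) ltac:(lra)) as (d & Hd & H).
    assert (Hm1 := Rmin_l d (y - zs)). assert (Hm2 := Rmin_r d (y - zs)).
    assert (Hm : 0 < Rmin d (y - zs)) by (apply Rmin_pos; lra).
    assert (Hv : forall t, zs < t < zs + Rmin d (y - zs) -> b < v t).
    { intros t Ht. assert (HPt := H t ltac:(lra)). apply Rabs_def2 in HPt. lra. }
    assert (v zs < v (zs + Rmin d (y - zs) / 2)); [|specialize (Hmax (zs + Rmin d (y - zs) / 2)); lra].
    apply Up; try lra. intros t Ht. apply Rle_lt_trans with (P zs); [exact HP|].
    apply PUp; try lra. intros s Hs. apply Hv. lra. }
  (* From z0 on, v stays above b, so P is increasing and positive at z1, against the assumption that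
     P is eventually below every positive bound. *)
  set (z1 := (z0 + 2) / 2).
  assert (HP1 : 0 < P z1).
  { apply Rle_lt_trans with (P z0); [apply Last; lra|]. unfold z1.
    apply PUp; try lra. intros t Ht. destruct (Last t ltac:(lra)). lra. }
  destruct (Pend (P z1) HP1) as (x & Hx & HPx).
  set (y := (Rmax x z1 + 2) / 2).
  assert (Hxm := Rmax_l x z1). assert (Hzm := Rmax_r x z1).
  assert (Hm2 : Rmax x z1 < 2) by (apply Rmax_lub_lt; unfold z1; lra).
  assert (P z1 < P y).
  { apply PUp; unfold y, z1 in *; try lra. intros t Ht. destruct (Last t ltac:(lra)). lra. }
  specialize (HPx y ltac:(unfold y; lra)). lra.
Qed.

Lemma axial_bvp_pos (C w : R) : C < 0 -> axial_bvp 1 C w.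
Proof.
  (* The maximum principle will give u <= ln (-C) + 4 |w|, strictly below this height, so that the
     cut-off disappears. The summand 2 also makes e^b exceed -2 C, so that a saturated cut-off on
     [0, 1] alone already carries more than the required mass. *)
  intros HC. set (b := ln (- C) + 4 * Rabs w + 2). set (B := fun _ : R => b).
  set (E := exp b).
  assert (HB : forall t, -2 < t < 2 -> continuous B t) by (intros; apply continuous_const).
  assert (Hw := Rabs_pos w). assert (HE0 : 0 < E) by apply exp_pos.
  assert (HE : -2 * C < E).
  { unfold E, b. rewrite !exp_plus, exp_ln by lra.
    assert (1 <= exp (4 * Rabs w)) by (rewrite <- exp_0; apply exp_le_compat; lra).
    assert (2 < exp 2) by (generalize (exp_ineq1_le 2); lra).
    assert (- C * 1 <= - C * exp (4 * Rabs w)) by (apply Rmult_le_compat_l; lra). nra. }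
  set (u := sol 1 C w B). set (m := mass 1 C w B).
  set (g := fun a t => exp (Rmin (u a t) b)).
  assert (Hg : forall a t, 0 < g a t <= E).
  { intros a t. split; [apply exp_pos|]. apply exp_le_compat, Rmin_r. }
  assert (Dm : forall a z, -2 < z < 2 -> is_derive (m a) z (g a z)).
  { intros a z Hz. exact (is_derive_mass 1 C w B a z HB Hz). }
  assert (Cm : forall a z, -2 < z < 2 -> continuous (m a) z).
  { intros a z Hz. eapply continuous_of_derive. now apply Dm. }
  assert (m0 : forall a, m a 0 = 0) by (intros; apply mass_0).
  assert (Lm : forall a x y, 0 <= x -> x <= y -> y < 2 -> 0 <= m a y - m a x <= E * (y - x)).
  { intros a x y Hx Hxy Hy. split; [generalize (mass_incr 1 C w B a x y HB Hx Hxy Hy); unfold m; lra|].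
    assert (Rabs (m a y - m a x) <= E * y - E * x).
    { apply (abs_le_of_derive (m a) (g a) (fun y => E * y) (fun _ => E)); [exact Hxy| | |].
      - intros t Ht. apply Dm. lra.
      - intros t _. auto_derive; [trivial|ring].
      - intros t _. destruct (Hg a t). rewrite Rabs_pos_eq; lra. }
    generalize (Rle_abs (m a y - m a x)). lra. }
  set (M := fun a => end_value (m a)).
  (* The tail beyond z is bounded independently of [a]; this transfers continuity in [a] from the
     mass at a fixed z < 2 to the total mass. *)
  assert (HM : forall a z, 0 <= z < 2 -> 0 <= M a - m a z <= E * (2 - z)).
  { intros a z Hz.
    destruct (end_value_spec (m a) (2 * E)) as (H1 & H2 & _).
    - intros x y Hx Hxy Hy. generalize (Lm a x y Hx Hxy Hy). lra.
    - intros x Hx. generalize (Lm a 0 x ltac:(lra) ltac:(lra) ltac:(lra)). rewrite m0. nra.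
    - split; [generalize (H1 z Hz); unfold M; lra|]. apply le_epsilon. intros eps He.
      destruct (H2 eps He) as (x & Hx & Hy). set (y := Rmax x z).
      assert (Hxm := Rmax_l x z). assert (Hzm := Rmax_r x z).
      assert (Hm2 : Rmax x z < 2) by (apply Rmax_lub_lt; lra).
      specialize (Hy y ltac:(unfold y; lra)).
      assert (HEy : E * y <= E * 2) by (apply Rmult_le_compat_l; [lra|left; exact Hm2]).
      generalize (Lm a z y ltac:(lra) Hzm Hm2). unfold M. lra. }
  assert (CM : forall a, continuous M a).
  { intros a. apply filterlim_locally. intros eps. assert (Heps := cond_pos eps).
    set (z := 2 - Rmin 1 (eps / (4 * E))).
    assert (0 < eps / (4 * E)) by (apply Rdiv_lt_0_compat; lra).
    assert (Hz1 := Rmin_l 1 (eps / (4 * E))). assert (Hz2 := Rmin_r 1 (eps / (4 * E))).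
    assert (Hz3 : 0 < Rmin 1 (eps / (4 * E))) by (apply Rmin_pos; lra).
    assert (HEz : E * (2 - z) <= eps / 4).
    { unfold z. replace (eps / 4) with (E * (eps / (4 * E))) by (field; lra).
      apply Rmult_le_compat_l; lra. }
    destruct (mass_dependence 1 C w B z HB ltac:(unfold z; lra)) as (L & HL0 & HL).
    assert (Hd : 0 < eps / (4 * L)) by (apply Rdiv_lt_0_compat; lra).
    exists (mkposreal _ Hd). intros a' Ha'. change (Rabs (a' - a) < eps / (4 * L)) in Ha'.
    change (Rabs (M a' - M a) < eps).
    assert (Hdm : Rabs (m a' z - m a z) <= eps / 4).
    { eapply Rle_trans; [apply HL|]. replace (eps / 4) with (L * (eps / (4 * L))) by (field; lra).
      apply Rmult_le_compat_l; lra. }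
    assert (HM1 := HM a z ltac:(unfold z; lra)). assert (HM2 := HM a' z ltac:(unfold z; lra)).
    apply Rabs_le_between in Hdm. apply Rabs_def1; lra. }
  (* A bound for |p'|, hence for |p| / z, and at the critical mass for |p| / (2 - z) as well. *)
  set (f0 := - C + 2 * Rabs w + E).
  set (p := fun a z => C * z - w * (z * (2 - z)) + 1 * m a z).
  assert (Hwab : - Rabs w <= w <= Rabs w) by (apply Rabs_le_between; lra).
  assert (Hp : forall a z, 0 <= z < 2 -> Rabs (p a z) <= f0 * z).
  { intros a z Hz. generalize (Lm a 0 z ltac:(lra) ltac:(lra) ltac:(lra)).
    rewrite m0, !Rminus_0_r. intros Hm.
    assert (Hq : 0 <= z * (2 - z) <= 2 * z) by nra.
    assert (H1 : w * (z * (2 - z)) <= Rabs w * (2 * z)) by nra.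
    assert (H2 : - (Rabs w * (2 * z)) <= w * (z * (2 - z))) by nra.
    assert (C * z <= 0) by nra. assert (0 <= Rabs w * z) by nra.
    unfold p, f0. apply Rabs_le_between. split; nra. }
  assert (Du : forall a z, 0 < z < 2 -> is_derive (u a) z (p a z / (z * (2 - z)))).
  { intros a z Hz. exact (is_derive_sol 1 C w B a z HB Hz). }
  assert (Cu : forall a z, -2 < z < 2 -> continuous (u a) z).
  { intros a z Hz. now apply continuous_sol. }
  assert (u0 : forall a, u a 0 = a) by (intros; now apply sol_0).
  assert (f0pos : 0 <= f0) by (unfold f0; lra).
  assert (Hu : forall a d z, 0 < d -> 0 <= z <= 2 - d -> Rabs (u a z - a) <= f0 / d * 2).
  { intros a d z Hd Hz. assert (Hfd : 0 <= f0 / d) by now apply Rdiv_le_0_compat.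
    assert (Hq : forall x, 0 < x < z -> - (f0 / d) <= p a x / (x * (2 - x)) <= f0 / d).
    { intros x Hx. assert (Hpx := Hp a x ltac:(lra)). apply Rabs_le_between in Hpx.
      assert (Hx0 : 0 < x * (2 - x)) by nra.
      assert (f0 / d * (x * (2 - x)) >= f0 * x).
      { replace (f0 * x) with (f0 / d * (x * d)) by (field; lra).
        apply Rle_ge, Rmult_le_compat_l; [exact Hfd|]. nra. }
      split; apply (Rmult_le_reg_r (x * (2 - x))); try exact Hx0;
        unfold Rdiv at 2; rewrite ?Rmult_assoc;
        [|unfold Rdiv at 1; rewrite ?Rmult_assoc];
        rewrite ?Rinv_l, ?Rmult_1_r by lra; nra. }
    assert (Cl : forall x, 0 <= x <= z -> continuous (fun x => f0 / d * x) x).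
    { intros x _. cont. }
    assert (H1 : u a 0 + f0 / d * 0 <= u a z + f0 / d * z).
    { apply (le_of_derive_nonneg (fun x => u a x + f0 / d * x)
        (fun x => p a x / (x * (2 - x)) + f0 / d * 1)); [lra| | |].
      - intros x Hx. apply (is_derive_plus (u a)); [apply Du; lra|].
        apply (is_derive_scal (fun x => x)), (is_derive_id x).
      - intros x Hx. apply continuous_Rplus; [apply Cu; lra|now apply Cl].
      - intros x Hx. specialize (Hq x Hx). lra. }
    assert (H2 : u a z - f0 / d * z <= u a 0 - f0 / d * 0).
    { apply (ge_of_derive_nonpos (fun x => u a x - f0 / d * x)
        (fun x => p a x / (x * (2 - x)) - f0 / d * 1)); [lra| | |].
      - intros x Hx. apply (is_derive_minus (u a)); [apply Du; lra|].
        apply (is_derive_scal (fun x => x)), (is_derive_id x).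
      - intros x Hx. apply continuous_Rminus; [apply Cu; lra|now apply Cl].
      - intros x Hx. specialize (Hq x Hx). lra. }
    rewrite u0 in *. apply Rabs_le_between. nra. }
  (* The start is so high that u >= b on all of [0, 1]: the integrand there equals E. *)
  assert (Hhigh : exists a, -2 * C <= M a).
  { exists (b + f0 / 1 * 2 / 1).
    set (a := b + f0 / 1 * 2 / 1).
    assert (g1 : forall z, 0 <= z <= 1 -> g a z = E).
    { intros z Hz. unfold g, E. f_equal. apply Rmin_right.
      assert (H := Hu a 1 z ltac:(lra) ltac:(lra)). apply Rabs_le_between in H. unfold a in *. lra. }
    assert (m a 0 - E * 0 <= m a 1 - E * 1).
    { apply (le_of_derive_nonneg (fun z => m a z - E * z) (fun z => g a z - E * 1)); [lra| | |].
      - intros x Hx. apply (is_derive_minus (m a)); [apply Dm; lra|].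
        apply (is_derive_scal (fun x => x)), (is_derive_id x).
      - intros x Hx. apply continuous_Rminus; [apply Cm; lra|cont].
      - intros x Hx. rewrite g1; lra. }
    rewrite m0 in *. generalize (HM a 1 ltac:(lra)). lra. }
  (* The length d makes the last stretch carry at most E d <= -C / 2, whatever u does there; before
     it, a low start keeps the integrand below -C / 2. The total is at most -3 C / 2. *)
  assert (Hlow : exists a, M a <= -2 * C).
  { set (d := - C / (- C + 2 * E)).
    assert (Hd : 0 < d < 1).
    { split; [apply Rdiv_lt_0_compat; lra|]. apply (Rmult_lt_reg_r (- C + 2 * E)); [lra|].
      unfold d. unfold Rdiv. rewrite Rmult_assoc, Rinv_l; lra. }
    assert (HEd : E * d <= - C / 2).
    { apply (Rmult_le_reg_r (- C + 2 * E)); [lra|].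
      unfold d. unfold Rdiv. rewrite !Rmult_assoc, Rinv_l; nra. }
    set (a := ln (- C / 2) - f0 / d * 2). exists a.
    assert (gl : forall z, 0 <= z <= 2 - d -> g a z <= - C / 2).
    { intros z Hz. unfold g. rewrite <- (exp_ln (- C / 2)) by lra. apply exp_le_compat.
      assert (H := Hu a d z ltac:(lra) ltac:(lra)). apply Rabs_le_between in H.
      generalize (Rmin_l (u a z) b). unfold a in *. lra. }
    assert (m a (2 - d) - (- C / 2) * (2 - d) <= m a 0 - (- C / 2) * 0).
    { apply (ge_of_derive_nonpos (fun z => m a z - (- C / 2) * z)
        (fun z => g a z - (- C / 2) * 1)); [lra| | |].
      - intros x Hx. apply (is_derive_minus (m a)); [apply Dm; lra|].
        apply (is_derive_scal (fun x => x)), (is_derive_id x).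
      - intros x Hx. apply continuous_Rminus; [apply Cm; lra|cont].
      - intros x Hx. generalize (gl x ltac:(lra)). lra. }
    rewrite m0 in *. generalize (HM a (2 - d) ltac:(lra)). nra. }
  destruct Hhigh as (a1 & Ha1), Hlow as (a2 & Ha2).
  assert (Hsol : exists a, M a = -2 * C).
  { destruct (Rle_dec a1 a2) as [H12|H12].
    - destruct (intermediate_value M a1 a2 (-2 * C)) as (a & _ & Ha); [lra|intros; apply CM|lra|now exists a].
    - destruct (intermediate_value M a2 a1 (-2 * C)) as (a & _ & Ha); [lra|intros; apply CM|lra|now exists a]. }
  destruct Hsol as (a & Ha).
  (* Adding w z absorbs the rotation term into the unknown; what remains of the momentum, C z + m,
     is at most -C (2 - z) because the total mass is -2 C. *)
  assert (Hbound : forall z, 0 < z < 2 -> u a z + w * z <= ln (- C) + 2 * Rabs w).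
  { apply (maximum_principle (fun z => u a z + w * z) (fun z => C * z + m a z) (g a) C).
    - intros z Hz. apply continuous_Rplus; [apply Cu; lra|cont].
    - intros z Hz. apply continuous_Rplus; [cont|apply Cm; lra].
    - intros z Hz.
      replace ((C * z + m a z) / (z * (2 - z))) with (p a z / (z * (2 - z)) + w * 1)
        by (unfold p; field; lra).
      apply (is_derive_plus (u a)); [now apply Du|].
      apply (is_derive_scal (fun x => x)), (is_derive_id z).
    - intros z Hz. replace (g a z + C) with (C * 1 + g a z) by ring.
      apply (is_derive_plus (fun z => C * z)); [|apply Dm; lra].
      apply (is_derive_scal (fun x => x)), (is_derive_id z).
    - intros z Hz Hv. unfold g. assert (HeC := exp_ln (- C) ltac:(lra)).
      assert (ln (- C) < Rmin (u a z) b).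
      { apply Rmin_glb_lt; [nra|unfold b; lra]. }
      generalize (exp_increasing _ _ H). lra.
    - rewrite m0. ring.
    - intros eps He. exists (2 - Rmin 1 (eps / (- C * 2))).
      assert (H0 : 0 < eps / (- C * 2)) by (apply Rdiv_lt_0_compat; lra).
      assert (Hz1 := Rmin_l 1 (eps / (- C * 2))). assert (Hz2 := Rmin_r 1 (eps / (- C * 2))).
      assert (Hz3 : 0 < Rmin 1 (eps / (- C * 2))) by (apply Rmin_pos; lra).
      split; [lra|]. intros y Hy. generalize (HM a y ltac:(lra)). rewrite Ha. intros HMy.
      assert (- C * (2 - y) <= - C * (eps / (- C * 2))) by (apply Rmult_le_compat_l; lra).
      replace (- C * (eps / (- C * 2))) with (eps / 2) in * by (field; lra). lra. }
  assert (Hcut : forall z, 0 < z < 2 -> g a z = exp (u a z)).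
  { intros z Hz. unfold g. f_equal. apply Rmin_left. specialize (Hbound z Hz).
    unfold b. nra. }
  apply (axial_bvp_of_z 1 C w f0 (u a) (p a)).
  intros z Hz. split; [now apply Du|split].
  - replace (1 * exp (u a z) + C + 2 * w * (z - 1)) with
      (C + 2 * w * (z - 1) + 1 * g a z) by (rewrite Hcut by exact Hz; ring).
    apply (is_derive_plus (fun z => C * z - w * (z * (2 - z)))).
    + auto_derive; [trivial|ring].
    + apply (is_derive_scal (m a)). apply Dm. lra.
  (* As the total mass is -2 C, p also vanishes at z = 2. The bounds f0 z and f0 (2 - z), each used
     on the half next to its own pole, give f0 z (2 - z). *)
  - assert (H1 := Hp a z ltac:(lra)).
    assert (H2 : Rabs (p a z) <= f0 * (2 - z)).
    { generalize (HM a z ltac:(lra)). rewrite Ha. intros H2.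
      assert (Hq : 0 <= z * (2 - z) <= 2 * (2 - z)) by nra.
      assert (H3 : w * (z * (2 - z)) <= Rabs w * (2 * (2 - z))) by nra.
      assert (H4 : - (Rabs w * (2 * (2 - z))) <= w * (z * (2 - z))) by nra.
      assert (C * (2 - z) <= 0) by nra. assert (0 <= Rabs w * (2 - z)) by nra.
      unfold p, f0. apply Rabs_le_between. split; nra. }
    destruct (Rle_dec z 1).
    + eapply Rle_trans; [exact H1|]. apply Rmult_le_compat_l; [exact f0pos|nra].
    + eapply Rle_trans; [exact H2|]. apply Rmult_le_compat_l; [exact f0pos|nra].
Qed.

(** * Existence for C between 0 and 4 *)

(* The case kap = -1 without cut-off; m is the mass int exp u, and continuity
   of u at z = 0 singles out the solution that is regular at that pole. *)
Definition regular_sol (C w a : R) (u m : R -> R) : Prop :=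
  u 0 = a /\ m 0 = 0 /\
  (forall z, 0 <= z < 2 -> continuous u z) /\
  (forall z, 0 <= z < 2 -> is_derive m z (exp (u z))) /\
  (forall z, 0 < z < 2 ->
     is_derive u z ((C * z - w * (z * (2 - z)) - m z) / (z * (2 - z)))).

(** The derivative of the mass in the cylindrical variable s with ds = dz / (z (2 - z)), for which
    the poles lie at s = -infinity and s = +infinity. *)
Definition density (u : R -> R) (z : R) : R := z * (2 - z) * exp (u z).

Lemma weight_pos z : 0 < z < 2 -> 0 < z * (2 - z).
Proof. intros; nra. Qed.

Lemma regular_sol_mass_continuous C w a u m :
  regular_sol C w a u m -> forall z, 0 <= z < 2 -> continuous m z.
Proof.
  intros (_ & _ & _ & Dm & _) z Hz. eapply continuous_of_derive. now apply Dm.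
Qed.

Lemma regular_sol_mass_incr C w a u m :
  regular_sol C w a u m -> forall x y, 0 <= x -> x <= y -> y < 2 -> m x <= m y.
Proof.
  intros H x y Hx Hxy Hy. assert (Cm := regular_sol_mass_continuous _ _ _ _ _ H).
  destruct H as (_ & _ & _ & Dm & _).
  apply (le_of_derive_nonneg m (fun z => exp (u z))); [exact Hxy| | |].
  - intros t Ht. apply Dm. lra.
  - intros t Ht. apply Cm. lra.
  - intros t _. left. apply exp_pos.
Qed.

Lemma regular_sol_mass_nonneg C w a u m :
  regular_sol C w a u m -> forall z, 0 <= z < 2 -> 0 <= m z.
Proof.
  intros H z Hz. rewrite <- (proj1 (proj2 H)).
  apply (regular_sol_mass_incr _ _ _ _ _ H); lra.
Qed.

Lemma mass_le_of_sol_le C w a u m b x :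
  regular_sol C w a u m -> 0 <= x < 2 -> (forall z, 0 < z < x -> u z <= b) ->
  m x <= exp b * x.
Proof.
  intros H Hx Hb. assert (Cm := regular_sol_mass_continuous _ _ _ _ _ H).
  destruct H as (_ & m0 & _ & Dm & _).
  assert (m x - exp b * x <= m 0 - exp b * 0).
  { apply (ge_of_derive_nonpos (fun z => m z - exp b * z) (fun z => exp (u z) - exp b * 1));
      [lra| | |].
    - intros t Ht. apply (is_derive_minus m); [apply Dm; lra|].
      apply (is_derive_scal (fun x => x)), (is_derive_id t).
    - intros t Ht. apply continuous_Rminus; [apply Cm; lra|cont].
    - intros t Ht. generalize (exp_le_compat _ _ (Hb t Ht)). lra. }
  lra.
Qed.

(** Dropping the terms with w and m, both of the favourable sign, leaves u' <= C / (2 - z). Stated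
    without [regular_sol], so that it applies to cut-off solutions before the cut-off is known to be
    inactive. *)
Lemma sol_upper_bound (C w a : R) (u m : R -> R) :
  0 <= w -> u 0 = a ->
  (forall z, 0 <= z < 2 -> continuous u z) ->
  (forall z, 0 <= z < 2 -> 0 <= m z) ->
  (forall z, 0 < z < 2 ->
     is_derive u z ((C * z - w * (z * (2 - z)) - m z) / (z * (2 - z)))) ->
  forall z, 0 <= z < 2 -> u z <= a - C * ln ((2 - z) / 2).
Proof.
  intros Hw u0 Cu Hm Du z Hz.
  assert (u z + C * ln ((2 - z) / 2) <= u 0 + C * ln ((2 - 0) / 2)).
  { apply (ge_of_derive_nonpos (fun z => u z + C * ln ((2 - z) / 2))
      (fun z => (C * z - w * (z * (2 - z)) - m z) / (z * (2 - z)) + - C / (2 - z))); [lra| | |].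
    - intros t Ht. apply (is_derive_plus u); [apply Du; lra|].
      auto_derive; [lra|field; lra].
    - intros t Ht. apply continuous_Rplus; [apply Cu; lra|].
      apply (ex_derive_continuous (fun z => C * ln ((2 - z) / 2))). auto_derive. lra.
    - intros t Ht. assert (Hq := weight_pos t ltac:(lra)).
      replace ((C * t - w * (t * (2 - t)) - m t) / (t * (2 - t)) + - C / (2 - t)) with
        (- (w * (t * (2 - t)) + m t) / (t * (2 - t))) by (field; lra).
      apply (Rmult_le_reg_r (t * (2 - t))); [exact Hq|].
      unfold Rdiv. rewrite Rmult_assoc, Rinv_l by lra.
      specialize (Hm t ltac:(lra)). nra. }
  replace ((2 - 0) / 2) with 1 in H by field. rewrite ln_1, u0 in H. lra.
Qed.

Lemma is_derive_density C w a u m z :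
  regular_sol C w a u m -> 0 < z < 2 ->
  is_derive (density u) z (exp (u z) * (2 - 2 * z + C * z - w * (z * (2 - z)) - m z)).
Proof.
  intros (_ & _ & _ & _ & Du) Hz. assert (D := Du z Hz).
  set (q := (C * z - w * (z * (2 - z)) - m z) / (z * (2 - z))) in *.
  replace (exp (u z) * (2 - 2 * z + C * z - w * (z * (2 - z)) - m z)) with
    ((2 - 2 * z) * exp (u z) + z * (2 - z) * (q * exp (u z))) by (unfold q; field; lra).
  apply (is_derive_mult (fun z => z * (2 - z)) (fun z => exp (u z))).
  - auto_derive; [trivial|ring].
  - apply (is_derive_comp exp u); [apply is_derive_exp|exact D].
  - intros; apply Rmult_comm.
Qed.

Lemma continuous_density C w a u m z :
  regular_sol C w a u m -> 0 <= z < 2 -> continuous (density u) z.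
Proof.
  intros (_ & _ & Cu & _) Hz. assert (continuous u z) by now apply Cu.
  unfold density. cont.
Qed.

Lemma density_nonneg u z : 0 <= z < 2 -> 0 <= density u z.
Proof.
  intros Hz. unfold density. apply Rmult_le_pos; [nra|left; apply exp_pos].
Qed.

(* For c = C this is the Pohozaev identity; other c absorb one-sided bounds on
   the derivative. *)
Lemma is_derive_pohozaev C w a u m c z :
  regular_sol C w a u m -> 0 < z < 2 ->
  is_derive (fun z => density u z + (m z * m z / 2 - c * m z)) z
    (exp (u z) * (2 - 2 * z + C * z - w * (z * (2 - z)) - c)).
Proof.
  intros H Hz. assert (DT := is_derive_density _ _ _ _ _ _ H Hz).
  destruct H as (_ & _ & _ & Dm & _). assert (D := Dm z ltac:(lra)).
  replace (exp (u z) * (2 - 2 * z + C * z - w * (z * (2 - z)) - c)) with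
    (exp (u z) * (2 - 2 * z + C * z - w * (z * (2 - z)) - m z) +
     ((exp (u z) * m z + m z * exp (u z)) * / 2 - c * exp (u z))) by field.
  apply (is_derive_plus (density u)); [exact DT|].
  apply (is_derive_minus (fun z => m z * m z / 2) (fun z => c * m z)).
  - apply (is_derive_ext (fun z => / 2 * (m z * m z))).
    { intros t. change (/ 2 * (m t * m t) = m t * m t / 2). field. }
    rewrite (Rmult_comm _ (/ 2)).
    apply (is_derive_scal (fun z => m z * m z)).
    apply (is_derive_mult m m); [exact D|exact D|intros; apply Rmult_comm].
  - now apply (is_derive_scal m).
Qed.

Lemma continuous_pohozaev C w a u m c z :
  regular_sol C w a u m -> 0 <= z < 2 ->
  continuous (fun z => density u z + (m z * m z / 2 - c * m z)) z.
Proof.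
  intros H Hz. assert (continuous (density u) z) by now apply (continuous_density C w a u m).
  assert (continuous m z) by now apply (regular_sol_mass_continuous C w a u m).
  unfold Rdiv. cont.
Qed.

Lemma pohozaev_le C w a u m c x y :
  regular_sol C w a u m -> 0 <= x -> x <= y -> y < 2 ->
  (forall t, x < t < y -> 2 - 2 * t + C * t - w * (t * (2 - t)) <= c) ->
  density u y + (m y * m y / 2 - c * m y) <= density u x + (m x * m x / 2 - c * m x).
Proof.
  intros H Hx Hxy Hy Hc.
  apply (ge_of_derive_nonpos (fun z => density u z + (m z * m z / 2 - c * m z))
    (fun z => exp (u z) * (2 - 2 * z + C * z - w * (z * (2 - z)) - c))); [exact Hxy| | |].
  - intros t Ht. apply (is_derive_pohozaev C w a); [exact H|lra].
  - intros t Ht. apply (continuous_pohozaev C w a); [exact H|lra].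
  - intros t Ht. specialize (Hc t Ht). generalize (exp_pos (u t)). nra.
Qed.

Lemma pohozaev_ge C w a u m c x y :
  regular_sol C w a u m -> 0 <= x -> x <= y -> y < 2 ->
  (forall t, x < t < y -> c <= 2 - 2 * t + C * t - w * (t * (2 - t))) ->
  density u x + (m x * m x / 2 - c * m x) <= density u y + (m y * m y / 2 - c * m y).
Proof.
  intros H Hx Hxy Hy Hc.
  apply (le_of_derive_nonneg (fun z => density u z + (m z * m z / 2 - c * m z))
    (fun z => exp (u z) * (2 - 2 * z + C * z - w * (z * (2 - z)) - c))); [exact Hxy| | |].
  - intros t Ht. apply (is_derive_pohozaev C w a); [exact H|lra].
  - intros t Ht. apply (continuous_pohozaev C w a); [exact H|lra].
  - intros t Ht. specialize (Hc t Ht). generalize (exp_pos (u t)). nra.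
Qed.

Lemma density_0 u : density u 0 = 0.
Proof. unfold density. ring. Qed.

(** * Mass and density near the far pole z = 2 *)

Lemma pohozaev_rate_le C w t :
  0 < C < 4 -> 0 <= w -> 0 < t < 2 -> 2 - 2 * t + C * t - w * (t * (2 - t)) <= 10.
Proof.
  intros HC Hw Ht. assert (0 <= w * (t * (2 - t))) by (apply Rmult_le_pos; nra). nra.
Qed.

(** With the crude rate 10 the Pohozaev quantity cannot rise above its value 0 at z = 0, so m^2 / 2
    <= 10 m. *)
Lemma mass_bounded C w a u m :
  0 < C < 4 -> 0 <= w -> regular_sol C w a u m -> forall z, 0 <= z < 2 -> m z <= 20.
Proof.
  intros HC Hw H z Hz.
  assert (H1 := pohozaev_le _ _ _ _ _ 10 0 z H ltac:(lra) ltac:(lra) ltac:(lra)).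
  rewrite density_0, (proj1 (proj2 H)) in H1.
  assert (H2 := density_nonneg u z Hz). assert (H3 := regular_sol_mass_nonneg _ _ _ _ _ H z Hz).
  apply Rnot_lt_le. intros H4.
  assert (m z * m z / 2 - 10 * m z <= 0); [|nra].
  apply Rle_trans with (density u z + (m z * m z / 2 - 10 * m z)); [lra|].
  eapply Rle_trans; [apply H1|lra].
  intros t Ht. apply pohozaev_rate_le; lra.
Qed.

Lemma end_mass_spec C w a u m :
  0 < C < 4 -> 0 <= w -> regular_sol C w a u m ->
  (forall x, 0 <= x < 2 -> m x <= end_value m) /\
  (forall eps, 0 < eps -> exists x, 0 <= x < 2 /\
     forall y, x <= y < 2 -> end_value m - eps < m y) /\
  end_value m <= 20.
Proof.
  intros HC Hw H. apply end_value_spec.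
  - apply (regular_sol_mass_incr _ _ _ _ _ H).
  - now apply (mass_bounded C w a u).
Qed.

(** A density bounded below would give m' >= eps / (2 (2 - z)), whose integral diverges
    logarithmically at z = 2, while the mass is bounded. *)
Lemma density_small_somewhere C w a u m x0 eps :
  0 < C < 4 -> 0 <= w -> regular_sol C w a u m -> 0 <= x0 < 2 -> 0 < eps ->
  exists x, x0 <= x < 2 /\ density u x < eps.
Proof.
  intros HC Hw H Hx0 He.
  (* Shrinking the distance to z = 2 by the factor e^(-k) would add mass eps k / 2 = 41 / 2, more
     than the bound 20. *)
  set (k := 41 / eps). set (y := 2 - (2 - x0) * exp (- k)).
  assert (Hk : 0 < k) by (apply Rdiv_lt_0_compat; lra).
  assert (Hek : 0 < exp (- k) < 1).
  { split; [apply exp_pos|]. rewrite <- exp_0. apply exp_increasing. lra. }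
  assert (Hy : x0 <= y < 2) by (unfold y; nra).
  apply NNPP. intros Hno.
  assert (Hall : forall x, x0 <= x < 2 -> eps <= density u x).
  { intros x Hx. apply Rnot_lt_le. intros Hlt. apply Hno. now exists x. }
  assert (m x0 + eps / 2 * ln (2 - x0) <= m y + eps / 2 * ln (2 - y)).
  { apply (le_of_derive_nonneg (fun z => m z + eps / 2 * ln (2 - z))
      (fun z => exp (u z) + - (eps / 2) / (2 - z))); [lra| | |].
    - intros t Ht. apply (is_derive_plus m); [apply H; lra|].
      auto_derive; [lra|field; lra].
    - intros t Ht. apply continuous_Rplus.
      + apply (regular_sol_mass_continuous _ _ _ _ _ H). lra.
      + apply (ex_derive_continuous (fun z => eps / 2 * ln (2 - z))). auto_derive. lra.
    - intros t Ht. assert (Hd := Hall t ltac:(lra)). unfold density in Hd.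
      assert (Hp := exp_pos (u t)).
      replace (exp (u t) + - (eps / 2) / (2 - t)) with
        ((2 * (2 - t) * exp (u t) - eps) / (2 * (2 - t))) by (field; lra).
      apply Rdiv_le_0_compat; [|lra]. assert (0 < (2 - t) * exp (u t)) by nra. nra. }
  assert (E : ln (2 - y) = ln (2 - x0) - k).
  { unfold y. replace (2 - (2 - (2 - x0) * exp (- k))) with ((2 - x0) * exp (- k)) by ring.
    rewrite ln_mult, ln_exp by (lra || apply exp_pos). ring. }
  rewrite E in H0. assert (E2 : eps / 2 * k = 41 / 2) by (unfold k; field; lra).
  generalize (mass_bounded C w a u m HC Hw H y ltac:(lra)).
  generalize (regular_sol_mass_nonneg C w a u m H x0 ltac:(lra)). nra.
Qed.

(** Smallness at one point persists: by the Pohozaev inequality with rate 10, the density rises by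
    at most 10 times the mass still to come, which is below eps / 20. *)
Lemma density_vanishes C w a u m eps :
  0 < C < 4 -> 0 <= w -> regular_sol C w a u m -> 0 < eps ->
  exists x, 0 <= x < 2 /\ forall y, x <= y < 2 -> density u y < eps.
Proof.
  intros HC Hw H He.
  destruct (end_mass_spec C w a u m HC Hw H) as (H1 & H2 & _).
  destruct (H2 (eps / 20) ltac:(lra)) as (x0 & Hx0 & Hm).
  destruct (density_small_somewhere C w a u m x0 (eps / 2) HC Hw H Hx0 ltac:(lra)) as (x & Hx & Hd).
  exists x. split; [lra|]. intros y Hy.
  assert (P := pohozaev_le _ _ _ _ _ 10 x y H ltac:(lra) ltac:(lra) ltac:(lra)).
  assert (density u y + (m y * m y / 2 - 10 * m y) <= density u x + (m x * m x / 2 - 10 * m x)).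
  { apply P. intros t Ht. apply pohozaev_rate_le; lra. }
  assert (m y - m x < eps / 20).
  { generalize (H1 y ltac:(lra)) (Hm x ltac:(lra)). lra. }
  assert (0 <= m x) by (apply (regular_sol_mass_nonneg C w a u m H); lra).
  assert (m x <= m y) by (apply (regular_sol_mass_incr C w a u m H); lra).
  nra.
Qed.

Lemma pohozaev_le_end C w a u m c x :
  0 < C < 4 -> 0 <= w -> regular_sol C w a u m -> 0 <= x < 2 ->
  (forall t, x < t < 2 -> 2 - 2 * t + C * t - w * (t * (2 - t)) <= c) ->
  end_value m * end_value m / 2 - c * end_value m <=
  density u x + (m x * m x / 2 - c * m x).
Proof.
  intros HC Hw H Hx Hc.
  destruct (end_mass_spec C w a u m HC Hw H) as (H1 & H2 & H3).
  set (M := end_value m) in *. apply le_epsilon. intros eps He.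
  set (K := 20 + Rabs c + 1). assert (HK : 0 < K) by (unfold K; generalize (Rabs_pos c); lra).
  destruct (H2 (eps / K)) as (x1 & Hx1 & Hm); [now apply Rdiv_lt_0_compat|].
  set (y := Rmax x x1).
  assert (Hy1 := Rmax_l x x1). assert (Hy2 := Rmax_r x x1).
  assert (Hy3 : y < 2) by (apply Rmax_lub_lt; lra). fold y in Hy1, Hy2.
  assert (P := pohozaev_le _ _ _ _ _ c x y H ltac:(lra) Hy1 Hy3 ltac:(intros; apply Hc; lra)).
  assert (Hd := density_nonneg u y ltac:(lra)).
  specialize (Hm y ltac:(lra)). specialize (H1 y ltac:(lra)).
  assert (Hm0 := regular_sol_mass_nonneg C w a u m H y ltac:(lra)).
  assert (E : (M * M / 2 - c * M) - (m y * m y / 2 - c * m y) = (M - m y) * ((M + m y) / 2 - c))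
    by field.
  assert (Hc1 : (M + m y) / 2 - c <= K).
  { unfold K. generalize (Rle_abs (- c)). rewrite Rabs_Ropp. lra. }
  assert ((M - m y) * ((M + m y) / 2 - c) <= (M - m y) * K) by (apply Rmult_le_compat_l; lra).
  assert ((M - m y) * K <= eps / K * K) by (apply Rmult_le_compat_r; lra).
  replace (eps / K * K) with eps in * by (field; lra). lra.
Qed.

(** In the limit the density at z = 2 must be shown to vanish; in the opposite inequality it is
    simply dropped as nonnegative. *)
Lemma pohozaev_ge_end C w a u m c x :
  0 < C < 4 -> 0 <= w -> regular_sol C w a u m -> 0 <= x < 2 ->
  (forall t, x < t < 2 -> c <= 2 - 2 * t + C * t - w * (t * (2 - t))) ->
  density u x + (m x * m x / 2 - c * m x) <=
  end_value m * end_value m / 2 - c * end_value m.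
Proof.
  intros HC Hw H Hx Hc.
  destruct (end_mass_spec C w a u m HC Hw H) as (H1 & H2 & H3).
  set (M := end_value m) in *. apply le_epsilon. intros eps He.
  set (K := 20 + Rabs c + 1). assert (HK : 0 < K) by (unfold K; generalize (Rabs_pos c); lra).
  destruct (H2 (eps / 2 / K)) as (x1 & Hx1 & Hm); [apply Rdiv_lt_0_compat; lra|].
  destruct (density_vanishes C w a u m (eps / 2) HC Hw H ltac:(lra)) as (x2 & Hx2 & Hd2).
  set (y := Rmax x (Rmax x1 x2)).
  assert (Hy0 : y < 2) by (apply Rmax_lub_lt; [lra|]; apply Rmax_lub_lt; lra).
  assert (Hy1 : x <= y) by apply Rmax_l.
  assert (Hy2 : x1 <= y) by (eapply Rle_trans; [apply Rmax_l|apply Rmax_r]).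
  assert (Hy3 : x2 <= y) by (eapply Rle_trans; [apply Rmax_r|apply Rmax_r]).
  assert (P := pohozaev_ge _ _ _ _ _ c x y H ltac:(lra) Hy1 Hy0 ltac:(intros; apply Hc; lra)).
  specialize (Hm y ltac:(lra)). specialize (H1 y ltac:(lra)). specialize (Hd2 y ltac:(lra)).
  assert (Hm0 := regular_sol_mass_nonneg C w a u m H y ltac:(lra)).
  assert (E : (m y * m y / 2 - c * m y) - (M * M / 2 - c * M) = (M - m y) * (c - (M + m y) / 2))
    by field.
  assert (Hc1 : c - (M + m y) / 2 <= K).
  { unfold K. generalize (Rle_abs c). lra. }
  assert ((M - m y) * (c - (M + m y) / 2) <= (M - m y) * K) by (apply Rmult_le_compat_l; lra).
  assert ((M - m y) * K <= eps / 2 / K * K) by (apply Rmult_le_compat_r; lra).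
  replace (eps / 2 / K * K) with (eps / 2) in * by (field; lra). lra.
Qed.

(* If the mass were at most 2 C - 2, the density could not decay at z = 2. *)
Lemma end_mass_gt C w a u m :
  0 < C < 4 -> 0 <= w -> regular_sol C w a u m -> 2 * C - 2 < end_value m.
Proof.
  intros HC Hw H. apply Rnot_le_lt. intros HM.
  destruct (end_mass_spec C w a u m HC Hw H) as (H1 & _ & _).
  (* If m <= 2 C - 2, the logarithmic derivative of the density is at least -K, so the factor e^(K
     z) makes it nondecreasing: the bracket is at least (2 - t) (2 + C (t - 1) + w t). *)
  set (K := C + 2 * w).
  assert (G : forall z, 1 <= z < 2 -> density u 1 * exp K <= density u z * exp (K * z)).
  { intros z Hz.
    replace (density u 1 * exp K) with (density u 1 * exp (K * 1)) by (now rewrite Rmult_1_r).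
    apply (le_of_derive_nonneg (fun z => density u z * exp (K * z))
      (fun z => exp (u z) * (2 - 2 * z + C * z - w * (z * (2 - z)) - m z) * exp (K * z)
                + density u z * (K * exp (K * z)))); [lra| | |].
    - intros t Ht. apply (is_derive_mult (density u) (fun z => exp (K * z))).
      + apply (is_derive_density C w a); [exact H|lra].
      + auto_derive; [trivial|ring].
      + intros; apply Rmult_comm.
    - intros t Ht. assert (continuous (density u) t).
      { apply (continuous_density C w a u m); [exact H|lra]. }
      cont.
    - intros t Ht. assert (m t <= 2 * C - 2) by (specialize (H1 t ltac:(lra)); lra).
      unfold density.
      replace (exp (u t) * (2 - 2 * t + C * t - w * (t * (2 - t)) - m t) * exp (K * t) +
        t * (2 - t) * exp (u t) * (K * exp (K * t))) with
        (exp (u t) * exp (K * t) * (2 - 2 * t + C * t - w * (t * (2 - t)) - m t + t * (2 - t) * K))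
        by ring.
      apply Rmult_le_pos; [left; apply Rmult_lt_0_compat; apply exp_pos|].
      assert (0 <= (2 - t) * (2 - C - w * t + t * K)).
      { apply Rmult_le_pos; [lra|]. unfold K. nra. }
      nra. }
  assert (D1 : 0 < density u 1).
  { unfold density. apply Rmult_lt_0_compat; [lra|apply exp_pos]. }
  destruct (density_vanishes C w a u m (density u 1 * exp K * exp (- (2 * K))) HC Hw H)
    as (x & Hx & Hd).
  { apply Rmult_lt_0_compat; [apply Rmult_lt_0_compat; [exact D1|apply exp_pos]|apply exp_pos]. }
  set (y := (Rmax x 1 + 2) / 2).
  assert (Hy1 := Rmax_l x 1). assert (Hy2 := Rmax_r x 1).
  assert (Hy3 : Rmax x 1 < 2) by (apply Rmax_lub_lt; lra).
  specialize (Hd y ltac:(unfold y; lra)). specialize (G y ltac:(unfold y; lra)).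
  assert (K0 : 0 <= K) by (unfold K; lra).
  assert (exp (K * y) <= exp (2 * K)) by (apply exp_le_compat; unfold y; nra).
  assert (E : exp (- (2 * K)) * exp (2 * K) = 1) by (rewrite <- exp_plus, Rplus_opp_l; apply exp_0).
  assert (density u y * exp (K * y) <= density u y * exp (2 * K)).
  { apply Rmult_le_compat_l; [apply density_nonneg; unfold y; lra|assumption]. }
  assert (density u y * exp (2 * K) < density u 1 * exp K * exp (- (2 * K)) * exp (2 * K)).
  { apply Rmult_lt_compat_r; [apply exp_pos|exact Hd]. }
  rewrite (Rmult_assoc (density u 1 * exp K)), E in H3. lra.
Qed.

(** Past x the bracket in the derivative of the density is at most -eta, so density + eta m
    decreases, and its limit at z = 2 is at least eta times the total mass. The constant depends on
    the margin eta only, which makes the estimate uniform in the start. *)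
Lemma tail_mass C w a u m eta x :
  0 < C < 4 -> 0 <= w -> regular_sol C w a u m -> 0 < eta -> 0 < x < 2 ->
  2 * C - 2 + 2 * eta <= m x -> 2 * (2 - x) <= eta ->
  forall y, x <= y < 2 -> eta * (end_value m - m y) <= density u y.
Proof.
  intros HC Hw H He Hx Hmx Hx2 y Hy.
  destruct (end_mass_spec C w a u m HC Hw H) as (_ & H2 & _).
  assert (D : forall z, y <= z < 2 -> density u z + eta * m z <= density u y + eta * m y).
  { intros z Hz. apply (ge_of_derive_nonpos (fun z => density u z + eta * m z)
      (fun z => exp (u z) * (2 - 2 * z + C * z - w * (z * (2 - z)) - m z) + eta * exp (u z)));
      [lra| | |].
    - intros t Ht. apply (is_derive_plus (density u)).
      + apply (is_derive_density C w a); [exact H|lra].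
      + apply (is_derive_scal m). apply H. lra.
    - intros t Ht. assert (continuous (density u) t).
      { apply (continuous_density C w a u m); [exact H|lra]. }
      assert (continuous m t) by (apply (regular_sol_mass_continuous C w a u m); [exact H|lra]).
      cont.
    - intros t Ht. assert (m x <= m t) by (apply (regular_sol_mass_incr C w a u m H); lra).
      assert (0 < exp (u t)) by apply exp_pos.
      assert (2 - 2 * t + C * t - w * (t * (2 - t)) - m t + eta <= 0).
      { assert (0 <= w * (t * (2 - t))) by (apply Rmult_le_pos; [lra|nra]).
        assert ((2 - t) * (2 - C) <= (2 - t) * 2) by (apply Rmult_le_compat_l; lra).
        lra. }
      nra. }
  apply le_epsilon. intros eps Heps.
  destruct (H2 (eps / eta)) as (x1 & Hx1 & Hm); [now apply Rdiv_lt_0_compat|].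
  set (z := Rmax y x1).
  assert (Hy1 : y <= z) by apply Rmax_l. assert (Hy2 : x1 <= z) by apply Rmax_r.
  assert (Hy3 : z < 2) by (apply Rmax_lub_lt; lra).
  specialize (D z ltac:(lra)). specialize (Hm z ltac:(lra)).
  assert (density u z >= 0) by (apply Rle_ge, density_nonneg; lra).
  assert (eta * (end_value m - eps / eta) < eta * m z) by (apply Rmult_lt_compat_l; lra).
  replace (eta * (end_value m - eps / eta)) with (eta * end_value m - eps) in * by (field; lra).
  lra.
Qed.

Lemma regular_sol_upper C w a u m z :
  0 <= w -> regular_sol C w a u m -> 0 <= z < 2 -> u z <= a - C * ln ((2 - z) / 2).
Proof.
  intros Hw H Hz. assert (Hm := regular_sol_mass_nonneg C w a u m H).
  destruct H as (u0 & _ & Cu & _ & Du).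
  now apply (sol_upper_bound C w a u m).
Qed.

(** * Total mass for low and for high starts *)

Lemma mass_small_of_low_start C w d eps :
  0 < C -> 0 <= w -> 0 < d < 2 -> 0 < eps ->
  exists a0, forall a u m, a <= a0 -> regular_sol C w a u m -> m (2 - d) <= eps.
Proof.
  intros HC Hw Hd He. exists (ln (eps / 2) + C * ln (d / 2)). intros a u m Ha H.
  apply Rle_trans with (exp (ln (eps / 2)) * (2 - d)).
  - apply (mass_le_of_sol_le C w a u m); [exact H|lra|]. intros z Hz.
    eapply Rle_trans; [apply (regular_sol_upper C w a u m); [exact Hw|exact H|lra]|].
    assert (ln (d / 2) <= ln ((2 - z) / 2)) by (apply ln_le; lra). nra.
  - rewrite exp_ln by lra. nra.
Qed.

(** Almost all mass lies in the last stretch, where the Pohozaev rate is below c < C. Hence M^2 / 2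
    - c M is almost nonpositive, which keeps M below 2 C. *)
Lemma end_mass_low_start_sub C w :
  0 < C < 2 -> 0 <= w ->
  exists a0, forall a u m, a <= a0 -> regular_sol C w a u m -> end_value m < 2 * C.
Proof.
  intros HC Hw.
  (* M >= 2 C would give M^2 / 2 - c M >= C (2 - C), while this quantity is at most 11 times the
     mass on [0, 3/2]; hence the divisor 12. *)
  destruct (mass_small_of_low_start C w (1 / 2) (C * (2 - C) / 12)) as (a0 & Ha0); try lra.
  { assert (0 < C * (2 - C)) by (apply Rmult_lt_0_compat; lra). lra. }
  exists a0. intros a u m Ha H. specialize (Ha0 a u m Ha H).
  replace (2 - 1 / 2) with (3 / 2) in Ha0 by field.
  assert (P1 := pohozaev_le C w a u m 10 0 (3/2) H ltac:(lra) ltac:(lra) ltac:(lra)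
    ltac:(intros; apply pohozaev_rate_le; lra)).
  rewrite density_0, (proj1 (proj2 H)) in P1.
  (* The value at t = 3/2 of 2 - 2 t + C t, which decreases in t as C < 2. *)
  set (c := 3 / 2 * C - 1).
  assert (P2 := pohozaev_le_end C w a u m c (3/2) ltac:(lra) Hw H ltac:(lra)).
  set (M := end_value m) in *. set (mx := m (3/2)) in *.
  assert (P3 : M * M / 2 - c * M <= density u (3/2) + (mx * mx / 2 - c * mx)).
  { apply P2. intros t Ht. unfold c.
    assert (0 <= w * (t * (2 - t))) by (apply Rmult_le_pos; nra). nra. }
  assert (0 <= mx) by (apply (regular_sol_mass_nonneg C w a u m H); lra).
  apply Rnot_le_lt. intros HM.
  assert (c * mx >= -1 * mx) by (unfold c; nra).
  assert (M * M / 2 - c * M <= 11 * mx) by lra.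
  assert (M * (2 - C) / 2 <= M * M / 2 - c * M) by (unfold c; nra).
  nra.
Qed.

(** Near z = 2 the rate now exceeds c > C, so M^2 / 2 - c M is almost nonnegative: M is either
    almost 0 or larger than 2 C. The lower bound [end_mass_gt] excludes the first case. *)
Lemma end_mass_low_start_super C w :
  2 < C < 4 -> 0 <= w ->
  exists a0, forall a u m, a <= a0 -> regular_sol C w a u m -> 2 * C < end_value m.
Proof.
  (* On the last stretch of length d the rate falls short of its end value 2 C - 2 by at most d (C -
     2 + 2 w), that is (C - 2) / 2, and so stays above c. *)
  intros HC Hw. set (d := (C - 2) / (2 * (C - 2 + 2 * w))).
  assert (Hd : d * (C - 2 + 2 * w) = (C - 2) / 2) by (unfold d; field; lra).
  assert (Hd0 : 0 < d) by (apply Rdiv_lt_0_compat; lra).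
  assert (Hd1 : d <= 1 / 2) by nra.
  destruct (mass_small_of_low_start C w d ((C - 2) / 6)) as (a0 & Ha0); try lra.
  exists a0. intros a u m Ha H. specialize (Ha0 a u m Ha H).
  set (c := C + (C - 2) / 2).
  assert (P2 := pohozaev_ge_end C w a u m c (2 - d) ltac:(lra) Hw H ltac:(lra)).
  assert (HM := end_mass_gt C w a u m ltac:(lra) Hw H).
  assert (Hden := density_nonneg u (2 - d) ltac:(lra)).
  set (M := end_value m) in *. set (mx := m (2 - d)) in *.
  assert (P3 : density u (2 - d) + (mx * mx / 2 - c * mx) <= M * M / 2 - c * M).
  { apply P2. intros t Ht. unfold c.
    assert (t * (2 - t) <= 2 * d) by nra.
    assert (w * (t * (2 - t)) <= w * (2 * d)) by (apply Rmult_le_compat_l; lra).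
    assert ((C - 2) * (2 - t) <= (C - 2) * d) by (apply Rmult_le_compat_l; lra).
    nra. }
  assert (0 <= mx) by (apply (regular_sol_mass_nonneg C w a u m H); lra).
  apply Rnot_le_lt. intros HM2.
  assert (c * mx <= 5 * mx) by (unfold c; nra).
  assert (M * M / 2 - c * M <= - (M * (C - 2) / 2)) by (unfold c; nra).
  nra.
Qed.

(* Just after z = 0 the mass follows the bubble m_s = m (4 - m) / 2 in the
   variable s with ds = dz / (z (2 - z)), which has a long time to reach 4
   when the start is high. *)
Lemma mass_of_high_start C w eta :
  0 < C < 4 -> 0 <= w -> 0 < eta < 1 ->
  exists a0, forall a u m, a0 <= a -> regular_sol C w a u m ->
    4 - 3 * eta <= m (eta / (2 + 2 * w)).
Proof.
  (* Up to this d the Pohozaev rate differs from its value 2 at the pole by at most eta. *)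
  intros HC Hw He. set (d := eta / (2 + 2 * w)).
  assert (Hd : d * (2 + 2 * w) = eta) by (unfold d; field; lra).
  assert (Hd0 : 0 < d) by (apply Rdiv_lt_0_compat; lra).
  assert (Hd1 : d < 1) by nra.
  (* A bound for the drop of u below a on [0, e^(-a)] that does not depend on a. *)
  set (k := w + exp C).
  exists (Rmax (- ln d) (4 / eta * (ln 4 + k) - ln d)). intros a u m Ha H.
  assert (Ha1 := Rle_trans _ _ _ (Rmax_l _ _) Ha).
  assert (Ha2 := Rle_trans _ _ _ (Rmax_r _ _) Ha). clear Ha.
  apply Rnot_lt_le. intros Hlow.
  (* The width of the bubble: at z1 the mass is already at least e^(-k), independently of a. *)
  set (z1 := exp (- a)).
  assert (Hz1 : 0 < z1 <= d).
  { split; [apply exp_pos|]. unfold z1. rewrite <- (exp_ln d) by exact Hd0.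
    apply exp_le_compat. lra. }
  assert (Hup : forall z, 0 <= z <= 1 -> u z <= a + C).
  { intros z Hz. eapply Rle_trans; [apply (regular_sol_upper C w a u m); [exact Hw|exact H|lra]|].
    assert (-1 <= ln ((2 - z) / 2)); [|nra].
    rewrite <- (ln_exp (-1)). apply ln_le; [apply exp_pos|].
    assert (E : exp (-1) * exp 1 = 1).
    { rewrite <- exp_plus. replace (-1 + 1) with 0 by ring. apply exp_0. }
    assert (He1 := exp_ineq1_le 1). assert (He2 := exp_pos (-1)). nra. }
  assert (Hmz : forall z, 0 <= z <= 1 -> m z <= exp (a + C) * z).
  { intros z Hz. apply (mass_le_of_sol_le C w a u m); [exact H|lra|].
    intros t Ht. apply Hup. lra. }
  assert (Cm := regular_sol_mass_continuous C w a u m H).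
  assert (Hincr := regular_sol_mass_incr C w a u m H).
  assert (P := fun z => pohozaev_ge C w a u m (2 - eta) 0 z H).
  destruct H as (u0 & m0 & Cu & Dm & Du).
  rewrite density_0, m0 in P.
  assert (Hea : exp (a + C) * z1 = exp C).
  { unfold z1. rewrite <- exp_plus. f_equal. ring. }
  assert (Hlo : forall z, 0 <= z <= z1 -> a - k <= u z).
  { intros z Hz.
    assert (u 0 + (w + exp (a + C)) * 0 <= u z + (w + exp (a + C)) * z).
    { apply (le_of_derive_nonneg (fun z => u z + (w + exp (a + C)) * z)
        (fun z => (C * z - w * (z * (2 - z)) - m z) / (z * (2 - z)) + (w + exp (a + C)) * 1)); [lra| | |].
      - intros t Ht. apply (is_derive_plus u); [apply Du; lra|].
        apply (is_derive_scal (fun x => x)), (is_derive_id t).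
      - intros t Ht. apply continuous_Rplus; [apply Cu; lra|cont].
      - intros t Ht. assert (Hq : 0 < t * (2 - t)) by nra.
        replace ((C * t - w * (t * (2 - t)) - m t) / (t * (2 - t)) + (w + exp (a + C)) * 1) with
          ((C * t + (exp (a + C) * t * (2 - t) - m t)) / (t * (2 - t))) by (field; lra).
        apply Rdiv_le_0_compat; [|exact Hq]. specialize (Hmz t ltac:(lra)).
        assert (exp (a + C) * t * 1 <= exp (a + C) * t * (2 - t)).
        { apply Rmult_le_compat_l; [|lra]. apply Rmult_le_pos; [left; apply exp_pos|lra]. }
        nra. }
    rewrite u0 in H.
    assert ((w + exp (a + C)) * z <= (w + exp (a + C)) * z1).
    { apply Rmult_le_compat_l; [|lra]. generalize (exp_pos (a + C)). lra. }
    assert (w * z1 <= w * 1) by (apply Rmult_le_compat_l; lra). unfold k. nra. }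
  assert (Hm1 : exp (- k) <= m z1).
  { assert (m 0 - exp (a - k) * 0 <= m z1 - exp (a - k) * z1).
    { apply (le_of_derive_nonneg (fun z => m z - exp (a - k) * z)
        (fun z => exp (u z) - exp (a - k) * 1)); [lra| | |].
      - intros t Ht. apply (is_derive_minus m); [apply Dm; lra|].
        apply (is_derive_scal (fun x => x)), (is_derive_id t).
      - intros t Ht. apply continuous_Rminus; [apply Cm; lra|cont].
      - intros t Ht. generalize (exp_le_compat _ _ (Hlo t ltac:(lra))). lra. }
    replace (exp (- k)) with (exp (a - k) * z1); [lra|].
    unfold z1. rewrite <- exp_plus. f_equal. ring. }
  (* While m < 4 - 3 eta, Pohozaev gives density >= m (2 - eta - m / 2) >= eta m / 2, so ln m grows
     at least like (eta / 4) ln z. From z1 to d this is eta (a + ln d) / 4, too much for a high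
     start since ln m stays between -k and ln 4. *)
  assert (Hgrow : ln (m z1) - eta / 4 * ln z1 <= ln (m d) - eta / 4 * ln d).
  { assert (Hmt : forall t, z1 <= t <= d -> 0 < m t < 4 - 3 * eta).
    { intros t Ht. split.
      - apply Rlt_le_trans with (m z1); [|apply Hincr; lra].
        apply Rlt_le_trans with (exp (- k)); [apply exp_pos|exact Hm1].
      - apply Rle_lt_trans with (m d); [apply Hincr; lra|exact Hlow]. }
    apply (le_of_derive_nonneg (fun z => ln (m z) - eta / 4 * ln z)
      (fun z => exp (u z) * / m z - eta / 4 * / z)); [lra| | |].
    - intros t Ht. apply (is_derive_minus (fun z => ln (m z)) (fun z => eta / 4 * ln z)).
      + apply (is_derive_comp ln m); [apply is_derive_ln; apply Hmt; lra|apply Dm; lra].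
      + apply (is_derive_scal ln), is_derive_ln. lra.
    - intros t Ht. apply continuous_Rminus.
      + apply (continuous_comp m ln); [apply Cm; lra|].
        eapply continuous_of_derive. apply is_derive_ln. apply Hmt. lra.
      + apply continuous_Rmult; [cont|]. eapply continuous_of_derive. apply is_derive_ln. lra.
    - intros t Ht. specialize (Hmt t ltac:(lra)).
      assert (Pt : 0 + (0 * 0 / 2 - (2 - eta) * 0) <= density u t + (m t * m t / 2 - (2 - eta) * m t)).
      { apply P; try lra. intros x Hx.
        assert (w * (x * (2 - x)) <= w * (2 * x)) by (apply Rmult_le_compat_l; nra). nra. }
      assert (Hden : eta / 2 * m t <= density u t) by nra.
      unfold density in Hden. assert (Hex := exp_pos (u t)).
      assert (Hden2 : t * (2 - t) * exp (u t) <= 2 * t * exp (u t)).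
      { apply Rmult_le_compat_r; [lra|nra]. }
      replace (exp (u t) * / m t - eta / 4 * / t) with
        ((t * exp (u t) - eta / 4 * m t) / (m t * t)) by (field; lra).
      apply Rdiv_le_0_compat; [lra|]. apply Rmult_lt_0_compat; lra. }
  assert (Hmd : 0 < m d).
  { apply Rlt_le_trans with (m z1); [|apply Hincr; lra].
    apply Rlt_le_trans with (exp (- k)); [apply exp_pos|exact Hm1]. }
  assert (H4 : ln (m d) < ln 4) by (apply ln_increasing; lra).
  assert (Hk : - k <= ln (m z1)).
  { rewrite <- (ln_exp (- k)). apply ln_le; [apply exp_pos|exact Hm1]. }
  unfold z1 in Hgrow at 2. rewrite ln_exp in Hgrow.
  assert (ln 4 + k <= eta / 4 * (a + ln d)).
  { replace (ln 4 + k) with (eta / 4 * (4 / eta * (ln 4 + k))) by (field; lra).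
    apply Rmult_le_compat_l; lra. }
  lra.
Qed.

Lemma end_mass_high_start_sub C w :
  0 < C < 2 -> 0 <= w ->
  exists a0, forall a u m, a0 <= a -> regular_sol C w a u m -> 2 * C < end_value m.
Proof.
  (* Here 4 - 4 eta = 2 C, so a bubble of mass at least 4 - 3 eta already exceeds 2 C. *)
  intros HC Hw. set (eta := (4 - 2 * C) / 4).
  destruct (mass_of_high_start C w eta) as (a0 & H0); [lra|lra|unfold eta; lra|].
  exists a0. intros a u m Ha H. specialize (H0 a u m Ha H).
  set (d := eta / (2 + 2 * w)) in *.
  assert (Hd : d * (2 + 2 * w) = eta) by (unfold d; field; lra).
  assert (Hd0 : 0 < d) by (apply Rdiv_lt_0_compat; unfold eta; lra).
  assert (Hd1 : d < 1) by (unfold eta in Hd; nra).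
  destruct (end_mass_spec C w a u m ltac:(lra) Hw H) as (H1 & _ & _).
  specialize (H1 d ltac:(lra)). unfold eta in *. lra.
Qed.

(** A bubble of mass about 4 has formed at rate about 2, and the rate stays below 2 C - 2
    afterwards, so M^2 / 2 - (2 C - 2) M is at most about -8 (C - 2). If M >= 2 C it would be at
    least -2 C (C - 2), which is larger since C < 4. *)
Lemma end_mass_high_start_super C w :
  2 < C < 4 -> 0 <= w ->
  exists a0, forall a u m, a0 <= a -> regular_sol C w a u m -> end_value m < 2 * C.
Proof.
  (* The gap between the two limiting values is 2 (C - 2) (4 - C) = 32 eta, and the error terms
     amount to eta (6 C - 8 - 3 eta), less than 16 eta. *)
  intros HC Hw. set (eta := (C - 2) * (4 - C) / 16).
  assert (He : 0 < eta < 1).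
  { unfold eta. assert (0 < (C - 2) * (4 - C)) by (apply Rmult_lt_0_compat; lra). nra. }
  destruct (mass_of_high_start C w eta) as (a0 & H0); [lra|lra|exact He|].
  exists a0. intros a u m Ha H. specialize (H0 a u m Ha H).
  set (d := eta / (2 + 2 * w)) in *.
  assert (Hd : d * (2 + 2 * w) = eta) by (unfold d; field; lra).
  assert (Hd0 : 0 < d) by (apply Rdiv_lt_0_compat; lra).
  assert (Hd1 : d < 1) by nra.
  assert (P1 : density u d + (m d * m d / 2 - (2 + eta) * m d) <=
               density u 0 + (m 0 * m 0 / 2 - (2 + eta) * m 0)).
  { apply (pohozaev_le C w a u m (2 + eta) 0 d H); try lra. intros t Ht.
    assert (0 <= w * (t * (2 - t))) by (apply Rmult_le_pos; nra). nra. }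
  rewrite density_0, (proj1 (proj2 H)) in P1.
  assert (P2 := pohozaev_le_end C w a u m (2 * C - 2) d ltac:(lra) Hw H ltac:(lra)).
  set (M := end_value m) in *.
  assert (P3 : M * M / 2 - (2 * C - 2) * M <= density u d + (m d * m d / 2 - (2 * C - 2) * m d)).
  { apply P2. intros t Ht.
    assert (0 <= w * (t * (2 - t))) by (apply Rmult_le_pos; nra). nra. }
  apply Rnot_le_lt. intros HM.
  assert (Hc : 4 - 2 * C + eta < 0) by (unfold eta; nra).
  assert (P4 : M * M / 2 - (2 * C - 2) * M <= (4 - 2 * C + eta) * (4 - 3 * eta)) by nra.
  assert (P5 : 4 * C - 2 * C * C <= M * M / 2 - (2 * C - 2) * M) by nra.
  assert (E : 16 * eta = (C - 2) * (4 - C)) by (unfold eta; field).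
  nra.
Qed.

(** One cut-off function, lying above the logarithmic upper bound of every start up to [A], serves
    the whole family: it never acts, yet continuous dependence on a follows from the Lipschitz
    theory of a single nonlinearity. *)
Lemma regular_sol_of_family C w A a :
  0 < C -> 0 <= w -> a <= A ->
  regular_sol C w a (sol (-1) C w (fun t => A + 1 - C * ln ((2 - t) / 2)) a)
                    (mass (-1) C w (fun t => A + 1 - C * ln ((2 - t) / 2)) a).
Proof.
  intros HC Hw Ha. set (B := fun t => A + 1 - C * ln ((2 - t) / 2)).
  assert (HB : forall t, -2 < t < 2 -> continuous B t).
  { intros t Ht. apply (ex_derive_continuous B). unfold B. auto_derive. lra. }
  assert (Cu : forall z, 0 <= z < 2 -> continuous (sol (-1) C w B a) z).
  { intros z Hz. apply continuous_sol; [exact HB|lra]. }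
  assert (Du : forall z, 0 < z < 2 -> is_derive (sol (-1) C w B a) z
    ((C * z - w * (z * (2 - z)) - mass (-1) C w B a z) / (z * (2 - z)))).
  { intros z Hz.
    replace (C * z - w * (z * (2 - z)) - mass (-1) C w B a z) with
      (C * z - w * (z * (2 - z)) + -1 * mass (-1) C w B a z) by ring.
    now apply is_derive_sol. }
  assert (Hle : forall z, 0 <= z < 2 -> sol (-1) C w B a z <= B z).
  { intros z Hz.
    apply Rle_trans with (a - C * ln ((2 - z) / 2)); [|unfold B; lra].
    apply (sol_upper_bound C w a _ (mass (-1) C w B a)); auto.
    - now apply sol_0.
    - intros x Hx. rewrite <- (mass_0 (-1) C w B a). apply mass_incr; auto; lra. }
  split; [now apply sol_0|]. split; [apply mass_0|]. split; [exact Cu|]. split; [|exact Du].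
  intros z Hz. rewrite <- (Rmin_left _ _ (Hle z Hz)). apply is_derive_mass; [exact HB|lra].
Qed.

Lemma end_mass_continuous C w A a :
  0 < C < 4 -> 0 <= w -> a < A ->
  continuous (fun a => end_value (mass (-1) C w (fun t => A + 1 - C * ln ((2 - t) / 2)) a)) a.
Proof.
  intros HC Hw Ha. set (B := fun t => A + 1 - C * ln ((2 - t) / 2)).
  assert (HB : forall t, -2 < t < 2 -> continuous B t).
  { intros t Ht. apply (ex_derive_continuous B). unfold B. auto_derive. lra. }
  set (u := sol (-1) C w B). set (m := mass (-1) C w B).
  assert (HR : forall b, b <= A -> regular_sol C w b (u b) (m b)).
  { intros b Hb. now apply regular_sol_of_family. }
  set (M := fun b => end_value (m b)). change (continuous M a).
  assert (HM : 2 * C - 2 < M a) by now apply (end_mass_gt C w a (u a) (m a)); [| |apply HR; lra].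
  (* The excess of the total mass is 4 eta: cutting at x costs less than eta, passing to a nearby
     start less than another, and the margin 2 eta required by [tail_mass] remains. *)
  set (eta := (M a - (2 * C - 2)) / 4). assert (He : 0 < eta) by (unfold eta; lra).
  apply filterlim_locally. intros eps. assert (Heps := cond_pos eps).
  assert (Hee : 0 < eps * eta / 8).
  { apply Rdiv_lt_0_compat; [apply Rmult_lt_0_compat; lra|lra]. }
  destruct (end_mass_spec C w a (u a) (m a) HC Hw (HR a ltac:(lra))) as (_ & H2 & _).
  destruct (H2 eta He) as (x1 & Hx1 & Hm1).
  destruct (density_vanishes C w a (u a) (m a) (eps * eta / 8) HC Hw (HR a ltac:(lra)) Hee)
    as (x2 & Hx2 & Hd2).
  set (x := Rmax (Rmax x1 x2) (Rmax 1 (2 - eta / 2))).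
  assert (Hxa : x1 <= x) by (eapply Rle_trans; [apply Rmax_l|apply Rmax_l]).
  assert (Hxb : x2 <= x) by (eapply Rle_trans; [apply Rmax_r|apply Rmax_l]).
  assert (Hxc : 1 <= x) by (eapply Rle_trans; [apply Rmax_l|apply Rmax_r]).
  assert (Hxd : 2 - eta / 2 <= x) by (eapply Rle_trans; [apply Rmax_r|apply Rmax_r]).
  assert (Hxe : x < 2) by (repeat apply Rmax_lub_lt; lra).
  specialize (Hm1 x ltac:(lra)). specialize (Hd2 x ltac:(lra)). fold (M a) in Hm1.
  destruct (mass_dependence (-1) C w B x HB ltac:(lra)) as (L1 & HL10 & HL1).
  destruct (sol_dependence (-1) C w B x HB ltac:(lra)) as (L2 & HL20 & HL2).
  assert (Cma : continuous (fun b => m b x) a).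
  { apply (continuous_of_linear_bound _ a L1 1); [lra|]. intros b _. apply HL1. }
  assert (Cua : continuous (fun b => u b x) a).
  { apply (continuous_of_linear_bound _ a L2 1); [lra|]. intros b _. apply HL2. lra. }
  assert (Cda : continuous (fun b => density (u b) x) a).
  { unfold density. apply continuous_Rmult; [cont|]. now apply continuous_exp_comp. }
  destruct (continuous_eps _ a (Rmin eta (eps / 4)) Cma) as (d1 & Hd1 & Hmb);
    [apply Rmin_pos; lra|].
  destruct (continuous_eps _ a _ Cda Hee) as (d2 & Hd2' & Hdb).
  assert (Hd : 0 < Rmin (Rmin d1 d2) (A - a)) by (repeat apply Rmin_pos; lra).
  exists (mkposreal _ Hd). intros b Hb.
  change (Rabs (b - a) < Rmin (Rmin d1 d2) (A - a)) in Hb.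
  change (Rabs (M b - M a) < eps).
  assert (Hb1 : Rabs (b - a) < d1).
  { eapply Rlt_le_trans; [exact Hb|]. eapply Rle_trans; [apply Rmin_l|apply Rmin_l]. }
  assert (Hb2 : Rabs (b - a) < d2).
  { eapply Rlt_le_trans; [exact Hb|]. eapply Rle_trans; [apply Rmin_l|apply Rmin_r]. }
  assert (Hb3 : Rabs (b - a) < A - a).
  { eapply Rlt_le_trans; [exact Hb|]. apply Rmin_r. }
  apply Rabs_def2 in Hb1, Hb2, Hb3.
  specialize (Hmb b ltac:(lra)). specialize (Hdb b ltac:(lra)). cbv beta in Hmb, Hdb.
  assert (Hmb1 := Rlt_le_trans _ _ _ Hmb (Rmin_l _ _)).
  assert (Hmb2 := Rlt_le_trans _ _ _ Hmb (Rmin_r _ _)).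
  apply Rabs_def2 in Hmb1, Hmb2, Hdb.
  assert (Ta := tail_mass C w a (u a) (m a) eta x HC Hw (HR a ltac:(lra)) He ltac:(lra)
    ltac:(unfold eta in *; lra) ltac:(lra) x ltac:(lra)).
  assert (Tb := tail_mass C w b (u b) (m b) eta x HC Hw (HR b ltac:(lra)) He ltac:(lra)
    ltac:(unfold eta in *; lra) ltac:(lra) x ltac:(lra)).
  fold (M a) in Ta. fold (M b) in Tb.
  assert (Ga : 0 <= M a - m a x).
  { destruct (end_mass_spec C w a (u a) (m a) HC Hw (HR a ltac:(lra))) as (H & _).
    specialize (H x ltac:(lra)). unfold M. lra. }
  assert (Gb : 0 <= M b - m b x).
  { destruct (end_mass_spec C w b (u b) (m b) HC Hw (HR b ltac:(lra))) as (H & _).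
    specialize (H x ltac:(lra)). unfold M. lra. }
  assert (Fa : M a - m a x < eps / 8).
  { apply (Rmult_lt_reg_l eta); [exact He|]. lra. }
  assert (Fb : M b - m b x < eps / 4).
  { apply (Rmult_lt_reg_l eta); [exact He|]. lra. }
  apply Rabs_def1; lra.
Qed.

(* At the critical mass the momentum p vanishes at z = 2; the point is to bound
   u from above there, starting from the power decay of the remaining mass. *)
Lemma regular_sol_critical C w a u m :
  0 < C < 4 -> 0 <= w -> regular_sol C w a u m -> end_value m = 2 * C ->
  axial_bvp (-1) C w.
Proof.
  intros HC Hw H HM. destruct (end_mass_spec C w a u m HC Hw H) as (H1 & H2 & _).
  destruct (H2 1 Rlt_0_1) as (x1 & Hx1 & Hm1).
  rewrite HM in H1, Hm1.
  (* These are the requirements of [tail_mass] for eta = 1/2: mass at least 2 C - 1 at x, and 2 (2 -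
     x) <= 1/2. *)
  set (x := Rmax x1 (7 / 4)).
  assert (Hxa : x1 <= x) by apply Rmax_l. assert (Hxb : 7 / 4 <= x) by apply Rmax_r.
  assert (Hxe : x < 2) by (apply Rmax_lub_lt; lra).
  specialize (Hm1 x ltac:(lra)).
  assert (T := tail_mass C w a u m (1 / 2) x HC Hw H ltac:(lra) ltac:(lra) ltac:(lra) ltac:(lra)).
  rewrite HM in T.
  assert (Hm0 := regular_sol_mass_nonneg C w a u m H).
  assert (Hmass := mass_le_of_sol_le C w a u m).
  assert (Cm := regular_sol_mass_continuous C w a u m H).
  destruct (H) as (u0 & m0 & Cu & Dm & Du).
  (* This is (2 - z)^(1/4). The tail T = 2 C - m satisfies T / 2 <= density <= 2 (2 - z) m', that is
     T' <= -T / (4 (2 - z)), so T / r is nonincreasing. *)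
  set (r := fun z => exp (/ 4 * ln (2 - z))).
  assert (Dr : forall z, z < 2 -> is_derive r z (- (/ 4 * (r z / (2 - z))))).
  { intros z Hz. unfold r. auto_derive; [lra|].
    change (2 + - z) with (2 - z). field. lra. }
  assert (rpos : forall z, 0 < r z) by (intros; apply exp_pos).
  set (K := (2 * C - m x) / r x).
  assert (HK : forall z, x <= z < 2 -> 2 * C - m z <= K * r z).
  { intros z Hz.
    assert ((2 * C - m z) / r z <= (2 * C - m x) / r x).
    { apply (ge_of_derive_nonpos (fun z => (2 * C - m z) / r z)
        (fun z => ((0 - exp (u z)) * r z - (2 * C - m z) * - (/ 4 * (r z / (2 - z)))) / (r z) ^ 2));
        [lra| | |].
      - intros t Ht. apply (is_derive_div (fun z => 2 * C - m z) r).
        + apply (is_derive_minus (fun _ => 2 * C) m); [apply (is_derive_const (2 * C))|apply Dm; lra].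
        + apply Dr. lra.
        + apply Rgt_not_eq, rpos.
      - intros t Ht. apply continuous_Rdiv.
        + apply continuous_Rminus; [cont|apply Cm; lra].
        + eapply continuous_of_derive. apply Dr. lra.
        + apply Rgt_not_eq, rpos.
      - intros t Ht. specialize (T t ltac:(lra)). unfold density in T.
        assert (Hr := rpos t). assert (Hex := exp_pos (u t)).
        replace (((0 - exp (u t)) * r t - (2 * C - m t) * - (/ 4 * (r t / (2 - t)))) / r t ^ 2) with
          (- ((4 * (2 - t) * exp (u t) - (2 * C - m t)) / (4 * (2 - t) * r t))) by (field; lra).
        assert (0 <= (4 * (2 - t) * exp (u t) - (2 * C - m t)) / (4 * (2 - t) * r t)); [|lra].
        apply Rdiv_le_0_compat.
        + assert (0 < (2 - t) * exp (u t)) by (apply Rmult_lt_0_compat; lra). nra.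
        + apply Rmult_lt_0_compat; [lra|exact Hr]. }
    fold K in H0. apply (Rmult_le_reg_r (/ r z)); [apply Rinv_0_lt_compat, rpos|].
    rewrite Rmult_assoc, Rinv_r by (apply Rgt_not_eq, rpos). rewrite Rmult_1_r. exact H0. }
  assert (K0 : 0 <= K).
  { apply Rdiv_le_0_compat; [|apply rpos]. specialize (H1 x ltac:(lra)). lra. }
  (* Now u' <= K r / (2 - z), which is integrable with primitive -4 K r. Once u is bounded above,
     the tail of the mass is linear in 2 - z and so is the bound on p. *)
  assert (Hend : forall z, x <= z < 2 -> u z <= u x + 4 * K * r x).
  { intros z Hz.
    assert (u z + 4 * K * r z <= u x + 4 * K * r x).
    { apply (ge_of_derive_nonpos (fun z => u z + 4 * K * r z)
        (fun z => (C * z - w * (z * (2 - z)) - m z) / (z * (2 - z)) +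
                  4 * K * - (/ 4 * (r z / (2 - z))))); [lra| | |].
      - intros t Ht. apply (is_derive_plus u); [apply Du; lra|].
        apply (is_derive_scal r). apply Dr. lra.
      - intros t Ht. apply continuous_Rplus; [apply Cu; lra|].
        apply continuous_Rmult; [cont|]. eapply continuous_of_derive. apply Dr. lra.
      - intros t Ht. specialize (HK t ltac:(lra)).
        replace ((C * t - w * (t * (2 - t)) - m t) / (t * (2 - t)) +
          4 * K * - (/ 4 * (r t / (2 - t)))) with
          (- ((t * (K * r t) + w * (t * (2 - t)) - (C * t - m t)) / (t * (2 - t)))) by (field; lra).
        assert (0 <= (t * (K * r t) + w * (t * (2 - t)) - (C * t - m t)) / (t * (2 - t))); [|lra].
        apply Rdiv_le_0_compat; [|apply weight_pos; lra].
        assert (0 <= w * (t * (2 - t))) by (apply Rmult_le_pos; [lra|left; apply weight_pos; lra]).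
        assert (0 <= K * r t) by (apply Rmult_le_pos; [exact K0|left; apply rpos]).
        nra. }
    assert (0 <= 4 * K * r z) by (apply Rmult_le_pos; [lra|left; apply rpos]). lra. }
  destruct (continuous_bounded u 0 x) as (b1 & Hb10 & Hb1); [lra|intros; apply Cu; lra|].
  set (b := Rmax b1 (u x + 4 * K * r x)).
  assert (Hb : forall z, 0 <= z < 2 -> u z <= b).
  { intros z Hz. destruct (Rle_lt_dec z x).
    - eapply Rle_trans; [|apply Rmax_l]. generalize (Hb1 z ltac:(lra)) (Rle_abs (u z)). lra.
    - eapply Rle_trans; [|apply Rmax_r]. apply Hend. lra. }
  assert (Hmz : forall z, 0 <= z < 2 -> m z <= exp b * z).
  { intros z Hz. apply Hmass; [exact H|exact Hz|]. intros t Ht. apply Hb. lra. }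
  assert (Htail : forall z, 0 <= z < 2 -> 2 * C - m z <= exp b * (2 - z)).
  { intros z Hz. apply le_epsilon. intros eps He. destruct (H2 eps He) as (x2 & Hx2 & Hm2).
    rewrite HM in Hm2. set (y := Rmax z x2).
    assert (Hya : z <= y) by apply Rmax_l. assert (Hyb : x2 <= y) by apply Rmax_r.
    assert (Hye : y < 2) by (apply Rmax_lub_lt; lra). specialize (Hm2 y ltac:(lra)).
    assert (m y - exp b * y <= m z - exp b * z).
    { apply (ge_of_derive_nonpos (fun z => m z - exp b * z) (fun z => exp (u z) - exp b * 1));
        [lra| | |].
      - intros t Ht. apply (is_derive_minus m); [apply Dm; lra|].
        apply (is_derive_scal (fun x => x)), (is_derive_id t).
      - intros t Ht. apply continuous_Rminus; [apply Cm; lra|cont].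
      - intros t Ht. generalize (exp_le_compat _ _ (Hb t ltac:(lra))). lra. }
    assert (exp b * y <= exp b * 2) by (apply Rmult_le_compat_l; [left; apply exp_pos|lra]).
    lra. }
  set (c0 := C + 2 * w + exp b).
  assert (Hc0 : 0 <= c0) by (unfold c0; generalize (exp_pos b); lra).
  apply (axial_bvp_of_z (-1) C w c0 u (fun z => C * z - w * (z * (2 - z)) - m z)).
  intros z Hz. split; [now apply Du|split].
  - replace (-1 * exp (u z) + C + 2 * w * (z - 1)) with (C + 2 * w * (z - 1) - exp (u z)) by ring.
    apply (is_derive_minus (fun z => C * z - w * (z * (2 - z))) m).
    + auto_derive; [trivial|ring].
    + apply Dm. lra.
  - assert (Hq := weight_pos z Hz).
    assert (0 <= w * (z * (2 - z))) by (apply Rmult_le_pos; lra).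
    specialize (Hmz z ltac:(lra)). specialize (Htail z ltac:(lra)).
    specialize (Hm0 z ltac:(lra)). specialize (H1 z ltac:(lra)).
    assert (Heb := exp_pos b).
    destruct (Rle_lt_dec z 1).
    + apply Rle_trans with (c0 * z); [|apply Rmult_le_compat_l; [exact Hc0|nra]].
      assert (w * (z * (2 - z)) <= w * (2 * z)) by (apply Rmult_le_compat_l; nra).
      assert (0 <= C * z) by (apply Rmult_le_pos; lra).
      unfold c0. apply Rabs_le_between. split; nra.
    + apply Rle_trans with (c0 * (2 - z)); [|apply Rmult_le_compat_l; [exact Hc0|nra]].
      assert (w * (z * (2 - z)) <= w * (2 * (2 - z))) by (apply Rmult_le_compat_l; nra).
      assert (0 <= C * (2 - z)) by (apply Rmult_le_pos; lra).
      unfold c0. apply Rabs_le_between. split; nra.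
Qed.

Lemma axial_bvp_neg_nonneg C w :
  0 < C < 4 -> C <> 2 -> 0 <= w -> axial_bvp (-1) C w.
Proof.
  intros HC HC2 Hw.
  assert (Hends : exists a1 a2, a1 <= a2 /\
    ((forall u m, regular_sol C w a1 u m -> end_value m <= 2 * C) /\
     (forall u m, regular_sol C w a2 u m -> 2 * C <= end_value m) \/
     (forall u m, regular_sol C w a1 u m -> 2 * C <= end_value m) /\
     (forall u m, regular_sol C w a2 u m -> end_value m <= 2 * C))).
  { destruct (Rle_lt_dec C 2).
    - destruct (end_mass_low_start_sub C w ltac:(lra) Hw) as (a1 & Ha1).
      destruct (end_mass_high_start_sub C w ltac:(lra) Hw) as (a2 & Ha2).
      exists (Rmin a1 a2), a2. split; [apply Rmin_r|]. left. split; intros u m H; left.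
      + apply (Ha1 _ u m (Rmin_l _ _) H).
      + apply (Ha2 _ u m (Rle_refl _) H).
    - destruct (end_mass_low_start_super C w ltac:(lra) Hw) as (a1 & Ha1).
      destruct (end_mass_high_start_super C w ltac:(lra) Hw) as (a2 & Ha2).
      exists (Rmin a1 a2), a2. split; [apply Rmin_r|]. right. split; intros u m H; left.
      + apply (Ha1 _ u m (Rmin_l _ _) H).
      + apply (Ha2 _ u m (Rle_refl _) H). }
  (* The extra 1 keeps every start in [a1, a2] strictly below the cut-off parameter, as continuity
     of the total mass at both ends requires. *)
  destruct Hends as (a1 & a2 & Ha & Hends). set (A := a2 + 1).
  assert (HR := fun a (Hle : a <= A) => regular_sol_of_family C w A a (proj1 HC) Hw Hle).
  destruct (intermediate_value
    (fun a => end_value (mass (-1) C w (fun t => A + 1 - C * ln ((2 - t) / 2)) a)) a1 a2 (2 * C))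
    as (a & Hle & E); [exact Ha| | |].
  - intros a Hle. apply end_mass_continuous; [exact HC|exact Hw|unfold A; lra].
  - assert (R1 := HR a1 ltac:(unfold A; lra)). assert (R2 := HR a2 ltac:(unfold A; lra)).
    destruct Hends as [(H1 & H2)|(H1 & H2)]; specialize (H1 _ _ R1); specialize (H2 _ _ R2);
      cbv beta; lra.
  - apply (regular_sol_critical C w a _ _ HC Hw (HR a ltac:(unfold A; lra)) E).
Qed.

Lemma axial_bvp_neg C w : 0 < C < 4 -> C <> 2 -> axial_bvp (-1) C w.
Proof.
  intros HC HC2. destruct (Rle_lt_dec 0 w); [now apply axial_bvp_neg_nonneg|].
  rewrite <- (Ropp_involutive w). apply axial_bvp_reflect. apply axial_bvp_neg_nonneg; lra.
Qed.

(** * Functions on the sphere in angular coordinates *)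

Lemma is_derive_eps (f : R -> R) (x l : R) :
  is_derive f x l <->
  forall eps, 0 < eps -> exists d, 0 < d /\ forall y, Rabs (y - x) < d ->
    Rabs (f y - f x - l * (y - x)) <= eps * Rabs (y - x).
Proof.
  split.
  - intros H eps He. apply is_derive_Reals in H.
    destruct (H eps He) as (d & Hd). exists d. split; [apply cond_pos|].
    intros y Hy. destruct (Req_dec y x) as [->|Hn].
    + replace (f x - f x - l * (x - x)) with 0 by ring. rewrite Rabs_R0.
      apply Rmult_le_pos; [lra|apply Rabs_pos].
    + specialize (Hd (y - x) ltac:(lra) Hy). replace (x + (y - x)) with y in Hd by ring.
      replace (f y - f x - l * (y - x)) with (((f y - f x) / (y - x) - l) * (y - x))
        by (field; lra).
      rewrite Rabs_mult. apply Rmult_le_compat_r; [apply Rabs_pos|lra].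
  - intros H. apply is_derive_Reals. intros eps He.
    destruct (H (eps / 2) ltac:(lra)) as (d & Hd0 & Hd). exists (mkposreal d Hd0).
    intros h Hh Hhd. specialize (Hd (x + h)). replace (x + h - x) with h in Hd by ring.
    specialize (Hd Hhd).
    replace ((f (x + h) - f x) / h - l) with ((f (x + h) - f x - l * h) * / h) by (field; lra).
    rewrite Rabs_mult, Rabs_inv. assert (Hp := Rabs_pos_lt h Hh).
    apply Rle_lt_trans with (eps / 2 * Rabs h * / Rabs h).
    + apply Rmult_le_compat_r; [left; now apply Rinv_0_lt_compat|exact Hd].
    + rewrite Rmult_assoc, Rinv_r; lra.
Qed.

Lemma mean_value_step (f df : R -> R) (x0 x P eps : R) :
  (forall t, Rmin x0 x <= t <= Rmax x0 x -> is_derive f t (df t)) ->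
  (forall t, Rmin x0 x <= t <= Rmax x0 x -> Rabs (df t - P) <= eps) ->
  Rabs (f x - f x0 - P * (x - x0)) <= eps * Rabs (x - x0).
Proof.
  intros Hd He. destruct (MVT_gen f x0 x df) as (c & Hc & E).
  - intros t Ht. apply Hd. lra.
  - intros t Ht. apply continuity_pt_filterlim. eapply continuous_of_derive. now apply Hd.
  - replace (f x - f x0 - P * (x - x0)) with ((df c - P) * (x - x0)) by (rewrite E; ring).
    rewrite Rabs_mult. apply Rmult_le_compat_r; [apply Rabs_pos|now apply He].
Qed.

Lemma smooth_on_partial U F i : smooth_on U F -> smooth_on U (partial i F).
Proof.
  intros H s p Hp.
  assert (E : iter_partial s (partial i F) = iter_partial (s ++ i :: nil) F).
  { unfold iter_partial. now rewrite fold_right_app. }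
  rewrite E. now apply H.
Qed.

Lemma is_derive_partial U F i p :
  smooth_on U F -> U p -> is_derive (fun t => F (set_coord i p t)) (coord i p) (partial i F p).
Proof.
  intros H Hp. apply Derive_correct. now apply (proj2 (H nil p Hp)).
Qed.

Lemma R3_locally_box (P : R3 -> Prop) (x y z : R) :
  locally (x, y, z) P ->
  exists r, 0 < r /\ forall x' y' z', Rabs (x' - x) < r -> Rabs (y' - y) < r ->
    Rabs (z' - z) < r -> P (x', y', z').
Proof.
  intros (r & Hr). exists r. split; [apply cond_pos|]. intros x' y' z' Hx Hy Hz.
  apply Hr. repeat split; assumption.
Qed.

Lemma R3_continuous_box (G : R3 -> R) (x y z eps : R) :
  continuous G (x, y, z) -> 0 < eps ->
  exists r, 0 < r /\ forall x' y' z', Rabs (x' - x) < r -> Rabs (y' - y) < r ->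
    Rabs (z' - z) < r -> Rabs (G (x', y', z') - G (x, y, z)) < eps.
Proof.
  intros HG He. apply (R3_locally_box (fun q => Rabs (G q - G (x, y, z)) < eps)).
  exact (proj1 (filterlim_locally G (G (x, y, z))) HG (mkposreal eps He)).
Qed.

(** Total differentiability from continuous partial derivatives: the increment is split into three
    moves parallel to the axes, each estimated by the mean value theorem. *)
Lemma increment_bound (U : R3 -> Prop) (F : R3 -> R) (x0 y0 z0 eps : R) :
  open U -> smooth_on U F -> U (x0, y0, z0) -> 0 < eps ->
  exists r, 0 < r /\ forall x y z,
    Rabs (x - x0) < r -> Rabs (y - y0) < r -> Rabs (z - z0) < r ->
    Rabs (F (x, y, z) - F (x0, y0, z0)
          - (partial axis_x F (x0, y0, z0) * (x - x0) + partial axis_y F (x0, y0, z0) * (y - y0)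
             + partial axis_z F (x0, y0, z0) * (z - z0)))
    <= eps * (Rabs (x - x0) + Rabs (y - y0) + Rabs (z - z0)).
Proof.
  intros HU HF H0 He.
  destruct (R3_locally_box U x0 y0 z0 (HU _ H0)) as (r0 & Hr0 & HrU).
  assert (HC : forall i, continuous (partial i F) (x0, y0, z0)).
  { intros i. apply (proj1 (HF (i :: nil) (x0, y0, z0) H0)). }
  destruct (R3_continuous_box _ _ _ _ eps (HC axis_x) He) as (r1 & Hr1 & Hc1).
  destruct (R3_continuous_box _ _ _ _ eps (HC axis_y) He) as (r2 & Hr2 & Hc2).
  destruct (R3_continuous_box _ _ _ _ eps (HC axis_z) He) as (r3 & Hr3 & Hc3).
  exists (Rmin (Rmin r0 r1) (Rmin r2 r3)). split; [repeat apply Rmin_pos; assumption|].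
  intros x y z Hx Hy Hz.
  assert (M0 : Rmin (Rmin r0 r1) (Rmin r2 r3) <= r0)
    by (eapply Rle_trans; [apply Rmin_l|apply Rmin_l]).
  assert (M1 : Rmin (Rmin r0 r1) (Rmin r2 r3) <= r1)
    by (eapply Rle_trans; [apply Rmin_l|apply Rmin_r]).
  assert (M2 : Rmin (Rmin r0 r1) (Rmin r2 r3) <= r2)
    by (eapply Rle_trans; [apply Rmin_r|apply Rmin_l]).
  assert (M3 : Rmin (Rmin r0 r1) (Rmin r2 r3) <= r3)
    by (eapply Rle_trans; [apply Rmin_r|apply Rmin_r]).
  set (r := Rmin (Rmin r0 r1) (Rmin r2 r3)) in *.
  assert (Hr : 0 < r) by (eapply Rle_lt_trans; [apply Rabs_pos|exact Hx]).
  assert (B : forall s0 s t, Rabs (s - s0) < r -> Rmin s0 s <= t <= Rmax s0 s -> Rabs (t - s0) < r).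
  { intros s0 s t Hs Ht. apply Rabs_def2 in Hs. apply Rabs_def1;
      unfold Rmin, Rmax in Ht; destruct (Rle_dec s0 s); lra. }
  assert (Z : forall s, Rabs (s - s) < r).
  { intros s. unfold Rminus. now rewrite Rplus_opp_r, Rabs_R0. }
  assert (S1 := mean_value_step (fun t => F (t, y, z)) (fun t => partial axis_x F (t, y, z))
    x0 x (partial axis_x F (x0, y0, z0)) eps).
  assert (S2 := mean_value_step (fun t => F (x0, t, z)) (fun t => partial axis_y F (x0, t, z))
    y0 y (partial axis_y F (x0, y0, z0)) eps).
  assert (S3 := mean_value_step (fun t => F (x0, y0, t)) (fun t => partial axis_z F (x0, y0, t))
    z0 z (partial axis_z F (x0, y0, z0)) eps).
  cbv beta in S1, S2, S3.
  assert (T1 : Rabs (F (x, y, z) - F (x0, y, z) - partial axis_x F (x0, y0, z0) * (x - x0))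
               <= eps * Rabs (x - x0)).
  { apply S1; intros t Ht; assert (Hb := B _ _ _ Hx Ht).
    - apply (is_derive_partial U F axis_x (t, y, z) HF). apply HrU; lra.
    - left. apply Hc1; lra. }
  assert (T2 : Rabs (F (x0, y, z) - F (x0, y0, z) - partial axis_y F (x0, y0, z0) * (y - y0))
               <= eps * Rabs (y - y0)).
  { apply S2; intros t Ht; assert (Hb := B _ _ _ Hy Ht); assert (Hz0 := Z x0).
    - apply (is_derive_partial U F axis_y (x0, t, z) HF). apply HrU; lra.
    - left. apply Hc2; lra. }
  assert (T3 : Rabs (F (x0, y0, z) - F (x0, y0, z0) - partial axis_z F (x0, y0, z0) * (z - z0))
               <= eps * Rabs (z - z0)).
  { apply S3; intros t Ht; assert (Hb := B _ _ _ Hz Ht);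
      assert (Hz0 := Z x0); assert (Hz1 := Z y0).
    - apply (is_derive_partial U F axis_z (x0, y0, t) HF). apply HrU; lra.
    - left. apply Hc3; lra. }
  apply Rabs_le_between in T1, T2, T3. apply Rabs_le_between. lra.
Qed.

Lemma is_derive_along_curve (U : R3 -> Prop) (F : R3 -> R) (a b c : R -> R) (t0 a' b' c' : R) :
  open U -> smooth_on U F -> U (a t0, b t0, c t0) ->
  is_derive a t0 a' -> is_derive b t0 b' -> is_derive c t0 c' ->
  is_derive (fun t => F (a t, b t, c t)) t0
    (partial axis_x F (a t0, b t0, c t0) * a' + partial axis_y F (a t0, b t0, c t0) * b'
     + partial axis_z F (a t0, b t0, c t0) * c').
Proof.
  intros HU HF H0 Ha Hb Hc.
  set (px := partial axis_x F (a t0, b t0, c t0)).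
  set (py := partial axis_y F (a t0, b t0, c t0)).
  set (pz := partial axis_z F (a t0, b t0, c t0)).
  assert (HG : is_derive (fun t => px * a t + py * b t + pz * c t) t0 (px * a' + py * b' + pz * c')).
  { apply (is_derive_plus (fun t => px * a t + py * b t) (fun t => pz * c t)).
    - apply (is_derive_plus (fun t => px * a t) (fun t => py * b t));
        [now apply (is_derive_scal a)|now apply (is_derive_scal b)].
    - now apply (is_derive_scal c). }
  assert (Lip : forall f l, is_derive f t0 l -> exists d, 0 < d /\ forall y, Rabs (y - t0) < d ->
     Rabs (f y - f t0) <= (Rabs l + 1) * Rabs (y - t0)).
  { intros f l Hf. destruct (proj1 (is_derive_eps f t0 l) Hf 1 Rlt_0_1) as (d & Hd & H).
    exists d. split; [exact Hd|]. intros y Hy. specialize (H y Hy).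
    replace (f y - f t0) with ((f y - f t0 - l * (y - t0)) + l * (y - t0)) by ring.
    eapply Rle_trans; [apply Rabs_triang|]. rewrite Rabs_mult. lra. }
  destruct (Lip a a' Ha) as (da & Hda & La), (Lip b b' Hb) as (db & Hdb & Lb),
    (Lip c c' Hc) as (dc & Hdc & Lc).
  set (K := Rabs a' + Rabs b' + Rabs c' + 3).
  assert (HK : 0 < K) by (unfold K; generalize (Rabs_pos a') (Rabs_pos b') (Rabs_pos c'); lra).
  apply is_derive_eps. intros eps He.
  destruct (proj1 (is_derive_eps _ _ _) HG (eps / 2) ltac:(lra)) as (dg & Hdg & Lg).
  assert (He2 : 0 < eps / (2 * K)) by (apply Rdiv_lt_0_compat; lra).
  destruct (increment_bound U F _ _ _ _ HU HF H0 He2) as (r & Hr & HI).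
  assert (HrK : 0 < r / K) by now apply Rdiv_lt_0_compat.
  exists (Rmin (Rmin da db) (Rmin dc (Rmin dg (r / K)))).
  split; [repeat apply Rmin_pos; assumption|].
  intros t Ht.
  assert (M1 := Rmin_l (Rmin da db) (Rmin dc (Rmin dg (r / K)))).
  assert (M2 := Rmin_r (Rmin da db) (Rmin dc (Rmin dg (r / K)))).
  assert (M3 := Rmin_l da db). assert (M4 := Rmin_r da db).
  assert (M5 := Rmin_l dc (Rmin dg (r / K))). assert (M6 := Rmin_r dc (Rmin dg (r / K))).
  assert (M7 := Rmin_l dg (r / K)). assert (M8 := Rmin_r dg (r / K)).
  specialize (La t ltac:(lra)). specialize (Lb t ltac:(lra)). specialize (Lc t ltac:(lra)).
  specialize (Lg t ltac:(lra)). cbv beta in Lg.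
  assert (HKt : K * Rabs (t - t0) < r).
  { replace r with (K * (r / K)) by (field; lra). apply Rmult_lt_compat_l; lra. }
  assert (Q := Rabs_pos (t - t0)). assert (Qa := Rabs_pos a'). assert (Qb := Rabs_pos b').
  assert (Qc := Rabs_pos c').
  assert (Ea : (Rabs a' + 1) * Rabs (t - t0) <= K * Rabs (t - t0))
    by (apply Rmult_le_compat_r; unfold K; lra).
  assert (Eb : (Rabs b' + 1) * Rabs (t - t0) <= K * Rabs (t - t0))
    by (apply Rmult_le_compat_r; unfold K; lra).
  assert (Ec : (Rabs c' + 1) * Rabs (t - t0) <= K * Rabs (t - t0))
    by (apply Rmult_le_compat_r; unfold K; lra).
  specialize (HI (a t) (b t) (c t) ltac:(lra) ltac:(lra) ltac:(lra)).
  fold px py pz in HI.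
  assert (HI2 : eps / (2 * K) * (Rabs (a t - a t0) + Rabs (b t - b t0) + Rabs (c t - c t0))
          <= eps / 2 * Rabs (t - t0)).
  { replace (eps / 2 * Rabs (t - t0)) with (eps / (2 * K) * (K * Rabs (t - t0))) by (field; lra).
    apply Rmult_le_compat_l; [lra|]. unfold K. lra. }
  apply Rabs_le_between in HI, Lg. apply Rabs_le_between. lra.
Qed.

(* O is open in every use; the partial derivatives are two-sided. *)
Fixpoint Cn_on_2d (n : nat) (O : R -> R -> Prop) (f : R -> R -> R) : Prop :=
  (forall x y, O x y -> continuity_2d_pt f x y) /\
  match n with
  | O => True
  | S n => exists f1 f2,
      (forall x y, O x y -> is_derive (fun t => f t y) x (f1 x y) /\
                            is_derive (fun t => f x t) y (f2 x y)) /\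
      Cn_on_2d n O f1 /\ Cn_on_2d n O f2
  end.

Lemma Cn_on_2d_pred n O f : Cn_on_2d (S n) O f -> Cn_on_2d n O f.
Proof.
  revert f; induction n as [|n IH]; intros f (Hc & f1 & f2 & Hd & H1 & H2).
  - split; [exact Hc|exact I].
  - split; [exact Hc|]. exists f1, f2. auto.
Qed.

Lemma Cn_on_2d_const n O c : Cn_on_2d n O (fun _ _ => c).
Proof.
  revert c; induction n as [|n IH]; intros c; (split; [intros; apply continuity_2d_pt_const|]).
  - exact I.
  - exists (fun _ _ => 0), (fun _ _ => 0). split; [|auto].
    intros x y _. split; apply (is_derive_const c).
Qed.

Lemma Cn_on_2d_plus n O f g :
  Cn_on_2d n O f -> Cn_on_2d n O g -> Cn_on_2d n O (fun x y => f x y + g x y).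
Proof.
  revert f g; induction n as [|n IH]; intros f g Hf Hg.
  - split; [|exact I]. intros x y H. apply continuity_2d_pt_plus; [now apply Hf|now apply Hg].
  - destruct Hf as (Cf & f1 & f2 & Df & Hf1 & Hf2), Hg as (Cg & g1 & g2 & Dg & Hg1 & Hg2).
    split; [intros; apply continuity_2d_pt_plus; auto|].
    exists (fun x y => f1 x y + g1 x y), (fun x y => f2 x y + g2 x y). split; [|auto].
    intros x y H. destruct (Df x y H), (Dg x y H). split.
    + now apply (is_derive_plus (fun t => f t y) (fun t => g t y)).
    + now apply (is_derive_plus (fun t => f x t) (fun t => g x t)).
Qed.

Lemma Cn_on_2d_mult n O f g :
  Cn_on_2d n O f -> Cn_on_2d n O g -> Cn_on_2d n O (fun x y => f x y * g x y).
Proof.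
  revert f g; induction n as [|n IH]; intros f g Hf Hg.
  - split; [|exact I]. intros x y H. apply continuity_2d_pt_mult; [now apply Hf|now apply Hg].
  - assert (Hf0 := Cn_on_2d_pred _ _ _ Hf). assert (Hg0 := Cn_on_2d_pred _ _ _ Hg).
    destruct Hf as (Cf & f1 & f2 & Df & Hf1 & Hf2), Hg as (Cg & g1 & g2 & Dg & Hg1 & Hg2).
    split; [intros; apply continuity_2d_pt_mult; auto|].
    exists (fun x y => f1 x y * g x y + f x y * g1 x y),
      (fun x y => f2 x y * g x y + f x y * g2 x y).
    split; [|split; apply Cn_on_2d_plus; auto].
    intros x y H. destruct (Df x y H), (Dg x y H). split.
    + apply (is_derive_mult (fun t => f t y) (fun t => g t y)); auto.
      intros; apply Rmult_comm.
    + apply (is_derive_mult (fun t => f x t) (fun t => g x t)); auto.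
      intros; apply Rmult_comm.
Qed.

Lemma continuity_2d_comp_fst (f : R -> R) x y :
  continuous f x -> continuity_2d_pt (fun x _ => f x) x y.
Proof.
  intros H. apply (continuity_1d_2d_pt_comp f (fun x _ => x)).
  - now apply continuity_pt_filterlim.
  - apply continuity_2d_pt_id1.
Qed.

Lemma continuity_2d_comp_snd (f : R -> R) x y :
  continuous f y -> continuity_2d_pt (fun _ y => f y) x y.
Proof.
  intros H. apply (continuity_1d_2d_pt_comp f (fun _ y => y)).
  - now apply continuity_pt_filterlim.
  - apply continuity_2d_pt_id2.
Qed.

Lemma Cn_on_2d_trig n O :
  Cn_on_2d n O (fun x _ => sin x) /\ Cn_on_2d n O (fun x _ => cos x) /\
  Cn_on_2d n O (fun _ y => sin y) /\ Cn_on_2d n O (fun _ y => cos y).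
Proof.
  assert (Cs := continuous_sin). assert (Cc := continuous_cos).
  induction n as [|n (I1 & I2 & I3 & I4)].
  - repeat split; intros;
      (apply continuity_2d_comp_fst || apply continuity_2d_comp_snd); auto.
  - assert (Z := Cn_on_2d_const n O 0).
    assert (N : forall f, Cn_on_2d n O f -> Cn_on_2d n O (fun x y => -1 * f x y)).
    { intros f Hf. apply Cn_on_2d_mult; [apply Cn_on_2d_const|exact Hf]. }
    assert (Dc : forall x, is_derive cos x (-1 * sin x)).
    { intros x. replace (-1 * sin x) with (- sin x) by ring. apply is_derive_cos. }
    split; [|split; [|split]]; (split; [intros;
      (apply continuity_2d_comp_fst || apply continuity_2d_comp_snd); auto|]).
    + exists (fun x _ => cos x), (fun _ _ => 0). split; [|auto].
      intros x y _. split; [apply is_derive_sin|apply (is_derive_const (sin x))].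
    + exists (fun x _ => -1 * sin x), (fun _ _ => 0). split; [|split; [now apply N|exact Z]].
      intros x y _. split; [apply Dc|apply (is_derive_const (cos x))].
    + exists (fun _ _ => 0), (fun _ y => cos y). split; [|auto].
      intros x y _. split; [apply (is_derive_const (sin y))|apply is_derive_sin].
    + exists (fun _ _ => 0), (fun _ y => -1 * sin y).
      split; [|split; [exact Z|apply (N (fun _ y => sin y)); exact I3]].
      intros x y _. split; [apply (is_derive_const (cos y))|apply Dc].
Qed.

Definition sph (x y : R) : R3 := (sin x * cos y, sin x * sin y, cos x).

Lemma continuity_2d_sph (G : R3 -> R) x y :
  continuous G (sph x y) -> continuity_2d_pt (fun x y => G (sph x y)) x y.
Proof.
  intros HG. apply continuity_2d_pt_filterlim.
  apply (filterlim_comp _ _ _ (fun z : R * R => sph (fst z) (snd z)) G _ (locally (sph x y)));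
    [|exact HG].
  destruct (Cn_on_2d_trig 0 (fun _ _ => True)) as (T1 & T2 & T3 & T4).
  assert (C1 : continuity_2d_pt (fun x y => sin x * cos y) x y).
  { apply (Cn_on_2d_mult 0 (fun _ _ => True) (fun x _ => sin x) (fun _ y => cos y)); auto. }
  assert (C2 : continuity_2d_pt (fun x y => sin x * sin y) x y).
  { apply (Cn_on_2d_mult 0 (fun _ _ => True) (fun x _ => sin x) (fun _ y => sin y)); auto. }
  assert (C3 : continuity_2d_pt (fun x _ => cos x) x y) by now apply T2.
  apply filterlim_locally. intros eps.
  apply continuity_2d_pt_filterlim in C1. apply continuity_2d_pt_filterlim in C2.
  apply continuity_2d_pt_filterlim in C3.
  assert (L1 := proj1 (filterlim_locally _ _) C1 eps).
  assert (L2 := proj1 (filterlim_locally _ _) C2 eps).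
  assert (L3 := proj1 (filterlim_locally _ _) C3 eps).
  generalize (filter_and _ _ (filter_and _ _ L1 L2) L3). apply filter_imp.
  intros z ((H1 & H2) & H3). repeat split; assumption.
Qed.

Lemma Cn_on_2d_sph n U F :
  open U -> smooth_on U F -> Cn_on_2d n (fun x y => U (sph x y)) (fun x y => F (sph x y)).
Proof.
  intros HU. revert F; induction n as [|n IH]; intros F HF;
    (split; [intros x y H; apply continuity_2d_sph; exact (proj1 (HF nil _ H))|]).
  - exact I.
  - set (O := fun x y => U (sph x y)).
    destruct (Cn_on_2d_trig n O) as (T1 & T2 & T3 & T4).
    assert (P := fun i => IH (partial i F) (smooth_on_partial U F i HF)). fold O in P.
    exists (fun x y => partial axis_x F (sph x y) * (cos x * cos y)
                       + partial axis_y F (sph x y) * (cos x * sin y)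
                       + partial axis_z F (sph x y) * (-1 * sin x)).
    exists (fun x y => partial axis_x F (sph x y) * (-1 * (sin x * sin y))
                       + partial axis_y F (sph x y) * (sin x * cos y)
                       + partial axis_z F (sph x y) * 0).
    split; [|split].
    + intros x y H. split.
      * apply (is_derive_along_curve U F (fun t => sin t * cos y) (fun t => sin t * sin y) cos);
          auto; auto_derive; auto; ring.
      * apply (is_derive_along_curve U F (fun t => sin x * cos t) (fun t => sin x * sin t)
          (fun _ => cos x)); auto; auto_derive; auto; ring.
    + repeat first [apply Cn_on_2d_plus | apply (P axis_x) | apply (P axis_y) | apply (P axis_z)
        | exact T1 | exact T2 | exact T3 | exact T4 | apply Cn_on_2d_const | apply Cn_on_2d_mult].
    + repeat first [apply Cn_on_2d_plus | apply (P axis_x) | apply (P axis_y) | apply (P axis_z)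
        | exact T1 | exact T2 | exact T3 | exact T4 | apply Cn_on_2d_const | apply Cn_on_2d_mult].
Qed.

(** The local representatives g vary from point to point. The global derivatives are therefore taken
    by [Derive]; on each open O they agree with the derivatives of g, which represent them locally
    in turn. *)
Lemma Cn_on_2d_of_local n (W : R -> R -> R) :
  (forall x y, exists O g, O x y /\ (forall a b, O a b -> locally_2d O a b) /\
     (forall a b, O a b -> W a b = g a b) /\ Cn_on_2d n O g) ->
  Cn_on_2d n (fun _ _ => True) W.
Proof.
  revert W; induction n as [|n IH]; intros W H.
  - split; [|exact I]. intros x y _. destruct (H x y) as (O & g & H0 & HO & E & Hg & _).
    apply continuity_2d_pt_ext_loc with g; [|now apply Hg].
    eapply locally_2d_impl; [|exact (HO x y H0)]. apply locally_2d_forall.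
    intros u v Huv. symmetry. now apply E.
  - assert (L1 : forall O x y, locally_2d O x y -> locally x (fun t => O t y)).
    { intros O x y (d & Hd). exists d. intros t Ht. apply Hd; [exact Ht|].
      unfold Rminus. rewrite Rplus_opp_r, Rabs_R0. apply cond_pos. }
    assert (L2 : forall O x y, locally_2d O x y -> locally y (fun t => O x t)).
    { intros O x y (d & Hd). exists d. intros t Ht. apply Hd; [|exact Ht].
      unfold Rminus. rewrite Rplus_opp_r, Rabs_R0. apply cond_pos. }
    assert (D : forall O g, (forall a b, O a b -> locally_2d O a b) ->
       (forall a b, O a b -> W a b = g a b) ->
       forall g1 g2, (forall x y, O x y -> is_derive (fun t => g t y) x (g1 x y) /\
                            is_derive (fun t => g x t) y (g2 x y)) ->
       forall x y, O x y -> is_derive (fun t => W t y) x (g1 x y) /\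
                            is_derive (fun t => W x t) y (g2 x y)).
    { intros O g HO E g1 g2 Hd x y Hxy. destruct (Hd x y Hxy) as (D1 & D2). split.
      - apply (is_derive_ext_loc (fun t => g t y)); [|exact D1].
        generalize (L1 O x y (HO x y Hxy)). apply filter_imp. intros t Ht. symmetry. now apply E.
      - apply (is_derive_ext_loc (fun t => g x t)); [|exact D2].
        generalize (L2 O x y (HO x y Hxy)). apply filter_imp. intros t Ht. symmetry. now apply E. }
    split.
    + intros x y _. destruct (H x y) as (O & g & H0 & HO & E & Hg & _).
      apply continuity_2d_pt_ext_loc with g; [|now apply Hg].
      eapply locally_2d_impl; [|exact (HO x y H0)]. apply locally_2d_forall.
      intros u v Huv. symmetry. now apply E.
    + exists (fun x y => Derive (fun t => W t y) x), (fun x y => Derive (fun t => W x t) y).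
      split; [|split].
      * intros x y _. destruct (H x y) as (O & g & H0 & HO & E & Hg & g1 & g2 & Hd & _).
        destruct (D O g HO E g1 g2 Hd x y H0) as (D1 & D2).
        split; apply Derive_correct; eexists; eassumption.
      * apply IH. intros x y. destruct (H x y) as (O & g & H0 & HO & E & Hg & g1 & g2 & Hd & Hg1 & _).
        exists O, g1. repeat split; auto. intros a b Hab.
        apply is_derive_unique. now apply (D O g HO E g1 g2 Hd).
      * apply IH. intros x y. destruct (H x y) as (O & g & H0 & HO & E & Hg & g1 & g2 & Hd & _ & Hg2).
        exists O, g2. repeat split; auto. intros a b Hab.
        apply is_derive_unique. now apply (D O g HO E g1 g2 Hd).
Qed.

Lemma open_preimage_sph (U : R3 -> Prop) x y :
  open U -> U (sph x y) -> locally_2d (fun x y => U (sph x y)) x y.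
Proof.
  intros HU H. destruct (R3_locally_box U _ _ _ (HU _ H)) as (r & Hr & HrU).
  destruct (Cn_on_2d_trig 0 (fun _ _ => True)) as (T1 & T2 & T3 & T4).
  assert (C1 : continuity_2d_pt (fun x y => sin x * cos y) x y).
  { apply (Cn_on_2d_mult 0 (fun _ _ => True) (fun x _ => sin x) (fun _ y => cos y)); auto. }
  assert (C2 : continuity_2d_pt (fun x y => sin x * sin y) x y).
  { apply (Cn_on_2d_mult 0 (fun _ _ => True) (fun x _ => sin x) (fun _ y => sin y)); auto. }
  assert (C3 : continuity_2d_pt (fun x _ => cos x) x y) by now apply T2.
  destruct (C1 (mkposreal r Hr)) as (d1 & H1), (C2 (mkposreal r Hr)) as (d2 & H2),
    (C3 (mkposreal r Hr)) as (d3 & H3).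
  assert (Hd : 0 < Rmin d1 (Rmin d2 d3)) by (repeat apply Rmin_pos; apply cond_pos).
  assert (M1 := Rmin_l d1 (Rmin d2 d3)). assert (M2 := Rmin_r d1 (Rmin d2 d3)).
  assert (M3 := Rmin_l d2 d3). assert (M4 := Rmin_r d2 d3).
  exists (mkposreal _ Hd). simpl. intros u v Hu Hv.
  apply HrU; [apply (H1 u v)|apply (H2 u v)|apply (H3 u v)]; lra.
Qed.

(** Points of [S2] carry a proof, so equal coordinates do not make equal points by computation; a
    local extension depends on the coordinates alone. This yields periodicity in the longitude and
    constancy at the poles. *)
Lemma smooth_S2_proj (psi : S2 -> R) (q q' : S2) :
  smooth_S2 psi -> proj1_sig q = proj1_sig q' -> psi q = psi q'.
Proof.
  intros H E. destruct (H q) as (U & F & _ & Hq & _ & HF).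
  rewrite (HF q Hq). rewrite E in Hq |- *. symmetry. now apply HF.
Qed.

Lemma smooth_S2_in_angles (psi : S2 -> R) n :
  smooth_S2 psi -> Cn_on_2d n (fun _ _ => True) (fun x y => psi (spherical x y)).
Proof.
  intros H. apply Cn_on_2d_of_local. intros x y.
  destruct (H (spherical x y)) as (U & F & HU & Hq & HF & E).
  exists (fun x y => U (sph x y)), (fun x y => F (sph x y)). split; [exact Hq|].
  split; [intros; now apply open_preimage_sph|].
  split; [intros a b Hab; now apply E|now apply Cn_on_2d_sph].
Qed.

Lemma continuous_slice_snd (f : R -> R -> R) x y :
  continuity_2d_pt f x y -> continuous (fun t => f x t) y.
Proof.
  intros H. apply filterlim_locally. intros eps. destruct (H eps) as (d & Hd).
  exists d. intros t Ht. apply Hd; [|exact Ht].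
  unfold Rminus. rewrite Rplus_opp_r, Rabs_R0. apply cond_pos.
Qed.

(** * Nonexistence *)

(* The average of J over the parallels vanishes at both poles, so that of
   sin x * J' - R' cannot have a sign: the term R' averages to zero. *)
Lemma no_divergence_of_one_sign (J J' R R' : R -> R -> R) :
  (forall x y, is_derive (fun t => J t y) x (J' x y)) ->
  (forall x y, continuity_2d_pt J' x y) ->
  (forall x y, continuity_2d_pt J x y) ->
  (forall y, J 0 y = 0) -> (forall y, J PI y = 0) ->
  (forall x y, is_derive (fun t => R x t) y (R' x y)) ->
  (forall x y, continuity_2d_pt R' x y) ->
  (forall x, R x (2 * PI) = R x 0) ->
  ~ (forall x y, 0 < x < PI -> 0 < y < 2 * PI -> 0 < sin x * J' x y - R' x y).
Proof.
  intros DJ CJ' CJ J0 JPI DR CR' Rper Hpos.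
  assert (Hpi := PI_RGT_0).
  assert (ExJ : forall x, ex_RInt (J x) 0 (2 * PI)).
  { intros x. apply (ex_RInt_continuous (V := R_CompleteNormedModule)). intros y _.
    now apply (continuous_slice_snd J). }
  assert (ExJ' : forall x, ex_RInt (J' x) 0 (2 * PI)).
  { intros x. apply (ex_RInt_continuous (V := R_CompleteNormedModule)). intros y _.
    now apply (continuous_slice_snd J'). }
  assert (IR : forall x, is_RInt (R' x) 0 (2 * PI) 0).
  { intros x. replace 0 with (minus (R x (2 * PI)) (R x 0)) at 2.
    - apply (is_RInt_derive (V := R_CompleteNormedModule) (R x)).
      + intros y _. apply DR.
      + intros y _. now apply (continuous_slice_snd R').
    - rewrite Rper. apply (minus_eq_zero (R x 0)). }
  assert (DH : forall x, is_derive (fun x => RInt (J x) 0 (2 * PI)) x (RInt (J' x) 0 (2 * PI))).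
  { intros x. rewrite (RInt_ext (J' x) (fun t => Derive (fun u => J u t) x)).
    2: { intros y _. symmetry. apply is_derive_unique, DJ. }
    apply (is_derive_RInt_param J).
    - apply filter_forall. intros u t _. eexists. apply DJ.
    - intros t _. apply continuity_2d_pt_ext with J'; [|apply CJ'].
      intros u v. symmetry. apply is_derive_unique, DJ.
    - apply filter_forall. intros u. apply ExJ. }
  assert (HI : forall x, 0 < x < PI -> 0 < RInt (J' x) 0 (2 * PI)).
  { intros x Hx. assert (Hs : 0 < sin x) by now apply sin_gt_0.
    assert (IQ : is_RInt (fun y => sin x * J' x y - R' x y) 0 (2 * PI)
                   (sin x * RInt (J' x) 0 (2 * PI) - 0)).
    { apply (is_RInt_minus (V := R_NormedModule) (fun y => sin x * J' x y) (R' x)); [|apply IR].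
      apply (is_RInt_scal (V := R_NormedModule) (J' x)).
      apply (RInt_correct (V := R_CompleteNormedModule)), ExJ'. }
    assert (0 < RInt (fun y => sin x * J' x y - R' x y) 0 (2 * PI)).
    { apply RInt_gt_0; [lra| |].
      - intros y Hy. now apply Hpos.
      - intros y _. apply continuous_Rminus.
        + apply continuous_Rmult; [apply continuous_const|now apply (continuous_slice_snd J')].
        + now apply (continuous_slice_snd R'). }
    rewrite (is_RInt_unique _ _ _ _ IQ) in H. nra. }
  assert (Z : forall x, (forall y, J x y = 0) -> RInt (J x) 0 (2 * PI) = 0).
  { intros x Hx. rewrite (RInt_ext (J x) (fun _ => 0)); [|intros; apply Hx].
    rewrite RInt_const. unfold scal; simpl. unfold mult; simpl. ring. }
  assert (RInt (J 0) 0 (2 * PI) < RInt (J PI) 0 (2 * PI)).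
  { apply (lt_of_derive_pos (fun x => RInt (J x) 0 (2 * PI)) (fun x => RInt (J' x) 0 (2 * PI)));
      auto. intros x _. eapply continuous_of_derive. apply DH. }
  rewrite (Z 0 J0), (Z PI JPI) in H. lra.
Qed.

(** Both mixed derivatives are the same [W12], by Schwarz; the cancellation in the critical case
    rests on it. The longitude derivative vanishes at the poles because each parallel shrinks to a
    point there. *)
Record angular_C2 (W W1 W2 W11 W12 W22 : R -> R -> R) : Prop := {
  ang_1 : forall x y, is_derive (fun t => W t y) x (W1 x y);
  ang_2 : forall x y, is_derive (fun t => W x t) y (W2 x y);
  ang_11 : forall x y, is_derive (fun t => W1 t y) x (W11 x y);
  ang_12 : forall x y, is_derive (fun t => W1 x t) y (W12 x y);
  ang_21 : forall x y, is_derive (fun t => W2 t y) x (W12 x y);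
  ang_22 : forall x y, is_derive (fun t => W2 x t) y (W22 x y);
  ang_c : forall x y, continuity_2d_pt W x y;
  ang_c1 : forall x y, continuity_2d_pt W1 x y;
  ang_c2 : forall x y, continuity_2d_pt W2 x y;
  ang_c11 : forall x y, continuity_2d_pt W11 x y;
  ang_c12 : forall x y, continuity_2d_pt W12 x y;
  ang_c22 : forall x y, continuity_2d_pt W22 x y;
  ang_per1 : forall x, W1 x (2 * PI) = W1 x 0;
  ang_per2 : forall x, W2 x (2 * PI) = W2 x 0;
  ang_north : forall y, W2 0 y = 0;
  ang_south : forall y, W2 PI y = 0 }.

Lemma angular_C2_of_smooth (psi : S2 -> R) :
  smooth_S2 psi ->
  exists W1 W2 W11 W12 W22, angular_C2 (fun x y => psi (spherical x y)) W1 W2 W11 W12 W22.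
Proof.
  intros H. set (W := fun x y => psi (spherical x y)).
  assert (HW := smooth_S2_in_angles psi 2 H). fold W in HW.
  destruct HW as (C & W1 & W2 & D & (C1 & W11 & W12 & D1 & (C11 & _) & (C12 & _)) &
    (C2 & W21 & W22 & D2 & (C21 & _) & (C22 & _))).
  assert (d1 := fun x y => proj1 (D x y I)). assert (d2 := fun x y => proj2 (D x y I)).
  assert (d11 := fun x y => proj1 (D1 x y I)). assert (d12 := fun x y => proj2 (D1 x y I)).
  assert (d21 := fun x y => proj1 (D2 x y I)). assert (d22 := fun x y => proj2 (D2 x y I)).
  assert (e1 : forall x y, Derive (fun t => W t y) x = W1 x y)
    by (intros; now apply is_derive_unique).
  assert (e2 : forall x y, Derive (fun t => W x t) y = W2 x y)
    by (intros; now apply is_derive_unique).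
  assert (e12 : forall x y, Derive (fun z => Derive (fun t => W t z) x) y = W12 x y).
  { intros x y. rewrite (Derive_ext _ (fun z => W1 x z)) by (intros; apply e1).
    now apply is_derive_unique. }
  assert (e21 : forall x y, Derive (fun z => Derive (fun t => W z t) y) x = W21 x y).
  { intros x y. rewrite (Derive_ext _ (fun z => W2 z y)) by (intros; apply e2).
    now apply is_derive_unique. }
  assert (E : forall x y, W21 x y = W12 x y).
  { intros x y. rewrite <- e12, <- e21. apply Schwarz.
    - apply locally_2d_forall. intros u v. repeat split.
      + eexists. apply d1.
      + eexists. apply d2.
      + apply ex_derive_ext with (fun z => W2 z v); [intros; symmetry; apply e2|eexists; apply d21].
      + apply ex_derive_ext with (fun z => W1 u z); [intros; symmetry; apply e1|eexists; apply d12].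
    - apply continuity_2d_pt_ext with W21; [intros; symmetry; apply e21|now apply C21].
    - apply continuity_2d_pt_ext with W12; [intros; symmetry; apply e12|now apply C12]. }
  assert (per : forall x y, W x (y + 2 * PI) = W x y).
  { intros x y. apply smooth_S2_proj; [exact H|]. simpl.
    replace (cos (y + 2 * PI)) with (cos y) by (rewrite <- (cos_period y 1); f_equal; simpl; ring).
    replace (sin (y + 2 * PI)) with (sin y) by (rewrite <- (sin_period y 1); f_equal; simpl; ring).
    reflexivity. }
  exists W1, W2, W11, W12, W22. constructor; auto.
  - intros x y. rewrite <- E. apply d21.
  - intros x. rewrite <- !e1. apply Derive_ext. intros t.
    rewrite <- (per t 0). f_equal. ring.
  - intros x. rewrite <- (e2 x 0). symmetry.
    rewrite (Derive_ext _ (fun t => W x (1 * t + 2 * PI))).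
    2: { intros t. rewrite <- (per x t). f_equal. ring. }
    apply is_derive_unique. replace (W2 x (2 * PI)) with (1 * W2 x (2 * PI)) by ring.
    apply (is_derive_affine (W x) 1 (2 * PI) 0).
    replace (1 * 0 + 2 * PI) with (2 * PI) by ring. apply d2.
  - intros y. rewrite <- e2. rewrite (Derive_ext _ (fun _ => W 0 y)); [apply Derive_const|].
    intros t. apply smooth_S2_proj; [exact H|]. simpl. rewrite sin_0. f_equal. f_equal; ring.
  - intros y. rewrite <- e2. rewrite (Derive_ext _ (fun _ => W PI y)); [apply Derive_const|].
    intros t. apply smooth_S2_proj; [exact H|]. simpl. rewrite sin_PI. f_equal. f_equal; ring.
Qed.

Lemma solution_in_angles c d g omega psi :
  is_solution c d g omega psi ->
  exists W1 W2 W11 W12 W22,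
    angular_C2 (fun x y => psi (spherical x y)) W1 W2 W11 W12 W22 /\
    forall x y, 0 < x < PI -> 0 < y < 2 * PI ->
      sin x ^ 2 * W11 x y + sin x * cos x * W1 x y + W22 x y
        - 2 * omega * cos x * sin x ^ 2
      = sin x ^ 2 * (c * exp (d * psi (spherical x y)) + g).
Proof.
  intros (Hs & Heq). destruct (angular_C2_of_smooth psi Hs) as (W1 & W2 & W11 & W12 & W22 & HA).
  exists W1, W2, W11, W12, W22. split; [exact HA|]. intros x y Hx Hy.
  rewrite <- Heq by lra. unfold laplacian_S2.
  assert (Hsx : 0 < sin x) by now apply sin_gt_0.
  assert (E11 : Derive_n (fun t => psi (spherical t y)) 2 x = W11 x y).
  { change (Derive (Derive (fun t => psi (spherical t y))) x = W11 x y).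
    rewrite (Derive_ext _ (fun t => W1 t y)).
    - apply is_derive_unique. apply (ang_11 _ _ _ _ _ _ HA).
    - intros t. apply is_derive_unique. apply (ang_1 _ _ _ _ _ _ HA). }
  assert (E22 : Derive_n (fun t => psi (spherical x t)) 2 y = W22 x y).
  { change (Derive (Derive (fun t => psi (spherical x t))) y = W22 x y).
    rewrite (Derive_ext _ (fun t => W2 x t)).
    - apply is_derive_unique. apply (ang_22 _ _ _ _ _ _ HA).
    - intros t. apply is_derive_unique. apply (ang_2 _ _ _ _ _ _ HA). }
  assert (E1 : Derive (fun t => psi (spherical t y)) x = W1 x y).
  { apply is_derive_unique. apply (ang_1 _ _ _ _ _ _ HA). }
  rewrite E11, E22, E1. field. lra.
Qed.

Ltac cont2 :=
  repeat first
    [ assumption | apply continuity_2d_pt_const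
    | apply continuity_2d_pt_minus | apply continuity_2d_pt_opp | apply continuity_2d_pt_plus | apply continuity_2d_pt_mult
    | apply (continuity_1d_2d_pt_comp exp); [apply continuity_pt_filterlim, continuous_exp|]
    | apply (continuity_2d_comp_fst sin); apply continuous_sin
    | apply (continuity_2d_comp_fst cos); apply continuous_cos ].

(** Integration over the sphere removes the Laplacian and the cosine, leaving c times a positive
    integral plus a multiple of g. Only the sign of [sg] matters, so c, d or -d can be inserted as
    convenient. *)
Lemma no_solution_same_sign c d g omega sg :
  0 < sg * c -> 0 <= sg * g -> ~ has_solution c d g omega.
Proof.
  intros Hc Hg (psi & Hpsi).
  destruct (solution_in_angles _ _ _ _ _ Hpsi) as (W1 & W2 & W11 & W12 & W22 & HA & Heq).
  (* The equation times sin^2 in divergence form: the rotation term -2 omega cos x sin^2 x is sin x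
     times the derivative of -omega sin^2 x. *)
  apply (no_divergence_of_one_sign
    (fun x y => sg * (sin x * (W1 x y - omega * sin x)))
    (fun x y => sg * (cos x * (W1 x y - omega * sin x) + sin x * (W11 x y - omega * cos x)))
    (fun x y => -1 * sg * W2 x y) (fun x y => -1 * sg * W22 x y)).
  - intros x y. apply (is_derive_scal (fun x => sin x * (W1 x y - omega * sin x))).
    apply (is_derive_mult sin (fun x => W1 x y - omega * sin x)).
    + apply is_derive_sin.
    + apply (is_derive_minus (fun x => W1 x y) (fun x => omega * sin x)).
      * apply (ang_11 _ _ _ _ _ _ HA).
      * apply (is_derive_scal sin), is_derive_sin.
    + intros; apply Rmult_comm.
  - intros x y. assert (A1 := ang_c1 _ _ _ _ _ _ HA x y). assert (A2 := ang_c11 _ _ _ _ _ _ HA x y).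
    cont2.
  - intros x y. assert (A1 := ang_c1 _ _ _ _ _ _ HA x y). cont2.
  - intros y. rewrite sin_0. ring.
  - intros y. rewrite sin_PI. ring.
  - intros x y. apply (is_derive_scal (fun t => W2 x t)). apply (ang_22 _ _ _ _ _ _ HA).
  - intros x y. assert (A1 := ang_c22 _ _ _ _ _ _ HA x y). cont2.
  - intros x. now rewrite (ang_per2 _ _ _ _ _ _ HA).
  - intros x y Hx Hy. specialize (Heq x y Hx Hy).
    replace (sin x * (sg * (cos x * (W1 x y - omega * sin x) + sin x * (W11 x y - omega * cos x)))
       - -1 * sg * W22 x y) with
      (sg * (sin x ^ 2 * W11 x y + sin x * cos x * W1 x y + W22 x y
        - 2 * omega * cos x * sin x ^ 2)) by ring.
    rewrite Heq.
    replace (sg * (sin x ^ 2 * (c * exp (d * psi (spherical x y)) + g))) with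
      (sin x ^ 2 * (sg * c * exp (d * psi (spherical x y)) + sg * g)) by ring.
    assert (0 < sin x) by now apply sin_gt_0.
    apply Rmult_lt_0_compat; [now apply pow_lt|].
    assert (0 < sg * c * exp (d * psi (spherical x y))) by (apply Rmult_lt_0_compat; [exact Hc|apply exp_pos]).
    lra.
Qed.

(* The Kazdan-Warner obstruction.  With v = d psi + varpi cos x and
   E = c d exp (d psi), the equation reads Delta v = E + 2; it is multiplied by
   the conformal field sin x * v_x + 2 cos x. *)
Lemma no_solution_critical c d g omega :
  c * d <> 0 -> omega * d <> 0 -> g * d = 2 -> ~ has_solution c d g omega.
Proof.
  intros Hcd Hw Hg (psi & Hpsi).
  destruct (solution_in_angles _ _ _ _ _ Hpsi) as (W1 & W2 & W11 & W12 & W22 & HA & Heq).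
  set (W := fun x y => psi (spherical x y)) in *.
  set (w := omega * d) in *.
  (* The divergence without this factor is -w c d sin^4 x e^(d psi); multiplying by its own constant
     turns that into a square. *)
  set (sg := - w * (c * d)).
  assert (Hsg : sg <> 0).
  { unfold sg. apply Rmult_integral_contrapositive_currified; [lra|exact Hcd]. }
  set (E := fun x y => c * d * exp (d * W x y)).
  set (v1 := fun x y => d * W1 x y - w * sin x).
  set (v11 := fun x y => d * W11 x y - w * cos x).
  (* J and R are the components of the field whose divergence is the multiplied equation. In it E
     depends on d psi and not on v, so its x-derivative brings [d * W1], that is [v1] plus w sin x;
     the surplus w sin x yields the only term that does not cancel. *)
  apply (no_divergence_of_one_sign
    (fun x y => sg * (/ 2 * (sin x * sin x * (v1 x y * v1 x y)) - / 2 * (d * W2 x y * (d * W2 x y))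
      - sin x * sin x * E x y + 2 * (cos x * (sin x * v1 x y)) - 2 * (sin x * sin x)))
    (fun x y => sg * (sin x * cos x * (v1 x y * v1 x y) + sin x * sin x * (v1 x y * v11 x y)
      - d * W2 x y * (d * W12 x y)
      - (2 * (sin x * cos x) * E x y + sin x * sin x * (E x y * (d * W1 x y)))
      + 2 * (- sin x * (sin x * v1 x y) + cos x * (cos x * v1 x y + sin x * v11 x y))
      - 4 * (sin x * cos x)))
    (fun x y => sg * (- (sin x * (v1 x y * (d * W2 x y))) - 2 * (cos x * (d * W2 x y))))
    (fun x y => sg * (- (sin x * (d * W12 x y * (d * W2 x y) + v1 x y * (d * W22 x y)))
      - 2 * (cos x * (d * W22 x y))))).
  - intros x y.
    assert (D := ang_1 _ _ _ _ _ _ HA x y). assert (D1 := ang_11 _ _ _ _ _ _ HA x y).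
    assert (D2 := ang_21 _ _ _ _ _ _ HA x y).
    set (f := fun t => W t y) in D. set (f1 := fun t => W1 t y) in D1.
    set (f2 := fun t => W2 t y) in D2.
    apply (is_derive_ext (fun t => sg * (/ 2 * (sin t * sin t * ((d * f1 t - w * sin t) * (d * f1 t - w * sin t)))
      - / 2 * (d * f2 t * (d * f2 t)) - sin t * sin t * (c * d * exp (d * f t))
      + 2 * (cos t * (sin t * (d * f1 t - w * sin t))) - 2 * (sin t * sin t)))).
    { intros t. reflexivity. }
    auto_derive.
    + repeat split; eexists; eassumption.
    + assert (e0 : Derive (fun t : R => f t) x = W1 x y) by exact (is_derive_unique _ _ _ D).
      assert (e1 : Derive (fun t : R => f1 t) x = W11 x y) by exact (is_derive_unique _ _ _ D1).
      assert (e2 : Derive (fun t : R => f2 t) x = W12 x y) by exact (is_derive_unique _ _ _ D2).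
      rewrite e0, e1, e2. unfold v1, v11, E, f, f1, f2. field.
  - intros x y.
    assert (A := ang_c _ _ _ _ _ _ HA x y).
    assert (A1 := ang_c1 _ _ _ _ _ _ HA x y). assert (A2 := ang_c2 _ _ _ _ _ _ HA x y).
    assert (A11 := ang_c11 _ _ _ _ _ _ HA x y). assert (A12 := ang_c12 _ _ _ _ _ _ HA x y).
    assert (A22 := ang_c22 _ _ _ _ _ _ HA x y). unfold v1, v11, E. cont2.
  - intros x y.
    assert (A := ang_c _ _ _ _ _ _ HA x y).
    assert (A1 := ang_c1 _ _ _ _ _ _ HA x y). assert (A2 := ang_c2 _ _ _ _ _ _ HA x y).
    assert (A11 := ang_c11 _ _ _ _ _ _ HA x y). assert (A12 := ang_c12 _ _ _ _ _ _ HA x y).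
    assert (A22 := ang_c22 _ _ _ _ _ _ HA x y). unfold v1, v11, E. cont2.
  - intros y. rewrite sin_0, (ang_north _ _ _ _ _ _ HA). ring.
  - intros y. rewrite sin_PI, (ang_south _ _ _ _ _ _ HA). ring.
  - intros x y.
    assert (D1 := ang_12 _ _ _ _ _ _ HA x y). assert (D2 := ang_22 _ _ _ _ _ _ HA x y).
    set (f1 := fun t => W1 x t) in D1. set (f2 := fun t => W2 x t) in D2.
    apply (is_derive_ext (fun t => sg * (- (sin x * ((d * f1 t - w * sin x) * (d * f2 t)))
      - 2 * (cos x * (d * f2 t))))).
    { intros t. reflexivity. }
    auto_derive.
    + repeat split; eexists; eassumption.
    + assert (e1 : Derive (fun t : R => f1 t) y = W12 x y) by exact (is_derive_unique _ _ _ D1).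
      assert (e2 : Derive (fun t : R => f2 t) y = W22 x y) by exact (is_derive_unique _ _ _ D2).
      rewrite e1, e2. unfold v1, f1, f2. ring.
  - intros x y.
    assert (A := ang_c _ _ _ _ _ _ HA x y).
    assert (A1 := ang_c1 _ _ _ _ _ _ HA x y). assert (A2 := ang_c2 _ _ _ _ _ _ HA x y).
    assert (A11 := ang_c11 _ _ _ _ _ _ HA x y). assert (A12 := ang_c12 _ _ _ _ _ _ HA x y).
    assert (A22 := ang_c22 _ _ _ _ _ _ HA x y). unfold v1, v11, E. cont2.
  - intros x. unfold v1. now rewrite (ang_per1 _ _ _ _ _ _ HA), (ang_per2 _ _ _ _ _ _ HA).
  - intros x y Hx Hy. specialize (Heq x y Hx Hy). fold (W x y) in Heq.
    assert (Hs : 0 < sin x) by now apply sin_gt_0.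
    assert (Ex := exp_pos (d * W x y)).
    (* The equation solved for the second longitude derivative; with g d = 2 this substitution makes
       the remaining claim a polynomial identity. *)
    assert (Hq : d * W22 x y = sin x ^ 2 * (E x y + 2) - sin x ^ 2 * v11 x y - sin x * cos x * v1 x y).
    { unfold E, v1, v11, w. rewrite <- Hg.
      replace (W22 x y) with (sin x ^ 2 * (c * exp (d * W x y) + g) - sin x ^ 2 * W11 x y
        - sin x * cos x * W1 x y + 2 * omega * cos x * sin x ^ 2) by lra. ring. }
    rewrite Hq.
    match goal with |- 0 < ?e => replace e with (sg * sg * sin x ^ 4 * exp (d * W x y)) end.
    { apply Rmult_lt_0_compat; [|exact Ex]. apply Rmult_lt_0_compat; [|now apply pow_lt].
      nra. }
    unfold E, v1, sg. ring.
Qed.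

Theorem theorem0p3 (c d g omega : R) (hc : c <> 0) (hvarpi : omega * d <> 0) :
  let C := g * d in
  let varpi := omega * d in
  (C < 0 -> (has_solution c d g omega <-> c * d > 0)) /\
  (C = 0 -> ~ has_solution c d g omega) /\
  (0 < C < 2 -> (has_solution c d g omega <-> c * d < 0)) /\
  (C = 2 -> ~ has_solution c d g omega) /\
  (2 < C < 13 / 6 ->
     c * d < 0 ->
     Rabs varpi < 2 * Rpower (C - 2) (3 / 2) * sqrt (11 - 5 * C) / (9 - 4 * C) ->
     has_solution c d g omega) /\
  (13 / 6 <= C < 4 ->
     c * d < 0 ->
     Rabs varpi < C - 2 ->
     has_solution c d g omega).
Proof.
  intros C varpi.
  assert (hd : d <> 0) by (intros ->; apply hvarpi; ring).
  assert (hcd : c * d <> 0) by now apply Rmult_integral_contrapositive_currified.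
  assert (Hneg : 0 < C < 4 -> C <> 2 -> c * d < 0 -> has_solution c d g omega).
  { intros HC HC2 Hcd. apply (has_solution_of_axial_bvp (-1)); auto.
    - replace (-1 / (c * d)) with (/ (- (c * d))) by (field; lra).
      apply Rinv_0_lt_compat. lra.
    - now apply axial_bvp_neg. }
  repeat split.
  - intros Hs. destruct (Rtotal_order (c * d) 0) as [Hcd|[Hcd|Hcd]]; [|lra|lra].
    (* Both (-d) c and (-d) g = -C are positive here. *)
    exfalso. revert Hs. apply (no_solution_same_sign c d g omega (- d)); [lra|unfold C in *; lra].
  - intros Hcd. apply (has_solution_of_axial_bvp 1); auto.
    + now apply Rdiv_lt_0_compat; [lra|].
    + now apply axial_bvp_pos.
  (* As d is not 0, C = 0 means g = 0, and c itself is a multiplier of the right sign. *)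
  - intros HC. apply (no_solution_same_sign c d g omega c); [nra|].
    destruct (Rmult_integral _ _ HC) as [->|]; [lra|contradiction].
  - intros Hs. destruct (Rtotal_order (c * d) 0) as [Hcd|[Hcd|Hcd]]; [lra|lra|].
    exfalso. revert Hs. apply (no_solution_same_sign c d g omega d); [lra|unfold C in *; lra].
  - intros Hcd. apply Hneg; lra.
  - intros HC. now apply no_solution_critical.
  - intros HC Hcd _. apply Hneg; lra.
  - intros HC Hcd _. apply Hneg; lra.
Qed.
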